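(* Let $n\in\mathbb{N}$, let $[\cdot]_\beta$ be the unnormalised expectation of the $\mathbb{S}^n_+$ model on $\Lambda$, and let $\mathbb{E}_{i,\boldsymbol{\ell}}$ be the expectation of the vertex-diminished jump process (VDJP). Let $g\colon(0,1]^\Lambda\to\mathbb{R}$ be a smooth compactly supported function, let $a\in\Lambda$, and let $s\in(-\frac\pi2,\frac\pi2)$. Then $$\Big[\mathbb{E}_{a,\boldsymbol{z}}\big(g(\boldsymbol{L}_{\tau(\cos s)})1_{\{\tau(\cos s)<\zeta\}}\big)\,\delta_{u_0}(u_a)\Big]_\beta=\Big[g(\boldsymbol{z})\,\delta_{\theta_su_0}(u_a)\Big]_\beta,$$ where $\tau(\gamma)=\inf\{t\mid L_t^a\le\gamma\}$ and $u_0=(1,0,\dots,0)\in\mathbb{S}^n_+$.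
   Context: $\Lambda$ is a finite set and $\beta=(\beta_{ij})_{i,j\in\Lambda}$ are edge weights with $\beta_{ij}=\beta_{ji}\ge0$ such that the graph with vertex set $\Lambda$ and edge set $\{\{i,j\}\mid\beta_{ij}>0\}$ is connected. Bold symbols denote objects indexed by $\Lambda$. Hemisphere: write points of $\mathbb{R}^{n+1}$ as $u=(u^0,u^1,\dots,u^n)$ with Euclidean inner product, $z=u^0$, $x=u^1$. $\mathbb{S}^n_+=\{u\in\mathbb{R}^{n+1}\mid u\cdot u=1,\ z>0\}$ is parametrised by the open unit ball of $\mathbb{R}^n$ via $(u^1,\dots,u^n)$, $z(u)=\sqrt{1-(u^1)^2-\dots-(u^n)^2}$, and carries the measure $du=du^1\cdots du^n/z(u)$. For $\boldsymbol{u}\in(\mathbb{S}^n_+)^\Lambda$ let $H_\beta(\boldsymbol{u})=\frac14\sum_{i,j\in\Lambda}\beta_{ij}(u_i-u_j)\cdot(u_i-u_j)$ and $[F]_\beta=\int_{(\mathbb{S}^n_+)^\Lambda}F(\boldsymbol{u})e^{-H_\beta(\boldsymbol{u})}\prod_{i\in\Lambda}du_i$. For $v\in\mathbb{S}^n_+$, $[F\,\delta_v(u_a)]_\beta$ is the expectation with the spin at $a$ fixed to be $v$: $\int_{(\mathbb{S}^n_+)^{\Lambda\setminus\{a\}}}F(\boldsymbol{u})e^{-H_\beta(\boldsymbol{u})}\prod_{i\ne a}du_i$ with $u_a=v$. $\theta_s$ is rotation by $s$ in the $xz$-plane, so $\theta_su_0=(\cos s,\sin s,0,\dots,0)$. VDJP: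 with initial condition $(v,\boldsymbol{L}_0)\in\Lambda\times(0,1]^\Lambda$, the process has $X_0=v$, jump rates $\mathbb{P}_{v,\boldsymbol{L}_0}[X_{t+dt}=j\mid(X_s)_{s\le t},X_t=i]=\beta_{ij}L_t^j\,dt$, where $L_t^j=L_0^j-\int_0^t1_{X_s=j}\,ds$, and is stopped at the time $\zeta=\inf\{s\mid\exists j\in\Lambda:\ L_s^j\le0\}$. *)

(* Defs.v *)
From HB Require Import structures.
From mathcomp Require Import all_boot all_order all_algebra.
From mathcomp Require Import all_classical all_reals all_analysis.
Set Implicit Arguments.
Unset Strict Implicit.
Unset Printing Implicit Defensive.
Import Order.TTheory GRing.Theory Num.Theory.
Import numFieldNormedType.Exports.
Local Open Scope classical_set_scope.
Local Open Scope ring_scope.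

Section cons_measure.
Context d (T : measurableType d) (R : realType) (n : nat).
Variables (mu : {sigma_finite_measure set T -> \bar R})
          (nu : {sigma_finite_measure set n.-tuple T -> \bar R}).

Definition cons_pair (p : T * n.-tuple T) : n.+1.-tuple T :=
  [tuple of p.1 :: p.2].

Lemma measurable_cons_pair : measurable_fun [set: T * n.-tuple T] cons_pair.
Proof. exact: measurable_cons. Qed.

Definition cons_measure := pushforward (mu \x nu)%E cons_pair.

Let cons_measure0 : cons_measure set0 = 0%E.
Proof. by rewrite /cons_measure /pushforward preimage_set0 measure0. Qed.

Let cons_measure_ge0 A : (0 <= cons_measure A)%E.
Proof. by rewrite /cons_measure /pushforward; exact: measure_ge0. Qed.

Let cons_measure_semi_sigma_additive : semi_sigma_additive cons_measure.
Proof.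
move=> F mF tF mUF; rewrite /cons_measure /pushforward preimage_bigcup.
have mP i : measurable (cons_pair @^-1` F i).
  by rewrite -[X in measurable X]setTI; exact: measurable_cons_pair.
apply: measure_semi_sigma_additive => //; last exact: bigcup_measurable.
apply/trivIsetP => /= i j _ _ ij; rewrite -preimage_setI.
by move/trivIsetP : tF => /(_ _ _ _ _ ij) ->//; rewrite preimage_set0.
Qed.

HB.instance Definition _ := isMeasure.Build _ _ _ cons_measure
  cons_measure0 cons_measure_ge0 cons_measure_semi_sigma_additive.

Let cons_measure_sigma_finite : sigma_finite setT cons_measure.
Proof.
have /sigma_finiteP[F [TF ndF Foo]] := sigma_finiteT mu.
have /sigma_finiteP[G [TG ndG Goo]] := sigma_finiteT nu.
pose unc (t : n.+1.-tuple T) : T * n.-tuple T := (thead t, [tuple of behead t]).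
have munc : measurable_fun setT unc.
  apply/measurable_fun_pair; [exact: measurable_tnth|exact: measurable_behead].
have consK p : unc (cons_pair p) = p.
  by case: p => x t; congr pair => //; apply/val_inj.
exists (fun k => unc @^-1` (F k `*` G k)).
  apply/esym; rewrite -subTset => t _.
  have [k _ Fk] : (\bigcup_k F k) (unc t).1 by rewrite -TF.
  have [l _ Gl] : (\bigcup_k G k) (unc t).2 by rewrite -TG.
  exists (maxn k l) => //; split.
  - by move: (unc t).1 Fk; exact/subsetPset/ndF/leq_maxl.
  - by move: (unc t).2 Gl; exact/subsetPset/ndG/leq_maxr.
move=> k; have [mF Fk] := Foo k; have [mG Gk] := Goo k; split.
  by rewrite -[X in measurable X]setTI; apply: munc => //; exact: measurableX.
rewrite /cons_measure /pushforward -comp_preimage.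
rewrite (_ : unc \o cons_pair = id); last exact/funext.
by rewrite preimage_id product_measure1E// lte_mul_pinfty// ge0_fin_numE.
Qed.

HB.instance Definition _ := Measure_isSigmaFinite.Build _ _ _ cons_measure
  cons_measure_sigma_finite.

End cons_measure.

Fixpoint power_measure d (T : measurableType d) (R : realType)
    (mu : {sigma_finite_measure set T -> \bar R}) (n : nat) :
    {sigma_finite_measure set n.-tuple T -> \bar R} :=
  match n with
  | 0 => @dirac _ (0.-tuple T) [tuple] R
  | m.+1 => cons_measure mu (power_measure mu m)
  end.

Definition lebesgueRn (R : realType) (n : nat) :
    {sigma_finite_measure set n.-tuple (measurableTypeR R) -> \bar R} :=
  power_measure (@lebesgue_measure R) n.

(* The spin [u = (u^0, .., u^n)] is the tuple [u] with [u`_k = u^k]. *)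
Notation spin R n := (n.+1.-tuple R).

Section hemisphere.
Context (R : realType).

Definition zcoord n (u : spin R n) : R := u`_0.

Definition sqdist n (u v : spin R n) : R := \sum_(k < n.+1) (tnth u k - tnth v k) ^+ 2.

Definition open_ball n : set (n.-tuple R) :=
  [set y : n.-tuple R | \sum_(k < n) tnth y k ^+ 2 < 1].

Definition hemi n (y : n.-tuple R) : spin R n :=
  [tuple of Num.sqrt (1 - \sum_(k < n) tnth y k ^+ 2) :: y].

Definition spin0 n : spin R n := [tuple ((k : nat) == 0%N)%:R | k < n.+1].

Definition rotation n (s : R) (u : spin R n) : spin R n :=
  [tuple if (k : nat) == 0%N then cos s * u`_0 - sin s * u`_1
         else if (k : nat) == 1%N then sin s * u`_0 + cos s * u`_1
         else u`_k | k < n.+1].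

Context (Lam : finType) (beta : Lam -> Lam -> R) (n : nat).

Definition energy (u : Lam -> spin R n) : R :=
  4^-1 * \sum_i \sum_j beta i j * sqdist (u i) (u j).

(* The sites other than [a] are numbered by [enum_rank]; the [k]-th of them
   carries the spin with ball coordinates [tnth y k]. *)
Definition pinned_config (a : Lam) (v : spin R n)
    (y : #|{: {i : Lam | i != a}}|.-tuple (n.-tuple R)) : Lam -> spin R n :=
  fun i => match insub i : option {i : Lam | i != a} with
           | Some k => hemi (tnth y (enum_rank k))
           | None => v
           end.

(* [[F delta_v(u_a)]_beta]; the factors [zcoord^-1] are the density of [du]
   with respect to [du^1..du^n]. *)
Definition pinned_expectation (a : Lam) (v : spin R n)
    (F : (Lam -> spin R n) -> R) : R :=
  \int[power_measure (lebesgueRn R n) #|{: {i : Lam | i != a}}|]_(y in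
        [set y | forall k, open_ball (tnth y k)])
    (F (pinned_config v y) * expR (- energy (pinned_config v y))
      * \prod_k (zcoord (hemi (tnth y k)))^-1).

End hemisphere.

Section vdjp.
Context (R : realType) (Lam : finType) (beta : Lam -> Lam -> R).
Context d (Om : measurableType d) (X : R -> Om -> Lam).

Definition diminished (l0 : Lam -> R) (t : R) (w : Om) : Lam -> R :=
  fun j => l0 j - \int[@lebesgue_measure R]_(s in `[0, t]) (X s w == j)%:R.

(* Times of first passage take values in the extended reals, so that the
   infimum of the empty set is [+oo]. *)
Definition lifetime (l0 : Lam -> R) (w : Om) : \bar R :=
  ereal_inf [set t%:E | t in
    [set t : R | 0 <= t /\ exists j, diminished l0 t w j <= 0]].

Definition hitting_time (l0 : Lam -> R) (a : Lam) (gamma : R) (w : Om) : \bar R :=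
  ereal_inf [set t%:E | t in [set t : R | 0 <= t /\ diminished l0 t w a <= gamma]].

Definition past_event (t : R) : set (set Om) :=
  [set B | exists (r : R) i, 0 <= r <= t /\ B = [set w | X r w = i]].

(* The law [P_(v, l0)] of the process started from [(v, l0)]. The rate
   condition [P[X_(t+dt) = j | (X_s)_(s <= t), X_t = i] = beta_ij L_t^j dt] is
   integrated over an arbitrary event [A] of [sigma(X_r, r <= t)]. Being a statement
   about right derivatives, it does not see jumps at deterministic times;
   these are excluded by continuity in probability. *)
Record is_vdjp (v : Lam) (l0 : Lam -> R) (P : probability Om R) : Prop := {
  vdjp_measurable : forall (t : R) i, 0 <= t -> measurable [set w | X t w = i] ;
  vdjp_right_continuous : forall w (t : R), 0 <= t ->
    \forall h \near 0^'+, X (t + h) w = X t w ;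
  vdjp_left_limits : forall w (t : R), 0 < t ->
    exists i, \forall h \near 0^'+, X (t - h) w = i ;
  vdjp_continuous_in_probability : forall t : R, 0 < t ->
    P [set w | X (t - h) w <> X t w] @[h --> 0^'+] --> 0%E ;
  vdjp_start : {ae P, forall w, X 0 w = v} ;
  vdjp_rate : forall (t : R) i j (A : set Om), 0 <= t -> i != j ->
    <<s past_event t >> A ->
    h^-1 * fine (P (A `&` [set w | (t%:E < lifetime l0 w)%E /\
                                   X t w = i /\ X (t + h) w = j]))
      @[h --> 0^'+] -->
    \int[P]_(w in A `&` [set w | (t%:E < lifetime l0 w)%E /\ X t w = i])
      (beta i j * diminished l0 t w j) ;
  vdjp_stopped : {ae P, forall w, forall t, (lifetime l0 w <= t%:E)%E ->
    X t w = X (fine (lifetime l0 w)) w}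
}.

End vdjp.

Section smooth.
Context (R : realType) (Lam : finType).

Definition unit_cube : set (Lam -> R) := [set l | forall j, 0 < l j <= 1].

Definition partial (j : Lam) (f : (Lam -> R) -> R) : (Lam -> R) -> R :=
  fun l => derive1 (fun t : R => f [eta l with j |-> t]) (l j).

Definition smooth_on (U : set (Lam -> R)) (f : (Lam -> R) -> R) : Prop :=
  forall (js : seq Lam) (l : Lam -> R), U l ->
    {for l, continuous (foldr partial f js : {ptws Lam -> R} -> R)} /\
    forall j, derivable (fun t : R => foldr partial f js [eta l with j |-> t])
                        (l j) 1.

Definition smooth_on_cube (g : (Lam -> R) -> R) : Prop :=
  exists (U : set {ptws Lam -> R}) (f : (Lam -> R) -> R),
    [/\ open U, unit_cube `<=` U, smooth_on U f &
        forall l, unit_cube l -> f l = g l].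

(* The support is the closure of [{g <> 0}] relative to [(0,1]^Lam]. *)
Definition compactly_supported_on_cube (g : (Lam -> R) -> R) : Prop :=
  compact ((unit_cube : set {ptws Lam -> R}) `&`
           closure ([set l | unit_cube l /\ g l <> 0] : set {ptws Lam -> R})).

End smooth.

(* Main.v *)
Require Import Defs.
From HB Require Import structures.
From mathcomp Require Import all_boot all_order all_algebra.
From mathcomp Require Import all_classical all_reals all_analysis.
Set Implicit Arguments.
Unset Strict Implicit.
Unset Printing Implicit Defensive.
Import Order.TTheory GRing.Theory Num.Theory.
Import numFieldNormedType.Exports.
From mathcomp Require Import measurable_realfun.
From mathcomp Require Import lra ring.
Local Open Scope classical_set_scope.
Local Open Scope ring_scope.

(** Let [F_i l] be the expectation of [g] at the time when the local time left
    at [a] falls to [cos s], for the process started from [(i, l)]. It solves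
    the backward equation [d/dl_i F_i = sum_j beta_ij l_j (F_j - F_i)].
    Conversely, the solution [F] of this equation given by Picard iteration
    makes [F_(X_t) L_t] a martingale up to that time, whence
    [E_(a,z) (g(L_tau) 1_(tau < zeta)) = F_a z].

    Put [Q l = 1/2 sum_ij beta_ij l_i l_j]. Then
    [d/dl_i (e^Q F_i) = sum_j beta_ij l_j (e^Q F_j)]; as [e^(-H)] is, up to a
    constant, the exponential of the sum of [Q] over all spin components, the
    infinitesimal rotation in the [xz]-plane of the spin at [i] sends
    [e^(-H) F_i] to [sum_j beta_ij (z_i x_j F_i - x_i z_j F_j) e^(-H)]. These
    expressions are antisymmetric, so they sum to zero over [i], and for
    [i <> a] each one integrates to zero, because [F_i] vanishes at the boundary
    of the hemisphere. Hence the one with [i = a] integrates to zero too, that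
    is, [[F_a(z) delta_(theta_t u_0)(u_a)]_beta] does not depend on [t] between
    [0] and [s]. At [t = 0] it is the left-hand side, and at [t = s] the process
    is already stopped. *)

(** The process is known only through right-hand rates at deterministic times, tested against events
    of the past; neither a Markov property nor regularity in the initial condition comes with it. A
    right derivative determines a function only together with continuity from the left; this comes
    from a bound of order [h] on the probability of a jump within time [h], uniform in the starting
    time.

    Compact support inside [(0,1]^Lam] leaves a margin [eps]: [g] is 0 once a coordinate is at most
    [eps], and Picard iteration preserves this for the coordinates other than [a]. The margin makes
    killing at [zeta] automatic and keeps [1/z] bounded wherever the integrands are nonzero.

    At [a] the equation starts from [l_a = gam = cos s], below which [F_a] is constant in [l_a]. The
    equation at [a] is available only strictly above [gam], so paths about to reach [gam], and the
    angle [t = s], are treated separately. *)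

Lemma near_right_ex (R : realType) (Q : R -> Prop) :
  (\forall h \near 0^'+, Q h) -> exists2 d : R, 0 < d & forall h : R, 0 < h < d -> Q h.
Proof.
case=> d /= d0 H; exists d => // h /andP[h0 hd]; apply: H => //=.
by rewrite /ball_ /= sub0r normrN gtr0_norm.
Qed.

Lemma near_right_of (R : realType) (Q : R -> Prop) d :
  0 < d -> (forall h : R, 0 < h < d -> Q h) -> \forall h \near 0^'+, Q h.
Proof.
move=> d0 H; exists d => //= h /=; rewrite sub0r normrN => hd h0.
by apply: H; rewrite h0 -(gtr0_norm h0).
Qed.

(** A mean value inequality for right-hand rates. The first hypothesis carries an inequality to the
    right of a point, the second forbids an upward jump when a point is reached from the left. *)
Lemma growth_le (R : realType) (f : R -> R) (u v C : R) : u <= v ->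
  (forall t, u <= t < v -> forall e, 0 < e ->
     \forall h \near 0^'+, f (t + h) - f t <= (C + e) * h) ->
  (forall t, u < t <= v -> forall e, 0 < e ->
     \forall h \near 0^'+, f t - f (t - h) <= e) ->
  f v - f u <= C * (v - u).
Proof.
move=> uv fr fl; apply/ler_addgt0Pl => e e0.
have [uv0|uv0] := leP (v - u) 0.
  have -> : v = u by apply/eqP; rewrite eq_le uv -subr_le0 uv0.
  by rewrite !subrr mulr0 addr0 ltW.
pose e' := e / (v - u).
have e'0 : 0 < e' by rewrite divr_gt0.
rewrite (_ : e + _ = (C + e') * (v - u)); last first.
  by rewrite mulrDl /e' divfK ?gt_eqF// addrC.
(* The slope [e'] spends the allowance [e] over the whole interval. At the supremum [c] of the times
   up to which [psi <= 0], the left condition gives [psi c <= 0], and the right condition would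
   carry the inequality beyond [c] if [c < v]. *)
pose psi t := f t - f u - (C + e') * (t - u).
suff : psi v <= 0 by rewrite subr_le0.
pose S := [set t | u <= t <= v /\ forall s, u <= s <= t -> psi s <= 0].
have psiu : psi u = 0 by rewrite /psi !subrr mulr0 subrr.
have Su : S u.
  split; first by rewrite lexx uv.
  by move=> s su; rewrite (_ : s = u) ?psiu//; apply: le_anti; rewrite andbC.
have supS : has_sup S.
  by split; [exists u|exists v => t [/andP[]]].
pose c := sup S.
have uc : u <= c by apply: sup_upper_bound.
have cv : c <= v by apply: ge_sup => //; [exists u|move=> t [/andP[]]].
have below s : u <= s < c -> psi s <= 0.
  move=> /andP[us sc].
  have [t St] := sup_adherent (eps := c - s) ltac:(by rewrite subr_gt0) supS.
  rewrite subKr => st; case: St => _; apply; rewrite us ltW//.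
have psic : psi c <= 0.
  have [->|cu] := eqVneq c u; first by rewrite psiu.
  have {}cu : u < c by rewrite lt_neqAle eq_sym cu.
  apply/ler_addgt0Pl => e2 e20; rewrite addr0.
  have e220 : 0 < e2 / 2 by rewrite divr_gt0.
  have /near_right_ex[d d0 H] := fl c ltac:(by rewrite cu cv) _ e220.
  pose K := `|C + e'| + 1.
  have K0 : 0 < K by rewrite ltr_wpDl.
  pose h := Num.min (d / 2) (Num.min ((c - u) / 2) (e2 / 2 / K)).
  have h0 : 0 < h by rewrite !lt_min !divr_gt0// subr_gt0.
  have hd : h < d.
    by rewrite (@le_lt_trans _ _ (d / 2)) ?ge_min ?lexx// ltr_pdivrMr//; lra.
  have hcu : h <= (c - u) / 2 by rewrite /h !ge_min lexx !orbT.
  have hK : h * K <= e2 / 2 by rewrite -ler_pdivlMr// /h !ge_min lexx !orbT.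
  have := H h ltac:(by rewrite h0 hd) => Hh.
  have := below (c - h) ltac:(apply/andP; split; lra).
  rewrite /psi => B.
  have : - (C + e') * h <= h * K.
    rewrite mulrC ler_pM2l// /K -normrN (le_trans (ler_norm _))// lerDl//.
  lra.
have [vc|cltv] := leP v c.
  by rewrite (_ : v = c)//; apply/eqP; rewrite eq_le vc cv.
have /near_right_ex[d d0 H] := fr c ltac:(by rewrite uc cltv) _ e'0.
pose h := Num.min (d / 2) (v - c).
have h0 : 0 < h by rewrite lt_min subr_gt0 cltv divr_gt0.
have hd : h <= d / 2 by rewrite ge_min lexx.
have hv : h <= v - c by rewrite ge_min lexx orbT.
have : c + h <= c.
  apply: sup_upper_bound => //; split; first by apply/andP; split; lra.
  move=> s /andP[us sch].
  have [sc|sc] := ltP s c; first by apply: below; rewrite us.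
  have [->//|sc'] := eqVneq s c.
  have {}sc : c < s by rewrite lt_neqAle eq_sym sc' sc.
  have := H (s - c) ltac:(apply/andP; split; lra).
  rewrite [c + _]addrC subrK; move: psic; rewrite /psi; lra.
lra.
Qed.

(** * Uniformly continuous functions of finitely many coordinates *)

Section ucont.
Context {R : realType} {Lam : finType}.
Implicit Types (l : Lam -> R) (f : (Lam -> R) -> R).

Definition ucont f := forall e : R, 0 < e -> exists2 d : R, 0 < d &
  forall l l', (forall j, `|l j - l' j| <= d) -> `|f l - f l'| <= e.

Definition upd l (i : Lam) (r : R) : Lam -> R := fun j => if j == i then r else l j.

Lemma ucont_continuous f (V : topologicalType) (phi : Lam -> V -> R) (x : V) :
  ucont f -> (forall j, {for x, continuous (phi j)}) ->
  {for x, continuous (fun v => f (phi^~ v))}.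
Proof.
move=> uf cphi; apply/cvgrPdist_le => e e0.
have [d d0 fd] := uf _ e0.
have H : \forall v \near x, forall j, `|phi j x - phi j v| <= d.
  by apply: filter_forall => j; move/cvgrPdist_le : (cphi j); exact.
by apply: filterS H => v Hv; exact: fd.
Qed.

(** The space [Lam -> R] is given no sigma-algebra, so the composite is treated directly: rounding
    all coordinates down to multiples of [1/(n+1)] leaves countably many values, and uniform
    continuity makes the rounded functions converge. *)
Lemma ucont_measurable f d (T : measurableType d) (phi : Lam -> T -> R) :
  ucont f -> (forall j, measurable_fun setT (phi j)) ->
  measurable_fun setT (fun w => f (phi^~ w)).
Proof.
move=> uf mphi.
pose g (c : {ffun Lam -> int}) (n : nat) : Lam -> R := fun j => (c j)%:~R / n.+1%:R.
pose fl n w : {ffun Lam -> int} := [ffun j => Num.floor (n.+1%:R * phi j w)].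
apply: (measurable_fun_cvg (h := fun n w => f (g (fl n w) n))) => [n|w _].
  move=> _ B mB; rewrite setTI.
  rewrite (_ : _ @^-1` _ = \bigcup_(c in [set c | B (f (g c n))])
      [set w | fl n w = c]); last first.
    apply/seteqP; split=> [w Bw|w [c Bc wc]]; first by exists (fl n w).
    by rewrite /preimage /= wc.
  rewrite bigcup_mkcond; apply: countable_bigcupT_measurable => // c; case: ifP => // _.
  rewrite (_ : mkset _ = \bigcap_(j in [set: Lam])
      [set w | (c j)%:~R <= n.+1%:R * phi j w < (c j + 1)%:~R]); last first.
    apply/seteqP; split=> [w /= <- j _ /=|w H /=].
      by rewrite ffunE floor_le lt_succ_floor.
      apply/ffunP => j; rewrite ffunE; apply: floor_def.
    by have := H j I.
  apply: fin_bigcap_measurable => // j _.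
  rewrite (_ : mkset _ = setT `&` (fun w => n.+1%:R * phi j w) @^-1`
     [set` `[(c j)%:~R, (c j + 1)%:~R[]); last first.
    by rewrite setTI; apply/seteqP; split=> w /=; rewrite in_itv.
  by apply: measurable_funM.
apply/cvgrPdist_le => e e0; have [dd d0 fd] := uf _ e0.
have H : \forall n \near \oo, n.+1%:R^-1 <= dd.
  have := @cvg_harmonic R; move=> /cvgrPdist_le/(_ _ d0).
  by apply: filterS => n; rewrite sub0r normrN ger0_norm// invr_ge0.
apply: filterS H => n nd; apply: fd => j; apply: le_trans nd.
rewrite /g ffunE.
have n0 : 0 < n.+1%:R :> R by rewrite ltr0n.
set y := n.+1%:R * phi j w.
have -> : phi j w - (Num.floor y)%:~R / n.+1%:R = (y - (Num.floor y)%:~R) / n.+1%:R.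
  by rewrite /y mulrBl mulrAC divff ?gt_eqF// mul1r.
rewrite normrM normfV (ger0_norm (ltW n0)); apply: ler_piMl; first by rewrite invr_ge0 ltW.
have := floor_le y; have := lt_succ_floor y; rewrite intrD => H1 H2.
by rewrite ler_norml; apply/andP; split; lra.
Qed.
End ucont.

(** * The backward equation *)

Section interval_integrals.
Context {R : realType}.
Notation mu := (@lebesgue_measure R).
Implicit Types f : R -> R.

Lemma continuous_itv_integrable f (x y : R) : continuous f ->
  mu.-integrable `[x, y] (EFin \o f).
Proof.
move=> cf; apply: continuous_compact_integrable; first exact: segment_compact.
exact: continuous_subspaceT.
Qed.

Lemma Rintegral_itv_gt f (x y : R) : y < x -> \int[mu]_(r in `[x, y]) f r = 0.
Proof. by move=> yx; rewrite set_itv_ge ?Rintegral_set0// -?ltNge ?bnd_simp -?ltNge. Qed.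

Lemma normr_Rintegral_le f f2 (x y : R) : continuous f -> continuous f2 ->
  (forall r, x <= r <= y -> `|f r| <= f2 r) ->
  `|\int[mu]_(r in `[x, y]) f r| <= \int[mu]_(r in `[x, y]) f2 r.
Proof.
move=> cf cf2 ff2; apply: (le_trans (le_normr_Rintegral _ _)) => //.
  exact: continuous_itv_integrable.
apply: le_Rintegral => //.
- apply: continuous_itv_integrable => r.
  by apply: continuous_comp; [exact: cf|exact: norm_continuous].
- exact: continuous_itv_integrable.
Qed.

Lemma normr_Rintegral_le_cst f (x y B : R) : continuous f -> x <= y ->
  (forall r, x <= r <= y -> `|f r| <= B) ->
  `|\int[mu]_(r in `[x, y]) f r| <= B * (y - x).
Proof.
move=> cf xy fB; apply: (le_trans (@normr_Rintegral_le f (cst B) _ _ _ _ _)) => //.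
  by move=> r; exact: cvg_cst.
rewrite (Rintegral_cst mu) // [X in _ * fine X](_ : _ = (y - x)%:E) //.
rewrite [LHS]lebesgue_measure_itv /= lte_fin; case: ltgtP xy => // -> _.
by rewrite subrr.
Qed.

(** The integral is unoriented, hence 0 for an endpoint below [g]; continued by 0 in this way it is
    still Lipschitz in the endpoint. *)
Lemma Rintegral_itv_lip f (g x y B : R) : continuous f ->
  (forall r, `|f r| <= B) ->
  `|\int[mu]_(r in `[g, x]) f r - \int[mu]_(r in `[g, y]) f r| <= B * `|x - y|.
Proof.
move=> cf fB; wlog xy : x y / x <= y => [H|].
  have [/H//|/ltW/H] := leP x y.
  by rewrite distrC [in leRHS]distrC.
have B0 : 0 <= B by exact: le_trans (fB 0).
have [yg|gy] := ltP y g.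
  rewrite !Rintegral_itv_gt ?(le_lt_trans xy)// subrr normr0 mulr_ge0//.
have [xg|gx] := ltP x g.
  rewrite (Rintegral_itv_gt _ xg) sub0r [`|x - y|]distrC [`|y - x|]ger0_norm ?subr_ge0//.
  rewrite -normrN opprK; apply: (@le_trans _ _ (B * (y - g))).
    exact: normr_Rintegral_le_cst.
  by rewrite ler_wpM2l// lerB// ltW.
rewrite distrC Rintegral_itvB//; last exact: continuous_itv_integrable.
rewrite Rintegral_itv_obnd_cbnd; last first.
  apply: (integrableS _ _ _ (continuous_itv_integrable x y cf)) => //.
  by apply: subset_itvr; rewrite bnd_simp.
rewrite [`|x - y|]distrC (ger0_norm (x := y - x)) ?subr_ge0//.
exact: normr_Rintegral_le_cst.
Qed.

(** Integrating the exponential weight gains the factor [1 / lam], the source of the contraction of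
    the Picard operator. *)
Lemma Rintegral_expR_le (lam s g x : R) : 0 < lam ->
  \int[mu]_(r in `[g, x]) expR (lam * (s + r)) <= expR (lam * (s + x)) / lam.
Proof.
move=> lam0; have e0 : 0 <= expR (lam * (s + x)) / lam.
  by rewrite divr_ge0 ?expR_ge0// ltW.
have [xg|] := ltP x g; first by rewrite Rintegral_itv_gt.
rewrite le_eqVlt => /predU1P[->|gx]; first by rewrite set_itv1 Rintegral_set1.
have dF (r : R) : is_derive r (1 : R) (fun r : R => expR (lam * (s + r)) / lam)
    (expR (lam * (s + r))).
  have d1 : is_derive r (1 : R) (fun r : R => lam * (s + r)) lam.
    by apply: is_derive_eq; rewrite /GRing.scale /= add0r mulr1.
  have d2 := @is_derive1_comp _ expR (fun r : R => lam * (s + r)) r _ _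
    (is_derive_expR (lam * (s + r))) d1.
  rewrite (_ : (fun r => _) = lam^-1 *: (expR \o (fun r : R => lam * (s + r))));
    last by apply/funext => x'; rewrite /= [RHS]mulrC.
  by apply: is_derive_eq; rewrite /GRing.scale /= mulrC mulfK ?gt_eqF.
have cF : continuous (fun r => expR (lam * (s + r)) / lam).
  by move=> r; apply/differentiable_continuous/derivable1_diffP/ex_derive.
rewrite /Rintegral (@continuous_FTC2 _ _ (fun r => expR (lam * (s + r)) / lam)) //.
- by rewrite -EFinB /= lerBlDr lerDl divr_ge0 ?expR_ge0// ltW.
- apply: continuous_subspaceT => r.
  apply: (@continuous_comp _ _ _ (fun r => lam * (s + r)) expR);
    last exact: continuous_expR.
  by apply: cvgM; [exact: cvg_cst|apply: cvgD; [exact: cvg_cst|exact: cvg_id]].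
- split.
  + by move=> r _; exact: ex_derive.
  + by apply: cvg_at_right_filter; exact: cF.
  + by apply: cvg_at_left_filter; exact: cF.
- by move=> r _; rewrite derive1E; exact: derive_val.
Qed.

End interval_integrals.

(** The increments between [k] and [m] add up to at most [C / 2^k - C / 2^m], so the sequence is
    Cauchy and the bound passes to the limit. *)
Lemma geometric_lim (R : realType) (u : nat -> R) (C : R) :
  (forall k, `|u k.+1 - u k| <= C / 2 ^+ k.+1) ->
  forall k, `|limn u - u k| <= C / 2 ^+ k.
Proof.
move=> uC.
have H k m : `|u (k + m)%N - u k| <= C / 2 ^+ k - C / 2 ^+ (k + m)%N.
  elim: m => [|m IH]; first by rewrite addn0 !subrr normr0.
  rewrite addnS (_ : _ - u k = (u (k + m).+1 - u (k + m)%N) + (u (k + m)%N - u k));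
    last by rewrite addrA subrK.
  rewrite (le_trans (ler_normD _ _))// (le_trans (lerD (uC _) IH))//.
  rewrite [C / 2 ^+ (k + m)%N](_ : _ = 2 * (C / 2 ^+ (k + m).+1)); last first.
    by rewrite exprS invfM; field; rewrite expf_neq0// pnatr_eq0.
  lra.
have C0 : 0 <= C by have := le_trans (normr_ge0 _) (uC 0%N); rewrite pmulr_lge0.
have Hk k m : (k <= m)%N -> `|u m - u k| <= C / 2 ^+ k.
  move=> km; rewrite -(subnKC km) (le_trans (H _ _))// gerBl.
  by rewrite divr_ge0// exprn_ge0.
have g0 : (fun k => C / 2 ^+ k) @ \oo --> 0.
  rewrite (_ : (fun _ => _) = geometric C (2^-1)).
    by apply: cvg_geometric; rewrite ger0_norm// invf_lt1// ltr1n.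
  by apply/funext => k; rewrite /geometric /= exprVn.
have cu : cvgn u.
  apply/cauchy_cvgP/cauchyP => e e0.
  move/cvgrPdist_lt/(_ _ e0) : (g0) => -[N _ HN].
  exists (u N); exists N => // m /= Nm; rewrite -ball_normE /= distrC.
  apply: le_lt_trans (Hk _ _ Nm) _.
  by have := HN N (leqnn N); rewrite sub0r normrN ger0_norm// divr_ge0// exprn_ge0.
move=> k; have cuk : `|u n - u k| @[n --> \oo] --> `|limn u - u k|.
  by apply: cvg_norm; apply: cvgB; [exact: cu|exact: cvg_cst].
apply: (cvgr_to_le cuk).
by exists k => // n /= kn; exact: Hk.
Qed.

Section bucont.
Context {R : realType} {Lam : finType}.
Implicit Types (l : Lam -> R) (f : (Lam -> R) -> R).
Notation mu := (@lebesgue_measure R).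

(** This class is stable under sums, products and integration in one coordinate, so all Picard
    iterates and their uniform limit stay in it. *)
Definition bucont f := ucont f /\ exists B : R, forall l, `|f l| <= B.

Lemma bucont_bound f : bucont f -> exists2 B : R, 0 < B & forall l, `|f l| <= B.
Proof.
move=> [_ [B fB]]; exists (`|B| + 1); first by rewrite ltr_wpDl.
by move=> l; apply: (le_trans (fB l)); rewrite ler_wpDr// ler_norm.
Qed.

Lemma bucont_cst c : bucont (fun=> c).
Proof.
split; last by exists `|c|.
by move=> e e0; exists 1 => // l l' _; rewrite subrr normr0 ltW.
Qed.

Lemma bucontD f1 f2 : bucont f1 -> bucont f2 -> bucont (fun l => f1 l + f2 l).
Proof.
move=> [u1 [B1 H1]] [u2 [B2 H2]]; split; last first.
  by exists (B1 + B2) => l; rewrite (le_trans (ler_normD _ _))// lerD.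
move=> e e0; have e20 : 0 < e / 2 by rewrite divr_gt0.
have [d1 d10 D1] := u1 _ e20; have [d2 d20 D2] := u2 _ e20.
exists (Num.min d1 d2); first by rewrite lt_min d10.
move=> l l' ll'; rewrite opprD addrACA [e]splitr (le_trans (ler_normD _ _))//.
by rewrite lerD//; [apply: D1|apply: D2] => j; have := ll' j;
  rewrite le_min => /andP[].
Qed.

Lemma bucontM f1 f2 : bucont f1 -> bucont f2 -> bucont (fun l => f1 l * f2 l).
Proof.
move=> b1 b2; have [B1 B10 H1] := bucont_bound b1; have [B2 B20 H2] := bucont_bound b2.
split; last first.
  by exists (B1 * B2) => l; rewrite normrM ler_pM.
move=> e e0; have e1 : 0 < e / 2 / B2 by rewrite !divr_gt0.
have e2 : 0 < e / 2 / B1 by rewrite !divr_gt0.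
have [d1 d10 D1] := b1.1 _ e1; have [d2 d20 D2] := b2.1 _ e2.
exists (Num.min d1 d2); first by rewrite lt_min d10.
move=> l l' ll'.
rewrite (_ : _ - _ = (f1 l - f1 l') * f2 l + f1 l' * (f2 l - f2 l')); last by ring.
rewrite [e]splitr (le_trans (ler_normD _ _))// lerD// normrM.
- rewrite -[leRHS](@divfK _ B2) ?gt_eqF// ler_pM// D1// => j; have := ll' j.
  by rewrite le_min => /andP[].
- rewrite -[leRHS](@divfK _ B1) ?gt_eqF// mulrC ler_pM// D2// => j; have := ll' j.
  by rewrite le_min => /andP[].
Qed.

Lemma bucontB f1 f2 : bucont f1 -> bucont f2 -> bucont (fun l => f1 l - f2 l).
Proof.
move=> b1 b2; rewrite (_ : (fun l => _) = (fun l => f1 l + (-1) * f2 l)).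
  by apply: bucontD => //; apply: bucontM => //; exact: bucont_cst.
by apply/funext => l; rewrite mulN1r.
Qed.

Lemma bucont_sum (I : Type) (s : seq I) (F : I -> (Lam -> R) -> R) :
  (forall i, bucont (F i)) -> bucont (fun l => \sum_(i <- s) F i l).
Proof.
move=> bF; elim: s => [|i s IH].
  by under eq_fun do rewrite big_nil; exact: bucont_cst.
by under eq_fun do rewrite big_cons; exact: bucontD.
Qed.

(* Local times lie in [[0, 1]]; truncating them at 2 makes the drift of the
   backward equation bounded without changing it near that range. *)
Definition clip2 (x : R) := Num.max 0 (Num.min 2 x).

Lemma clip2_ge0 x : 0 <= clip2 x.
Proof. by rewrite le_max lexx. Qed.

Lemma clip2_le2 x : clip2 x <= 2.
Proof. by rewrite ge_max ler0n ge_min lexx. Qed.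

Lemma clip2_id x : 0 <= x <= 2 -> clip2 x = x.
Proof.
by move=> /andP[x0 x2]; rewrite /clip2 (min_idPr x2) (max_idPr x0).
Qed.

Lemma clip2_lo x : x <= 0 -> clip2 x = 0.
Proof. by move=> x0; rewrite /clip2 (max_idPl _)// ge_min x0 orbT. Qed.

Lemma clip2_hi x : 2 <= x -> clip2 x = 2.
Proof. by move=> x2; rewrite /clip2 (min_idPl _)// (max_idPr _). Qed.

Lemma clip2_le x : 0 <= x -> clip2 x <= x.
Proof. by move=> x0; rewrite ge_max x0 ge_min lexx orbT. Qed.

Lemma clip2_lip x y : `|clip2 x - clip2 y| <= `|x - y|.
Proof.
wlog xy : x y / x <= y => [H|].
  have [/H//|/ltW/H] := leP x y.
  by rewrite distrC [in leRHS]distrC.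
rewrite distrC [leRHS]distrC (ger0_norm (x := y - x)) ?subr_ge0//.
rewrite ler_norml; apply/andP.
have [y0|y0] := leP y 0.
  by rewrite !clip2_lo ?(le_trans xy)//; split; lra.
have [x0|x0] := leP x 0; have [y2|y2] := leP 2 y; have [x2|x2] := leP 2 x;
  rewrite ?(clip2_lo x0) ?(clip2_hi x2) ?(clip2_hi y2) ?(@clip2_id x) ?(@clip2_id y);
  do ?[split|apply/andP]; lra.
Qed.

Lemma bucont_clip2 j : bucont (fun l => clip2 (l j)).
Proof.
split; last by exists 2 => l; rewrite ger0_norm ?clip2_ge0// clip2_le2.
by move=> e e0; exists e => // l l' ll'; apply: le_trans (ll' j); exact: clip2_lip.
Qed.

Lemma upd_upd l i x y : upd (upd l i x) i y = upd l i y.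
Proof. by apply/funext => j; rewrite /upd; case: eqP. Qed.

Lemma upd_id l i : upd l i (l i) = l.
Proof. by apply/funext => j; rewrite /upd; case: eqP => // ->. Qed.

Lemma bucont_upd_continuous f l i : bucont f -> continuous (fun r => f (upd l i r)).
Proof.
move=> bf r; apply: (ucont_continuous (phi := fun j r => upd l i r j)); first exact: bf.1.
move=> j; rewrite /upd; case: eqP => _; [exact: cvg_id|exact: cvg_cst].
Qed.

(** A change of [l] moves both the integrand and the endpoint, and each is charged [e / 2]. The
    interval has length at most 2, because [0 <= g] and [clip2] is at most 2. *)
Lemma bucont_Rintegral_upd f i (g : R) : bucont f -> 0 <= g ->
  bucont (fun l => \int[mu]_(r in `[g, clip2 (l i)]) f (upd l i r)).
Proof.
move=> bf g0; have [B B0 HB] := bucont_bound bf.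
have cf l : continuous (fun r => f (upd l i r)) by exact: bucont_upd_continuous.
have bd h (c x : R) : continuous h -> 0 <= c -> x <= 2 ->
    (forall r, g <= r <= x -> `|h r| <= c) ->
    `|\int[mu]_(r in `[g, x]) h r| <= c * 2.
  move=> ch c0 x2 hc; have [xg|gx] := ltP x g.
    by rewrite Rintegral_itv_gt// normr0 mulr_ge0.
  apply: (le_trans (normr_Rintegral_le_cst ch gx hc)).
  by rewrite ler_wpM2l//; lra.
split; last by exists (B * 2) => l; apply: bd => //; [exact: ltW|exact: clip2_le2].
move=> e e0; have e40 : 0 < e / 4 by rewrite divr_gt0.
have [d d0 D] := bf.1 _ e40.
exists (Num.min d (e / 2 / B)); first by rewrite lt_min d0 !divr_gt0.
move=> l l' ll'.
rewrite -(subrKA (\int[mu]_(r in `[g, clip2 (l i)]) f (upd l' i r))).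
rewrite [e]splitr (le_trans (ler_normD _ _))// lerD//.
  rewrite -RintegralB//; try exact: continuous_itv_integrable.
  rewrite (_ : e / 2 = e / 4 * 2); last by field.
  apply: bd => //; [|exact: ltW|exact: clip2_le2|].
    by move=> r; apply: cvgB; exact: cf.
  move=> r _; apply: D => j; rewrite /upd; case: eqP => _.
    by rewrite subrr normr0 ltW.
  by have := ll' j; rewrite le_min => /andP[].
apply: (le_trans (Rintegral_itv_lip (B := B) _ _ _ _ _)) => //.
rewrite mulrC -ler_pdivlMr// (le_trans (clip2_lip _ _))//.
by have := ll' i; rewrite le_min => /andP[].
Qed.

End bucont.

Section backward_equation.
Context {R : realType} {Lam : finType}.
Implicit Types (l : Lam -> R) (f : Lam -> (Lam -> R) -> R).
Notation mu := (@lebesgue_measure R).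
Variables (b : Lam -> Lam -> R) (b_ge0 : forall i j, 0 <= b i j) (a : Lam).
Variables (gam eps : R) (eps0 : 0 < eps) (epsgam : eps < gam).
Variables (g0 : (Lam -> R) -> R) (g0_bucont : bucont g0).
Hypothesis g0_vanish : forall l j, l j <= eps -> g0 l = 0.

Definition drift f i l := \sum_j b i j * clip2 (l j) * (f j l - f i l).

(** The coordinate value at which [F i] is prescribed; [b0] is the prescribed value. At [a] it is
    the freezing level [gam]. Elsewhere it is a level in []0, eps[], where [F i] vanishes; the gap
    between [eps / 2] and [eps] makes the region of vanishing overlap the region where the integral
    equation is differentiated. *)
Let gi i : R := if i == a then gam else eps / 2.
Let b0 i l := if i == a then g0 (upd l a gam) else 0.
(** For [l i] below [gi i] the interval is empty and the integral is 0, which freezes the iterates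
    there. *)
Let Kop f i l := \int[mu]_(r in `[gi i, clip2 (l i)]) drift f i (upd l i r).

Let gi_ge0 i : 0 <= gi i.
Proof.
by rewrite /gi; case: ifP => _; [rewrite ltW// (lt_trans eps0)|rewrite divr_ge0// ltW].
Qed.

Lemma bucont_drift f i : (forall j, bucont (f j)) -> bucont (drift f i).
Proof.
move=> bf; apply: bucont_sum => j; apply: bucontM; last exact: bucontB.
by apply: bucontM; [exact: bucont_cst|exact: bucont_clip2].
Qed.

Let bucont_Kop f i : (forall j, bucont (f j)) -> bucont (Kop f i).
Proof.
by move=> bf; apply: bucont_Rintegral_upd; [exact: bucont_drift|exact: gi_ge0].
Qed.

Let bucont_b0 i : bucont (b0 i).
Proof.
rewrite /b0; case: eqP => _; last exact: bucont_cst.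
split; last by have [B _ HB] := bucont_bound g0_bucont; exists B => l.
move=> e e0; have [d d0 D] := g0_bucont.1 _ e0; exists d => // l l' ll'.
by apply: D => j; rewrite /upd; case: eqP => // _; rewrite subrr normr0 ltW.
Qed.

(* In the norm [sup |f| / wt] the Picard operator contracts by [1/2]. *)
Let A := 4 * (\sum_i \sum_j b i j) + 1.
Let lam := 2 * A.

Let A_gt0 : 0 < A.
Proof.
by rewrite ltr_wpDl// mulr_ge0// sumr_ge0// => i _; rewrite sumr_ge0.
Qed.

Let wt l := expR (lam * \sum_j clip2 (l j)).

Let wt_ge1 l : 1 <= wt l.
Proof.
rewrite -expR0 ler_expR mulr_ge0 ?mulr_ge0 ?(ltW A_gt0)//.
by rewrite sumr_ge0// => j _; exact: clip2_ge0.
Qed.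



Let W := expR (lam * \sum_(j : Lam) 2).

Let wt_leW l : wt l <= W.
Proof.
rewrite ler_expR ler_wpM2l ?mulr_ge0 ?(ltW A_gt0)//.
by apply: ler_sum => j _; exact: clip2_le2.
Qed.

(** In [A] the factor 4 is a 2 from [clip2] times a 2 from the difference [f j - f i]; the summand 1
    keeps [A] positive when all weights vanish. *)
Let drift_bound f i l (B : R) : (forall j, `|f j l| <= B) -> `|drift f i l| <= A * B.
Proof.
move=> fB; have B0 : 0 <= B := le_trans (normr_ge0 _) (fB i).
apply: (le_trans (ler_norm_sum _ _ _)).
apply: (@le_trans _ _ (\sum_j b i j * (4 * B))).
  apply: ler_sum => j _.
  rewrite !normrM (ger0_norm (b_ge0 _ _)) (ger0_norm (clip2_ge0 _)) -mulrA.
  rewrite ler_wpM2l// (_ : 4 * B = 2 * (B + B)); last by ring.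
  rewrite ler_pM ?clip2_ge0 ?clip2_le2//.
  by rewrite (le_trans (ler_normB _ _))// lerD.
rewrite -mulr_suml mulrA ler_wpM2r// mulrC /A ler_wpDr// ler_wpM2l//.
rewrite [leRHS](bigD1 i)//= lerDl sumr_ge0// => k _.
by rewrite sumr_ge0.
Qed.

(** Along the coordinate [i] the weight is [expR (lam * (s + r))]. The drift costs a factor [A],
    integration gains [1 / lam], and [A / lam = 1/2]. *)
Let Kop_bound f (B : R) i l : (forall j, bucont (f j)) ->
  (forall j l, `|f j l| <= B * wt l) -> `|Kop f i l| <= B / 2 * wt l.
Proof.
move=> bf fB; have B0 : 0 <= B.
  have := le_trans (normr_ge0 _) (fB i l).
  by rewrite pmulr_lge0// (lt_le_trans _ (wt_ge1 l)).
pose s := \sum_(j | j != i) clip2 (l j).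
have wtE r : 0 <= r <= 2 -> wt (upd l i r) = expR (lam * (s + r)).
  move=> r02; rewrite /wt (bigD1 i)//= {1}/upd eqxx clip2_id// addrC.
  rewrite (_ : \sum_(j | j != i) _ = s)//; apply: eq_bigr => j /negbTE ji.
  by rewrite /upd ji.
apply: (@le_trans _ _ (\int[mu]_(r in `[gi i, clip2 (l i)])
    (A * B * expR (lam * (s + r))))).
  apply: normr_Rintegral_le.
  - by apply: bucont_upd_continuous; exact: bucont_drift.
  - move=> r; apply: cvgM; first exact: cvg_cst.
    apply: (@continuous_comp _ _ _ (fun r : R => lam * (s + r)) expR);
      last exact: continuous_expR.
    by apply: cvgM; [exact: cvg_cst|apply: cvgD; [exact: cvg_cst|exact: cvg_id]].
  - move=> r /andP[r1 r2]; rewrite -mulrA -wtE; last first.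
      by rewrite (le_trans (gi_ge0 i) r1)/= (le_trans r2)// clip2_le2.
    by apply: drift_bound => j; exact: fB.
rewrite RintegralZl//; last first.
  apply: continuous_itv_integrable => r.
  apply: (@continuous_comp _ _ _ (fun r : R => lam * (s + r)) expR);
      last exact: continuous_expR.
  by apply: cvgM; [exact: cvg_cst|apply: cvgD; [exact: cvg_cst|exact: cvg_id]].
apply: (@le_trans _ _ (A * B * (expR (lam * (s + clip2 (l i))) / lam))).
  by rewrite ler_wpM2l ?mulr_ge0 ?(ltW A_gt0)// Rintegral_expR_le// mulr_gt0.
rewrite -wtE ?clip2_ge0 ?clip2_le2//.
rewrite (_ : wt (upd l i (clip2 (l i))) = wt l); last first.
  rewrite /wt (_ : \sum_j clip2 (upd _ _ _ j) = \sum_j clip2 (l j))//.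
  apply: eq_bigr => j _; rewrite /upd.
  by case: eqP => // ->; rewrite clip2_id// clip2_ge0 clip2_le2.
rewrite le_eqVlt; apply/orP; left; apply/eqP; rewrite /lam; field.
by rewrite gt_eqF.
Qed.

Let KopB f1 f2 i l : (forall j, bucont (f1 j)) -> (forall j, bucont (f2 j)) ->
  Kop f1 i l - Kop f2 i l = Kop (fun j l => f1 j l - f2 j l) i l.
Proof.
move=> bf1 bf2; rewrite /Kop -RintegralB//; try by
  apply: continuous_itv_integrable; apply: bucont_upd_continuous; exact: bucont_drift.
apply: eq_Rintegral => r _; rewrite /drift -sumrB; apply: eq_bigr => j _; ring.
Qed.

Let Fk := fix Fk k i l := if k is k.+1 then b0 i l + Kop (Fk k) i l else b0 i l.

Let bucont_Fk k i : bucont (Fk k i).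
Proof.
elim: k i => [|k IH] i /=; first exact: bucont_b0.
by apply: bucontD => //; exact: bucont_Kop.
Qed.

(** Picard iteration in the weighted norm. Vanishing for small [l j] holds for every iterate and
    passes to the limit. Freezing at [a] is read off the fixed-point equation, whose integral runs
    over an empty or one-point interval when [l a <= gam]. The derivative is the fundamental theorem
    of calculus in the coordinate [i]. *)
Lemma backward_solution : exists F : Lam -> (Lam -> R) -> R,
  [/\ forall i, bucont (F i),
      forall i l j, j != a -> l j <= eps -> F i l = 0,
      forall l, l a <= gam -> F a l = g0 (upd l a gam) &
      forall i l, l i < 2 -> (i = a -> gam < l a) ->
        is_derive (l i) 1 (fun x => F i (upd l i x)) (drift F i l)].
Proof.
have [M M0 HM] := bucont_bound g0_bucont.
have b0M i l : `|b0 i l| <= M.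
  by rewrite /b0; case: eqP => // _; rewrite normr0 ltW.
have stepw k i l : `|Fk k.+1 i l - Fk k i l| <= M / 2 ^+ k.+1 * wt l.
  elim: k i l => [|k IH] i l.
    rewrite /= addrAC subrr add0r expr1; apply: Kop_bound => // j l'.
    by apply: (le_trans (b0M j l')); rewrite ler_peMr// ltW.
  rewrite [Fk k.+2]/= {2}/Fk -/Fk opprD addrACA subrr add0r KopB//.
  rewrite exprSr invfM mulrA; apply: Kop_bound => // j.
    by apply: bucontB; [exact: (bucont_Fk k.+1)|exact: bucont_Fk].
  exact: (bucont_Fk k.+1).
have step i l k : `|Fk k.+1 i l - Fk k i l| <= M * W / 2 ^+ k.+1.
  rewrite (le_trans (stepw _ _ _))// mulrAC ler_wpM2r ?invr_ge0 ?exprn_ge0//.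
  by rewrite ler_wpM2l// ltW.
pose F i l := limn (fun k => Fk k i l).
have FFk i l k : `|F i l - Fk k i l| <= M * W / 2 ^+ k.
  exact: geometric_lim (step i l) k.
have small e : 0 < e -> exists k, M * W / 2 ^+ k <= e.
  move=> e0; have : (fun k => M * W / 2 ^+ k) @ \oo --> 0.
    rewrite (_ : (fun _ => _) = geometric (M * W) (2^-1)).
      by apply: cvg_geometric; rewrite ger0_norm// invf_lt1// ltr1n.
    by apply/funext => k; rewrite /geometric /= exprVn.
  move=> /cvgrPdist_le/(_ _ e0)[N _ HN]; exists N.
  by have := HN N (leqnn N); rewrite sub0r normrN; apply: le_trans; exact: ler_norm.
have bF i : bucont (F i).
  split; last first.
    have [B B0 HB] := bucont_bound (bucont_Fk 0 i).
    exists (M * W / 2 ^+ 0 + B) => l; rewrite -(subrK (Fk 0 i l) (F i l)).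
    by rewrite (le_trans (ler_normD _ _))// lerD.
  move=> e e0; have e30 : 0 < e / 3 by rewrite divr_gt0.
  have [k Hk] := small _ e30; have [d d0 D] := (bucont_Fk k i).1 _ e30.
  exists d => // l l' ll'.
  rewrite (_ : _ - _ = (F i l - Fk k i l) + (Fk k i l - Fk k i l') +
    (Fk k i l' - F i l')); last by ring.
  rewrite (_ : e = e / 3 + e / 3 + e / 3); last by field.
  rewrite (le_trans (ler_normD _ _))// lerD//; last first.
    by rewrite distrC (le_trans (FFk _ _ _)).
  by rewrite (le_trans (ler_normD _ _))// lerD ?D// (le_trans (FFk _ _ _)).
(* Compared through the iterate [k]: [F - Fk k.+1] is small by convergence and [Kop (Fk k) - Kop F]
   by the contraction. Dividing by [W] compensates for the weight, which lies between 1 and [W]. *)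
have FE i l : F i l = b0 i l + Kop F i l.
  apply/eqP; rewrite -subr_eq0 -normr_le0; apply/ler_addgt0Pl => /= e e0; rewrite addr0.
  have MW0 : 0 < M * W by rewrite mulr_gt0 ?expR_gt0.
  have e2 : 0 < e / (2 * W) by rewrite divr_gt0// mulr_gt0// expR_gt0.
  have e1 : 0 < e / 2 by rewrite divr_gt0.
  have [k1 Hk1] := small _ e1; have [k2 Hk2] := small _ e2.
  pose k := maxn k1 k2.
  have mono m n : (m <= n)%N -> M * W / 2 ^+ n <= M * W / 2 ^+ m.
    move=> mn; rewrite ler_pM2l// lef_pV2 ?posrE ?exprn_gt0//.
    by rewrite ler_eXn2l// ltr1n.
  rewrite (_ : _ - _ = (F i l - Fk k.+1 i l) + (Kop (Fk k) i l - Kop F i l)); last first.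
    by rewrite /=; ring.
  rewrite (splitr e) (le_trans (ler_normD _ _))// lerD//.
    rewrite (le_trans (FFk _ _ _))// (le_trans _ Hk1)// mono//.
    by rewrite (leq_trans (leq_maxl k1 k2)).
  rewrite KopB//; apply: (@le_trans _ _ (e / (2 * W) / 2 * wt l)).
    apply: Kop_bound => [j|j l']; first by apply: bucontB.
    rewrite distrC (le_trans (FFk _ _ _))// (le_trans (mono _ _ (leq_maxr k1 k2)))//.
    by rewrite (le_trans Hk2)// ler_peMr// ltW.
  apply: (@le_trans _ _ (e / (2 * W) / 2 * W)).
    by rewrite ler_wpM2l// divr_ge0// ltW.
  rewrite (_ : e / (2 * W) / 2 * W = e / 4); last by field; rewrite gt_eqF// expR_gt0.
  by rewrite ler_pM2l// lef_pV2 ?posrE// ler_nat.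
have Fk0 k i l j : j != a -> l j <= eps -> Fk k i l = 0.
  move=> ja; elim: k i l => [|k IH] i l lj /=.
    rewrite /b0; case: eqP => // _; apply: (g0_vanish (j := j)).
    by rewrite /upd (negbTE ja).
  rewrite {1}/b0 (_ : (if _ then _ else _) = 0) ?add0r; last first.
    case: eqP => // _; apply: (g0_vanish (j := j)).
    by rewrite /upd (negbTE ja).
  (* If [i != j], integration leaves the coordinate [j] alone. If [i = j], the integration variable
     stays below [l j], or the interval is empty because [l j < 0 < gi j]. In all cases the previous
     iterate vanishes on it. *)
  suff K0 : {in `[gi i, clip2 (l i)]%classic, (fun r => drift (Fk k) i (upd l i r)) =1 cst 0}.
    transitivity (\int[mu]_(r in `[gi i, clip2 (l i)]) (cst 0 r)).
      by apply: eq_Rintegral => r rD; exact: K0.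
    by rewrite (Rintegral_cst mu)// mul0r.
  move=> r; rewrite inE /= in_itv /= => /andP[r1 r2].
  have uj : upd l i r j <= eps.
    rewrite /upd; case: eqP => // ji; rewrite -ji in r1 r2.
    have lj0 : 0 <= l j.
      rewrite leNgt; apply/negP => lj0; move: r1 r2; rewrite /gi (negbTE ja).
      by rewrite (clip2_lo (ltW lj0)); have := eps0; lra.
    by rewrite (le_trans r2)// (le_trans (clip2_le lj0)).
  by rewrite /drift big1// => m _; rewrite !IH// subrr mulr0.
exists F; split => //.
- move=> i l j ja lj; rewrite /F (_ : (fun k => _) = cst 0) ?lim_cst//.
  by apply/funext => k; rewrite (Fk0 _ _ _ _ ja).
- move=> l la; rewrite FE /b0 eqxx /Kop /gi eqxx.
  have cla : clip2 (l a) <= gam.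
    have [l0|l0] := leP 0 (l a); first by rewrite (le_trans (clip2_le l0)).
    by rewrite (clip2_lo (ltW l0)); have := eps0; have := epsgam; lra.
  move: cla; rewrite le_eqVlt => /predU1P[->|cla].
    by rewrite set_itv1 Rintegral_set1 addr0.
  by rewrite Rintegral_itv_gt// addr0.
- move=> i l li2 ia.
  (* Below [gi i], which forces [i != a], the coordinate is less than [eps] and [F i] is locally 0.
     Above it the integral equation is differentiated. *)
  have [lgi|lgi] := ltP (gi i) (l i); last first.
    have iNa : i != a.
      by apply/eqP => ia'; move: lgi; rewrite /gi ia' eqxx leNgt ia.
    have lie : l i < eps by rewrite (le_lt_trans lgi)// /gi (negbTE iNa); have := eps0; lra.
    have Fx0 x m : x <= eps -> F m (upd l i x) = 0.
      move=> xe; rewrite /F (_ : (fun k => _) = cst 0) ?lim_cst//.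
      by apply/funext => k; rewrite (Fk0 _ _ _ _ iNa)// /upd eqxx.
    have -> : drift F i l = 0.
      by rewrite /drift big1// => m _; rewrite -(upd_id l i) !Fx0 ?(ltW lie)// subrr mulr0.
    have F0near : \forall x \near l i, cst 0 x = F i (upd l i x).
      near=> x; rewrite Fx0//; apply: ltW; near: x; exact: lt_nbhsl.
    by apply: (near_eq_is_derive F0near); exact: is_derive_cst.
  have ph : {for l i, continuous (fun r => drift F i (upd l i r))}.
    by apply: bucont_upd_continuous; exact: bucont_drift.
  have [] := @continuous_FTC1_closed _ (fun r => drift F i (upd l i r)) (gi i) (l i) 2 li2
    _ lgi ph.
    by apply: continuous_itv_integrable; apply: bucont_upd_continuous; exact: bucont_drift.
  move=> dG G'; rewrite upd_id in G'.
  have lgi0 : 0 < l i by rewrite (le_lt_trans (gi_ge0 i)).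
  (* Near [l i], which lies strictly between 0 and 2, [clip2] is the identity. *)
  have FG : \forall x \near l i,
     b0 i l + \int[mu]_(r in `[gi i, x]) drift F i (upd l i r) = F i (upd l i x).
    near=> x; rewrite FE; congr (_ + _).
      by rewrite /b0; case: eqP => // ->; rewrite upd_upd.
    rewrite /Kop (_ : upd l i x i = x); last by rewrite /upd eqxx.
    rewrite clip2_id; last first.
      apply/andP; split; apply: ltW; near: x; [exact: lt_nbhsr|exact: lt_nbhsl].
    by apply: eq_Rintegral => r _; rewrite upd_upd.
  apply: (near_eq_is_derive FG).
  rewrite -[drift F i l]add0r; apply: is_deriveD.
  by apply: DeriveDef; [exact: dG|rewrite -derive1E; exact: G'].
Unshelve. all: by end_near. Qed.

End backward_equation.

(** * Occupation times *)

(** Time is rounded to a grid point strictly to its right, which leaves countably many times;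
    constancy to the right makes the rounded values eventually equal to the true one. *)
Lemma measurable_rcont_joint (R : realType) d (T : measurableType d) (phi : R -> T -> R) :
  (forall s, measurable_fun setT (phi s)) ->
  (forall w s, \forall h \near 0^'+, phi (s + h) w = phi s w) ->
  measurable_fun setT (fun p : T * measurableTypeR R => phi p.2 p.1).
Proof.
move=> mphi rphi.
pose e (n : nat) (k : int) : R := (k + 1)%:~R / n.+1%:R.
pose fl n (p : T * measurableTypeR R) := Num.floor (n.+1%:R * (p.2 : R)).
apply: (measurable_fun_cvg (h := fun n p => phi (e n (fl n p)) p.1)) => [n|[w s] _].
  move=> _ B mB; rewrite setTI.
  rewrite (_ : _ @^-1` _ = \bigcup_(k in [set: int])
      ([set w | B (phi (e n k) w)] `*`
       [set s : measurableTypeR R | k%:~R <= n.+1%:R * (s : R) < (k + 1)%:~R])); last first.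
    apply/seteqP; split=> [p Bp|[w s] [k _ [/= Bk ks]]].
      by exists (fl n p) => //; split => //=; rewrite floor_le lt_succ_floor.
    by rewrite /preimage /= /fl /= (floor_def ks).
  apply: countable_bigcupT_measurable => // k; apply: measurableX.
    by rewrite -[X in measurable X]setTI; exact: mphi.
  rewrite (_ : mkset _ = setT `&` (fun s : measurableTypeR R => n.+1%:R * (s : R)) @^-1`
     [set` `[k%:~R, (k + 1)%:~R[]); last first.
    by rewrite setTI; apply/seteqP; split=> r /=; rewrite in_itv.
  by apply: measurable_funM.
have /near_right_ex[d0 d00 Hd] := rphi w s.
apply/cvgrPdist_le => e0 e00.
have H : \forall n \near \oo, n.+1%:R^-1 < d0.
  have := @cvg_harmonic R; move=> /cvgrPdist_lt/(_ _ d00).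
  by apply: filterS => n; rewrite sub0r normrN ger0_norm// invr_ge0.
apply: filterS H => n nd /=.
suff -> : phi (e n (fl n (w, s))) w = phi s w by rewrite subrr normr0 ltW.
have -> : e n (fl n (w, s)) = (s : R) + (e n (fl n (w, s)) - (s : R)).
  by rewrite addrC subrK.
apply: Hd.
have n0 : 0 < n.+1%:R :> R by rewrite ltr0n.
have H1 := floor_le (n.+1%:R * s); have := lt_succ_floor (n.+1%:R * s).
rewrite /e /fl /=; set k := Num.floor _ in H1 *; rewrite intrD => H2.
rewrite subr_gt0 ltr_pdivlMr// mulrC H2/= (le_lt_trans _ nd)//.
rewrite lerBlDr ler_pdivrMr// mulrDl mulVf ?gt_eqF// [s * _]mulrC addrC lerD2l.
exact: H1.
Qed.

Section occupation_time.
Context {R : realType}.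
Notation mu := (@lebesgue_measure R).
Implicit Types (A B : R -> bool) (s t u h c : R).

Lemma lebesgue_itv_lty (b1 b2 : bool) t u :
  (mu [set` Interval (BSide b1 t) (BSide b2 u)] < +oo)%E.
Proof.
by rewrite [ltLHS]lebesgue_measure_itv/=; case: ifP => _; rewrite ?ltry// -EFinB ltry.
Qed.

Definition right_locally_constant (T : Type) (f : R -> T) :=
  forall t, 0 <= t -> \forall h \near 0^'+, f (t + h) = f t.

(** Joint measurability asks for constancy to the right at all real times, while the process is
    controlled only from time 0 on. Truncating time to [[0, u]] repairs this and involves no value
    after time [u]. *)
Lemma right_locally_constant_total (T : Type) (f : R -> T) (u : R) : 0 <= u ->
  right_locally_constant f -> forall s,
  \forall h \near 0^'+, f (Num.min (Num.max (s + h) 0) u) = f (Num.min (Num.max s 0) u).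
Proof.
move=> u0 rf s.
have [s0|s0] := ltP s 0.
  apply: (near_right_of (d := - s)); first by rewrite oppr_gt0.
  move=> h /andP[h0 hs]; rewrite max_r//.
  by rewrite -lerBrDl sub0r ltW.
have [su|us] := ltP s u; last first.
  apply: (near_right_of (d := 1)) => // h /andP[h0 _].
  have sh0 : 0 <= s + h by rewrite addr_ge0// ltW.
  have ush : u <= s + h by rewrite (le_trans us)// lerDl ltW.
  by rewrite (max_l sh0) (min_r ush).
have /near_right_ex[d d0 Hd] := rf _ s0.
apply: (near_right_of (d := Num.min d (u - s))); first by rewrite lt_min d0 subr_gt0.
move=> h /andP[h0]; rewrite lt_min => /andP[hd hu].
have sh0 : 0 <= s + h by rewrite addr_ge0// ltW.
have shu : s + h <= u by rewrite ltW// -ltrBrDl.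
by rewrite (max_l sh0) (min_l shu); apply: Hd; rewrite h0 hd.
Qed.

Definition occ A (t : R) := \int[mu]_(s in `[0, t]) (A s)%:R : R.

Lemma rlc_measurable A t : right_locally_constant A ->
  measurable_fun (`[0, t] : set (measurableTypeR R)) (fun s => (A s)%:R : R).
Proof.
move=> rA; have [t0|t0] := ltP t 0.
  by rewrite set_itv_ge ?bnd_simp -?ltNge//; exact: measurable_fun_set0.
pose phi s (_ : unit) : R := (A (Num.min (Num.max s 0) t))%:R.
have mphi : measurable_fun setT (fun p : unit * measurableTypeR R => phi p.2 p.1).
  apply: measurable_rcont_joint => [s|w s]; first exact: measurable_cst.
  by apply: filterS (right_locally_constant_total t0 rA s) => h; rewrite /phi => ->.
have := measurable_fun_pair2 tt mphi.
move/(measurable_funS measurableT (@subsetT _ `[0, t])).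
apply: eq_measurable_fun => s; rewrite inE /= in_itv /= => /andP[s0 st].
by rewrite /phi max_l// min_l.
Qed.

Lemma occ_integrable A t : right_locally_constant A ->
  mu.-integrable `[0, t] (fun s => ((A s)%:R : R)%:E).
Proof.
move=> rA; apply: (measurable_bounded_integrable (mu := mu)) => //.
- exact: lebesgue_itv_lty.
- exact: rlc_measurable.
- exists 1; split => // M M1 s _ /=; rewrite (le_trans _ (ltW M1))//.
  by case: (A s); rewrite ?normr1 ?normr0.
Qed.

Lemma occ0 A : occ A 0 = 0 :> R.
Proof. by rewrite /occ set_itv1 Rintegral_set1. Qed.

Lemma occ_split A t u : right_locally_constant A -> 0 <= t <= u ->
  occ A u - occ A t = \int[mu]_(s in `]t, u]) (A s)%:R.
Proof.
move=> rA /andP[t0 tu].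
rewrite /occ Rintegral_itvB//; exact: occ_integrable.
Qed.

Lemma Rintegral_itv_oc_cst (t u c : R) : t <= u ->
  \int[mu]_(s in `]t, u]) (cst c s) = c * (u - t).
Proof.
move=> tu; rewrite (Rintegral_cst mu) // [X in _ * fine X](_ : _ = (u - t)%:E) //.
rewrite [LHS]lebesgue_measure_itv /= lte_fin; case: ltgtP tu => // -> _.
by rewrite subrr.
Qed.

Lemma occ_incr A t u : right_locally_constant A -> 0 <= t <= u ->
  0 <= occ A u - occ A t <= u - t.
Proof.
move=> rA /[dup] tu /andP[t0 tu'].
have iA : mu.-integrable `]t, u] (fun s => ((A s)%:R : R)%:E).
  apply: (integrableS _ _ _ (occ_integrable u rA)) => //.
  move=> s /=; rewrite !in_itv /= => /andP[ts ->]; rewrite andbT.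
  by rewrite (le_trans t0)// ltW.
rewrite occ_split// Rintegral_ge0//=.
rewrite -[u - t]mul1r -(Rintegral_itv_oc_cst 1 tu'); apply: le_Rintegral => //.
  apply: (measurable_bounded_integrable (mu := mu)) => //.
  - exact: lebesgue_itv_lty.
  - by exists 1; split => // M M1 s _ /=; rewrite normr1 ltW.
by move=> s _; rewrite /cst; case: (A s).
Qed.

Lemma occ_const A t u (c : bool) : right_locally_constant A -> 0 <= t <= u ->
  (forall s, t < s <= u -> A s = c) -> occ A u - occ A t = c%:R * (u - t).
Proof.
move=> rA /[dup] tu /andP[t0 tu'] H; rewrite occ_split//.
rewrite -Rintegral_itv_oc_cst//; apply: eq_Rintegral => s; rewrite inE /= in_itv /= => st.
by rewrite H.
Qed.

Lemma occ_eq A B t : 0 <= t -> right_locally_constant A -> right_locally_constant B ->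
  (forall s, 0 <= s < t -> A s = B s) -> occ A t = occ B t.
Proof.
move=> t0 rA rB AB; apply/eqP; rewrite -subr_eq0 -normr_le0.
apply/ler_addgt0Pl => /= e e0; rewrite addr0.
pose s := Num.max 0 (t - e).
have [te|te] := ltP t e.
  have := occ_incr (t := 0) (u := t) rA; have := occ_incr (t := 0) (u := t) rB.
  rewrite !occ0 !lexx t0 !subr0 => /(_ isT)/andP[? ?] /(_ isT)/andP[? ?].
  by rewrite ler_norml; apply/andP; split; lra.
have Es : occ A (t - e) = occ B (t - e).
  apply: eq_Rintegral => r; rewrite inE /= in_itv /= => /andP[r0 rt].
  by rewrite AB// r0/=; lra.
have := occ_incr (t := t - e) (u := t) rA; have := occ_incr (t := t - e) (u := t) rB.
rewrite Es subr_ge0 te gerBl ltW// => /(_ isT)/andP[? ?] /(_ isT)/andP[? ?].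
by rewrite ler_norml; apply/andP; split; lra.
Qed.

(** Tonelli for the jointly measurable indicator. The measurable space is arbitrary and only times
    up to [t] are involved, so this also applies to the sigma-algebra of the past up to [t]. *)
Lemma measurable_occ d (T : measurableType d) (A : R -> T -> bool) t : 0 <= t ->
  (forall s, 0 <= s <= t -> measurable [set w | A s w]) ->
  (forall w, right_locally_constant (A^~ w)) ->
  measurable_fun setT (fun w => occ (A^~ w) t).
Proof.
move=> t0 mA rA.
pose phi s w : R := (A (Num.min (Num.max s 0) t) w)%:R.
have mphi : measurable_fun setT (fun p : T * measurableTypeR R => phi p.2 p.1).
  apply: measurable_rcont_joint => [s|w s].
    have -> : phi s = \1_[set w | A (Num.min (Num.max s 0) t) w].
      by apply/funext => w; rewrite indicE mem_setE.
    apply: measurable_indic; apply: mA.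
    by rewrite le_min t0 le_max lexx orbT ge_min lexx orbT.
  by apply: filterS (right_locally_constant_total t0 (rA w) s) => h; rewrite /phi => ->.
pose f (p : T * measurableTypeR R) : \bar R := (\1_`[0, t] (p.2 : R) * phi p.2 p.1)%:E.
have mf : measurable_fun setT f.
  apply/measurable_EFinP; apply: measurable_funM => //.
  apply: (measurableT_comp (f := \1_`[0, t] : measurableTypeR R -> R)).
    by apply: measurable_indic; exact: measurable_itv.
  exact: measurable_snd.
have f0 p : (0 <= f p)%E by rewrite lee_fin mulr_ge0.
have mF := @measurable_fun_fubini_tonelli_F _ _ T (measurableTypeR R) R mu f mf f0.
have := measurableT_comp (@fine_measurable R setT measurableT) mF.
apply: eq_measurable_fun => w _ /=; rewrite /occ /Rintegral; congr fine.
rewrite /fubini_F [RHS]integral_mkcond /=; apply: eq_integral => s _.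
rewrite patchE /f /= indicE; case: ifPn => [|_]; last by rewrite mul0r.
by rewrite inE /= in_itv /= mul1r /phi => /andP[s0 st]; rewrite max_l// min_l.
Qed.

End occupation_time.

(** By monotonicity [Q] persists once it holds, and openness to the right of its failure keeps the
    infimum away from [t] when [Q t] fails. Lifetime and hitting time are both of this form. *)
Lemma first_passage_gt (R : realType) (Q : R -> Prop) (t : R) : 0 <= t ->
  (forall u v, 0 <= u <= v -> Q u -> Q v) ->
  (~ Q t -> exists2 h : R, 0 < h & ~ Q (t + h)) ->
  (t%:E < ereal_inf [set u%:E | u in [set u | (0 <= u)%R /\ Q u]])%E <-> ~ Q t.
Proof.
move=> t0 Qmono Qopen; split=> [tinf Qt|nQt].
  move: tinf; apply/negP; rewrite -leNgt; apply: ereal_inf_lbound.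
  by exists t.
have [d d0 nQ] := Qopen nQt.
apply: (@lt_le_trans _ _ (t + d)%:E); first by rewrite lte_fin ltrDl.
apply: le_ereal_inf_tmp => _ [u [u0 Qu] <-]; rewrite lee_fin leNgt; apply/negP => utd.
by apply: nQ; apply: (Qmono u) => //; rewrite u0 ltW.
Qed.

(** * Bounded expectations and set-wise convergence *)

Section bounded_expectation.
Context d (T : measurableType d) (R : realType) (P : probability T R).
Implicit Types (f g : T -> R) (A B : set T).

Definition bmf f := measurable_fun setT f /\ exists M : R, forall w, `|f w| <= M.

Lemma bmf_integrable f : bmf f -> P.-integrable setT (EFin \o f).
Proof.
move=> [mf [M fM]]; apply: (measurable_bounded_integrable (mu := P)) => //.
  by rewrite (le_lt_trans (probability_le1 P measurableT))// ltry.
exists M; split => [|N MN w _ /=]; first by rewrite num_real.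
by rewrite (le_trans (fM w))// ltW.
Qed.

Lemma bmf_cst (c : R) : bmf (fun=> c).
Proof. by split; [exact: measurable_cst|exists `|c|]. Qed.

Lemma bmfD f g : bmf f -> bmf g -> bmf (fun w => f w + g w).
Proof.
move=> [mf [M fM]] [mg [N gN]]; split; first exact: measurable_funD.
by exists (M + N) => w; rewrite (le_trans (ler_normD _ _))// lerD.
Qed.

Lemma bmfM f g : bmf f -> bmf g -> bmf (fun w => f w * g w).
Proof.
move=> [mf [M fM]] [mg [N gN]]; split; first exact: measurable_funM.
by exists (M * N) => w; rewrite normrM ler_pM.
Qed.

Lemma bmfB f g : bmf f -> bmf g -> bmf (fun w => f w - g w).
Proof.
move=> [mf [M fM]] [mg [N gN]]; split; first exact: measurable_funB.
by exists (M + N) => w; rewrite (le_trans (ler_normB _ _))// lerD.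
Qed.

Lemma bmf_norm f : bmf f -> bmf (fun w => `|f w|).
Proof.
move=> [mf [M fM]]; split; first exact: measurableT_comp.
by exists M => w; rewrite normr_id.
Qed.

Lemma bmf_indic A : measurable A -> bmf \1_A.
Proof.
move=> mA; split; first exact: measurable_indic.
by exists 1 => w; rewrite indicE; case: (_ \in _); rewrite ?normr1 ?normr0.
Qed.

Lemma bmf_sum (I : Type) (s : seq I) (F : I -> T -> R) :
  (forall i, bmf (F i)) -> bmf (fun w => \sum_(i <- s) F i w).
Proof.
move=> bF; elim: s => [|i s IH].
  by under eq_fun do rewrite big_nil; exact: bmf_cst.
by under eq_fun do rewrite big_cons; exact: bmfD.
Qed.

Lemma E_le f g : bmf f -> bmf g -> (forall w, f w <= g w) ->
  \int[P]_w f w <= \int[P]_w g w.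
Proof. by move=> bf bg fg; apply: le_Rintegral => //; exact: bmf_integrable. Qed.

Lemma E_cst (c : R) : \int[P]_w c = c.
Proof.
rewrite (Rintegral_cst P)// [X in _ * X](_ : _ = 1) ?mulr1//.
by rewrite -[RHS]/(fine 1%:E); congr fine; exact: probability_setT.
Qed.

Lemma ED f g : bmf f -> bmf g ->
  \int[P]_w (f w + g w) = \int[P]_w f w + \int[P]_w g w.
Proof. by move=> bf bg; rewrite RintegralD//; exact: bmf_integrable. Qed.

Lemma EB f g : bmf f -> bmf g ->
  \int[P]_w (f w - g w) = \int[P]_w f w - \int[P]_w g w.
Proof. by move=> bf bg; rewrite RintegralB//; exact: bmf_integrable. Qed.

Lemma EZ (c : R) f : bmf f -> \int[P]_w (c * f w) = c * \int[P]_w f w.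
Proof. by move=> bf; rewrite RintegralZl//; exact: bmf_integrable. Qed.

Lemma E_sum (I : Type) (s : seq I) (F : I -> T -> R) : (forall i, bmf (F i)) ->
  \int[P]_w (\sum_(i <- s) F i w) = \sum_(i <- s) \int[P]_w F i w.
Proof.
move=> bF; elim: s => [|i s IH].
  by under eq_Rintegral do rewrite big_nil; rewrite E_cst big_nil.
under eq_Rintegral do rewrite big_cons.
by rewrite big_cons ED ?IH//; exact: bmf_sum.
Qed.

Lemma E_norm f : bmf f -> `|\int[P]_w f w| <= \int[P]_w `|f w|.
Proof. by move=> bf; apply: le_normr_Rintegral => //; exact: bmf_integrable. Qed.

Lemma E_indic A : measurable A -> \int[P]_w \1_A w = fine (P A).
Proof. by move=> mA; rewrite /Rintegral integral_indic// setIT. Qed.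

Lemma pr_ge0 A : 0 <= fine (P A).
Proof. by rewrite fine_ge0. Qed.

Lemma pr_le1 A : measurable A -> fine (P A) <= 1.
Proof.
by move=> mA; rewrite -lee_fin fineK ?probability_le1// fin_num_measure.
Qed.

Lemma pr_le A B : measurable A -> measurable B -> A `<=` B -> fine (P A) <= fine (P B).
Proof.
move=> mA mB AB; rewrite -!E_indic//; apply: E_le; try exact: bmf_indic.
move=> w; rewrite !indicE; have [Aw|] := boolP (w \in A); last by case: (_ \in _).
by rewrite mem_set//; apply: AB; rewrite inE in Aw.
Qed.

Lemma pr_le_sum (I : finType) A (F : I -> set T) : measurable A ->
  (forall i, measurable (F i)) -> A `<=` \bigcup_i F i ->
  fine (P A) <= \sum_i fine (P (F i)).
Proof.
move=> mA mF AF; rewrite -E_indic//.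
under eq_bigr do rewrite -E_indic//.
rewrite -E_sum; last by move=> i; exact: bmf_indic.
apply: E_le; [exact: bmf_indic|by apply: bmf_sum => i; exact: bmf_indic|].
move=> w; rewrite !indicE; have [Aw|_] := boolP (w \in A); last first.
  by rewrite sumr_ge0.
have [i _ Fi] : (\bigcup_i F i) w by apply: AF; rewrite inE in Aw.
by rewrite (bigD1 i)//= indicE mem_set// lerDl sumr_ge0.
Qed.

Lemma pr_leU A B C : measurable A -> measurable B -> measurable C ->
  A `<=` B `|` C -> fine (P A) <= fine (P B) + fine (P C).
Proof.
move=> mA mB mC AF.
have := @pr_le_sum bool A (fun b => if b then B else C) mA.
rewrite big_bool /=; apply; first by case.
by move=> w /AF [Bw|Cw]; [exists true|exists false].
Qed.

Lemma E_ae_eq f g : bmf f -> bmf g -> {ae P, forall w, f w = g w} ->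
  \int[P]_w f w = \int[P]_w g w.
Proof.
move=> [mf _] [mg _] fg; rewrite /Rintegral; congr fine.
apply: ae_eq_integral => //; try exact/measurable_EFinP.
by apply: filterS fg => w /= -> _.
Qed.

End bounded_expectation.

(** The sum counts the integers from 1 to [x], so it is the integer part of [x]. *)
Lemma layer_cake (R : realType) (N : nat) (x : R) : 0 <= x <= N%:R ->
  x - 1 <= \sum_(m < N) ((m.+1%:R : R) <= x)%R%:R <= x.
Proof.
elim: N x => [|N IH] x /andP[x0 xN].
  by rewrite big_ord0 x0 andbT; lra.
rewrite big_ord_recr /=; have [xN'|Nx] := leP x N%:R.
  rewrite [N.+1%:R <= x](_ : _ = false) ?addr0; first by apply: IH; rewrite x0.
  by apply/negbTE; rewrite -ltNge (le_lt_trans xN')// ltr_nat.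
rewrite (eq_bigr (fun=> 1)); last first.
  by move=> m _; rewrite (le_trans _ (ltW Nx))// ler_nat.
rewrite sumr_const card_ord; rewrite -natr1 in xN *.
have [H|H] := leP (N%:R + 1) x; rewrite ?addr0 /=; apply/andP; split; lra.
Qed.

Section setwise_convergence.
Context d (T : measurableType d) (R : realType) (P : probability T R).
Variables (G : set (set T)) (S : R -> set T) (c : T -> R).
Hypotheses (GT : G setT) (Gm : forall A, G A -> measurable A).
Hypotheses (mS : forall h, 0 < h -> measurable (S h)) (bc : bmf c).
Hypothesis cvgS : forall A, G A ->
  h^-1 * fine (P (A `&` S h)) @[h --> 0^'+] --> \int[P]_w (\1_A w * c w).

(** Up to an error [1 / N], a function with values in [[0, 1]] is the mean of the indicators of [N]
    upper level sets, for which convergence is the hypothesis. The error is uniform in [h], because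
    the masses [h^-1 P(S h)] converge and so stay bounded. *)
Let cvg01 (phi : T -> R) : bmf phi -> (forall r, G [set w | r <= phi w]) ->
  (forall w, 0 <= phi w <= 1) ->
  h^-1 * \int[P]_w (\1_(S h) w * phi w) @[h --> 0^'+] --> \int[P]_w (phi w * c w).
Proof.
move=> bphi Gphi phi01.
have [_ [M0 cM0]] := bc; pose M := `|M0| + 1.
have M1 : 0 < M by rewrite ltr_wpDl.
have cM w : `|c w| <= M by rewrite (le_trans (cM0 w))// ler_wpDr// ler_norm.
apply/cvgrPdist_le => /= e e0.
(* The error [1 / N] enters once before and once after the limit, each time against a mass of at
   most [M + 1]. *)
pose N := (Num.truncn (2 * (M + 1) / (e / 2))).+1.
have N0 : 0 < N%:R :> R by rewrite ltr0n.
have HN : N%:R^-1 * (2 * (M + 1)) <= e / 2.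
  rewrite mulrC.
  rewrite ler_pdivrMr// -ler_pdivrMl ?divr_gt0// [leLHS]mulrC.
  by apply: ltW; rewrite /N truncnS_gt.
pose A (m : 'I_N) := [set w | m.+1%:R <= N%:R * phi w].
have GA m : G (A m).
  rewrite /A (_ : mkset _ = [set w | m.+1%:R / N%:R <= phi w]); first exact: Gphi.
  by apply/seteqP; split=> w /=; rewrite ler_pdivrMr// mulrC.
have mA m := Gm (GA m).
pose phiN w : R := N%:R^-1 * \sum_(m < N) \1_(A m) w.
have bphiN : bmf phiN.
  by apply: bmfM; [exact: bmf_cst|apply: bmf_sum => m; exact: bmf_indic].
have phiNphi w : `|phi w - phiN w| <= N%:R^-1.
  have Nphi : 0 <= N%:R * phi w <= N%:R.
    have /andP[p0 p1] := phi01 w.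
    by rewrite mulr_ge0//= ler_piMr.
  have /andP[] := layer_cake Nphi.
  rewrite (eq_bigr (fun m => \1_(A m) w)); last first.
    by move=> m _; rewrite indicE /A mem_setE.
  set s := \sum_(m < N) _ => s1 s2.
  rewrite /phiN -/s -[phi w](mulKf (x := N%:R)) ?gt_eqF// -mulrBr normrM.
  rewrite ger0_norm ?invr_ge0// ler_piMr ?invr_ge0// ler_norml.
  by apply/andP; split; lra.
have cvgN : h^-1 * \int[P]_w (\1_(S h) w * phiN w) @[h --> 0^'+] -->
    \int[P]_w (phiN w * c w).
  have -> : \int[P]_w (phiN w * c w) =
      N%:R^-1 * \sum_(m < N) \int[P]_w (\1_(A m) w * c w).
    rewrite -E_sum; last by move=> m; apply: bmfM => //; exact: bmf_indic.
    rewrite -EZ; last by apply: bmf_sum => m; apply: bmfM => //; exact: bmf_indic.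
    by apply: eq_Rintegral => w _; rewrite /phiN -mulrA mulr_suml.
  have H : \forall h \near 0^'+,
      N%:R^-1 * \sum_(m < N) (h^-1 * fine (P (A m `&` S h))) =
      h^-1 * \int[P]_w (\1_(S h) w * phiN w).
    apply: (near_right_of (d := 1)) => // h /andP[h0 _].
    rewrite -mulr_sumr mulrCA; congr (_ * _).
    rewrite (eq_bigr (fun m => \int[P]_w \1_(A m `&` S h) w)); last first.
      by move=> m _; rewrite E_indic//; exact: measurableI (mS h0).
    rewrite -E_sum; last by move=> m; apply: bmf_indic; exact: measurableI (mS h0).
    rewrite -EZ; last first.
      by apply: bmf_sum => m; apply: bmf_indic; exact: measurableI (mS h0).
    apply: eq_Rintegral => w _; rewrite /phiN mulrCA; congr (_ * _).
    by rewrite mulr_sumr; apply: eq_bigr => m _; rewrite indicI /= mulrC.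
  apply: cvg_trans (near_eq_cvg H) _.
  apply: cvgM; first exact: cvg_cst.
  by apply: cvg_big => [|m _]; [exact: add_continuous|exact: cvgS].
have cvgmass : h^-1 * fine (P (setT `&` S h)) @[h --> 0^'+] --> \int[P]_w (\1_setT w * c w).
  exact: cvgS.
have EcM : \int[P]_w (\1_setT w * c w) < M + 1.
  apply: (@le_lt_trans _ _ (\int[P]_w (fun=> M) w)); last by rewrite E_cst ltrDl.
  apply: E_le; [by apply: bmfM => //; exact: bmf_indic|exact: bmf_cst|].
  by move=> w; rewrite indicE mem_set// mul1r (le_trans (ler_norm _)).
have massM : \forall h \near 0^'+, h^-1 * fine (P (setT `&` S h)) <= M + 1.
  exact: cvgr_le cvgmass _ EcM.
move/cvgrPdist_le : cvgN => /(_ _ (_ : 0 < e / 2)) => /(_ ltac:(by rewrite divr_gt0)) nearN.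
near=> h.
have h0 : 0 < h by near: h; exact: nbhs_right_gt.
have mSh := mS h0.
have hm : h^-1 * fine (P (setT `&` S h)) <= M + 1 by near: h.
have hN : `|\int[P]_w (phiN w * c w) - h^-1 * \int[P]_w (\1_(S h) w * phiN w)| <= e / 2.
  by near: h.
rewrite (_ : _ - _ =
  (\int[P]_w (phiN w * c w) - h^-1 * \int[P]_w (\1_(S h) w * phiN w)) +
  (\int[P]_w ((phi w - phiN w) * c w)
   - h^-1 * \int[P]_w (\1_(S h) w * (phi w - phiN w)))); last first.
  have -> : \int[P]_w ((phi w - phiN w) * c w) =
      \int[P]_w (phi w * c w) - \int[P]_w (phiN w * c w).
    by rewrite -EB; [apply: eq_Rintegral => w _; rewrite mulrBl|exact: bmfM..].
  have -> : \int[P]_w (\1_(S h) w * (phi w - phiN w)) =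
      \int[P]_w (\1_(S h) w * phi w) - \int[P]_w (\1_(S h) w * phiN w).
    rewrite -EB; [apply: eq_Rintegral => w _; rewrite mulrBr//|..];
      by apply: bmfM => //; exact: bmf_indic.
  ring.
rewrite [e]splitr (le_trans (ler_normD _ _))// lerD// (le_trans _ HN)//.
rewrite (_ : 2 * (M + 1) = (M + 1) + (M + 1)); last by ring.
rewrite mulrDr (le_trans (ler_normB _ _))// lerD//.
  apply: (le_trans (E_norm P _)); first by apply: bmfM => //; exact: bmfB.
  rewrite -[leRHS](E_cst P); apply: E_le; [|exact: bmf_cst|move=> w].
    by apply: bmf_norm; apply: bmfM => //; exact: bmfB.
  by rewrite normrM ler_pM// (le_trans (cM w))// lerDl.
rewrite setTI in hm.
rewrite normrM [`|h^-1|]ger0_norm ?invr_ge0 ?(ltW h0)//.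
apply: (@le_trans _ _ (h^-1 * (N%:R^-1 * fine (P (S h))))); last first.
  by rewrite mulrCA ler_wpM2l// invr_ge0 (ltW N0).
rewrite ler_wpM2l ?invr_ge0 ?(ltW h0)//.
rewrite -E_indic// -EZ; last exact: bmf_indic.
apply: (le_trans (E_norm P _)); first by apply: bmfM; [exact: bmf_indic|exact: bmfB].
apply: E_le.
- by apply: bmf_norm; apply: bmfM; [exact: bmf_indic|exact: bmfB].
- by apply: bmfM; [exact: bmf_cst|exact: bmf_indic].
- move=> w; rewrite normrM mulrC ler_pM// indicE ger0_norm//.
Unshelve. all: by end_near. Qed.

(* Set-wise convergence of the measures [h^-1 P(S h `&` .)] passes to bounded
   integrands by summing over their upper level sets. *)
Lemma cvg_setwise_integral (phi : T -> R) : bmf phi ->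
  (forall r, G [set w | r <= phi w]) ->
  h^-1 * \int[P]_w (\1_(S h) w * phi w) @[h --> 0^'+] --> \int[P]_w (phi w * c w).
Proof.
move=> [mphi [M0 phiM0]] Gphi; pose M := `|M0| + 1.
have M1 : 0 < M by rewrite ltr_wpDl.
have phiM w : `|phi w| <= M by rewrite (le_trans (phiM0 w))// ler_wpDr// ler_norm.
have bphi : bmf phi by split => //; exists M.
(* An affine change to values in [[0, 1]]; the constant that it introduces is handled by convergence
   of the total mass. *)
pose psi w := (phi w + M) / (2 * M).
have phiE w : phi w = 2 * M * psi w - M.
  by rewrite /psi mulrC divfK ?addrK// mulf_neq0// gt_eqF.
have bpsi : bmf psi.
  by apply: bmfM; [apply: bmfD => //; exact: bmf_cst|exact: bmf_cst].
have M20 : 0 < 2 * M by rewrite mulr_gt0.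
have H1 : h^-1 * \int[P]_w (\1_(S h) w * psi w) @[h --> 0^'+] --> \int[P]_w (psi w * c w).
  apply: cvg01 => // [r|w].
    rewrite (_ : mkset _ = [set w | r * (2 * M) - M <= phi w]); first exact: Gphi.
    by apply/seteqP; split=> w /=; rewrite /psi ler_pdivlMr// lerBlDr.
  have := phiM w; rewrite ler_norml => /andP[? ?].
  apply/andP; split; first by apply: divr_ge0; [lra|exact: ltW].
  by rewrite /psi ler_pdivrMr//; lra.
have H2 : h^-1 * fine (P (setT `&` S h)) @[h --> 0^'+] --> \int[P]_w (\1_setT w * c w).
  exact: cvgS.
have -> : \int[P]_w (phi w * c w) =
    2 * M * \int[P]_w (psi w * c w) - M * \int[P]_w (\1_setT w * c w).
  rewrite -!EZ; [|by apply: bmfM => //; exact: bmf_indic|exact: bmfM].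
  rewrite -EB.
  - by apply: eq_Rintegral => w _; rewrite phiE indicT /cst; ring.
  - by apply: bmfM; [exact: bmf_cst|exact: bmfM].
  - by apply: bmfM; [exact: bmf_cst|apply: bmfM => //; exact: bmf_indic].
have H : \forall h \near 0^'+,
    2 * M * (h^-1 * \int[P]_w (\1_(S h) w * psi w)) - M * (h^-1 * fine (P (setT `&` S h))) =
    h^-1 * \int[P]_w (\1_(S h) w * phi w).
  apply: (near_right_of (d := 1)) => // h /andP[h0 _].
  have mSh := mS h0; have b1 : bmf (\1_(S h) : T -> R) by exact: bmf_indic.
  rewrite setTI -E_indic// mulrCA [M * _]mulrCA -mulrBr; congr (_ * _).
  rewrite -!EZ//; last exact: bmfM.
  rewrite -EB.
  - by apply: eq_Rintegral => w _; rewrite phiE; ring.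
  - by apply: bmfM; [exact: bmf_cst|exact: bmfM].
  - by apply: bmfM; [exact: bmf_cst|].
apply: cvg_trans (near_eq_cvg H) _.
by apply: cvgB; apply: cvgM => //; exact: cvg_cst.
Qed.

End setwise_convergence.

(** * The stopped process *)

Section vdjp_process.
Context (R : realType) (Lam : finType) (beta : Lam -> Lam -> R).
Hypothesis beta_ge0 : forall i j, 0 <= beta i j.
Context d (Om : measurableType d) (X : R -> Om -> Lam) (P : probability Om R).
Variables (a : Lam) (z : Lam -> R).
Hypotheses (V : is_vdjp beta X a z P) (z_cube : unit_cube z).
Implicit Types (s t u h : R) (w : Om) (A B : set Om) (i j : Lam).

Notation L := (diminished X z).
Notation pr A := (fine (P A)).

Lemma vdjp_rlc w i : right_locally_constant (fun s => X s w == i).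
Proof. by move=> t t0; apply: filterS (vdjp_right_continuous V w t0) => h ->. Qed.

Lemma diminishedE t w j : L t w j = z j - occ (fun s => X s w == j) t.
Proof. by []. Qed.

Lemma diminished0 w : L 0 w = z.
Proof. by apply/funext => j; rewrite diminishedE occ0 subr0. Qed.

Lemma diminished_incr t u w j : 0 <= t <= u -> 0 <= L t w j - L u w j <= u - t.
Proof.
move=> tu; have /andP[H1 H2] := occ_incr (vdjp_rlc w j) tu.
by rewrite !diminishedE; apply/andP; split; lra.
Qed.

Lemma diminished_const t u w i j : 0 <= t <= u -> (forall s, t < s <= u -> X s w = i) ->
  L u w j = L t w j - (j == i)%:R * (u - t).
Proof.
move=> tu Xi; have H := occ_const (c := j == i) (vdjp_rlc w j) tu.
rewrite !diminishedE -H; first by ring.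
by move=> s st; rewrite (Xi s st) eq_sym.
Qed.

Lemma diminished_le1 t w j : 0 <= t -> L t w j <= 1.
Proof.
move=> t0; have /andP[H _] := @diminished_incr 0 t w j ltac:(by rewrite lexx t0).
by move: H; rewrite diminished0; have /andP[_ z1] := z_cube j; lra.
Qed.

Lemma diminished_ge t w j : 0 <= t -> - t <= L t w j.
Proof.
move=> t0; have /andP[_ H] := @diminished_incr 0 t w j ltac:(by rewrite lexx t0).
by move: H; rewrite diminished0; have /andP[z0 _] := z_cube j; lra.
Qed.

(** Exactly one site is occupied at each time, so the total decreases at unit rate. This bounds the
    lifetime. *)
Lemma sum_diminished t w : 0 <= t -> \sum_j L t w j = \sum_j z j - t.
Proof.
move=> t0; under eq_bigr do rewrite diminishedE.
rewrite sumrB; congr (_ - _).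
have intX j := occ_integrable t (vdjp_rlc w j).
have H (r : seq Lam) : \sum_(j <- r) occ (fun s => X s w == j) t =
    \int[@lebesgue_measure R]_(s in `[0, t]) (\sum_(j <- r) (X s w == j)%:R) /\
    (@lebesgue_measure R).-integrable `[0, t]
      (fun s => (\sum_(j <- r) (X s w == j)%:R : R)%:E).
  elim: r => [|j r [IH1 IH2]].
    rewrite big_nil; split.
      under eq_Rintegral do rewrite big_nil.
      by rewrite (Rintegral_cst (@lebesgue_measure R))// mul0r.
    rewrite (_ : (fun _ => _) = cst 0%E); first exact: integrable0.
    by apply/funext => s; rewrite big_nil.
  rewrite big_cons IH1; split.
    rewrite [RHS](_ : _ = \int[@lebesgue_measure R]_(s in `[0, t])
        ((X s w == j)%:R + \sum_(k <- r) (X s w == k)%:R)); last first.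
      by apply: eq_Rintegral => s _; rewrite big_cons.
    by symmetry; apply: RintegralD; [exact: measurable_itv|exact: intX|exact: IH2].
  rewrite (_ : (fun _ => _) = (fun s => ((X s w == j)%:R : R)%:E +
      (\sum_(k <- r) (X s w == k)%:R : R)%:E)%E); first exact: integrableD.
  by apply/funext => s; rewrite big_cons EFinD.
have [-> _] := H (index_enum Lam).
transitivity (\int[@lebesgue_measure R]_(s in `[0, t]) (cst 1 s)).
  apply: eq_Rintegral => s _; rewrite (bigD1 (X s w))//= eqxx big1 ?addr0//.
  by move=> j /negbTE; rewrite eq_sym => ->.
rewrite (Rintegral_cst (@lebesgue_measure R)) // mul1r.
rewrite [X in fine X](_ : _ = t%:E) //.
rewrite [LHS]lebesgue_measure_itv /= lte_fin.
have [t0'|t0'] := ltP 0 t; first by rewrite sube0.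
by congr (_%:E); apply: le_anti; rewrite t0 t0'.
Qed.

Definition alive t w := forall j, 0 < L t w j.

(** Local times fall at most at unit rate, so positivity at the finitely many sites persists for a
    short while. *)
Lemma lifetimeP t w : 0 <= t -> (t%:E < lifetime X z w)%E <-> alive t w.
Proof.
move=> t0; rewrite /lifetime.
apply: (iff_trans (@first_passage_gt R (fun t => exists j, L t w j <= 0) t t0 _ _)).
- move=> u v uv [j Lj]; exists j; apply: le_trans Lj.
  by have /andP[] := diminished_incr w j uv; rewrite subr_ge0.
- move=> nQ; have H : \forall h \near 0^'+, forall j, h < L t w j.
    apply: filter_forall => j; apply: nbhs_right_lt; rewrite ltNge; apply/negP => Lj.
    by apply: nQ; exists j.
  have [e e0 He] := near_right_ex H; exists (e / 2); first by rewrite divr_gt0.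
  move=> [j Lj]; have := He (e / 2) ltac:(apply/andP; split; lra) j.
  have /andP[_] := @diminished_incr t (t + e / 2) w j ltac:(apply/andP; split; lra).
  lra.
- split=> [nQ j|al [j Lj]]; last by have := al j; rewrite ltNge Lj.
  by rewrite ltNge; apply/negP => Lj; apply: nQ; exists j.
Qed.

Lemma hitting_timeP (gam : R) t w : 0 <= t ->
  (t%:E < hitting_time X z a gam w)%E <-> gam < L t w a.
Proof.
move=> t0; rewrite /hitting_time.
apply: (iff_trans (@first_passage_gt R (fun t => L t w a <= gam) t t0 _ _)).
- move=> u v uv; apply: le_trans.
  by have /andP[] := diminished_incr w a uv; rewrite subr_ge0.
- move=> /negP; rewrite -ltNge => gL; exists ((L t w a - gam) / 2).
    by rewrite divr_gt0// subr_gt0.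
  apply/negP; rewrite -ltNge.
  have := @diminished_incr t (t + (L t w a - gam) / 2) w a ltac:(apply/andP; split; lra).
  by move=> /andP[_]; lra.
- by split=> [/negP|]; rewrite -?ltNge// => ?; apply/negP; rewrite -ltNge.
Qed.

Notation past t := (g_sigma_algebraType (past_event X t)).
Notation pastm t A := (<<s past_event X t >> A).

Lemma past_X t s i : 0 <= s <= t -> pastm t [set w | X s w = i].
Proof. by move=> st; apply: sub_sigma_algebra; exists s, i. Qed.

Lemma past_measurable t A : pastm t A -> measurable A.
Proof.
apply: smallest_sub; first exact: sigma_algebra_measurable.
by move=> _ [s [i [/andP[s0 _] ->]]]; exact: (vdjp_measurable V).
Qed.

Lemma past_mono t u A : t <= u -> pastm t A -> pastm u A.
Proof.
move=> tu; apply: sub_sigma_algebra2 => _ [s [i [/andP[s0 st] ->]]].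
by exists s, i; rewrite s0 (le_trans st).
Qed.

Lemma past_diminished t j : 0 <= t ->
  measurable_fun (setT : set (past t)) (fun w : past t => L t w j).
Proof.
move=> t0; apply: measurable_funB => //.
apply: (@measurable_occ R _ (past t) (fun s w => X s w == j) t t0).
  move=> s st; rewrite (_ : mkset _ = [set w | X s w = j]); first exact: past_X.
  by apply/seteqP; split=> w /= /eqP.
by move=> w; exact: vdjp_rlc.
Qed.

Lemma past_gt t j (c : R) : 0 <= t -> pastm t [set w | c < L t w j].
Proof.
move=> t0; have := past_diminished j t0 => /(_ measurableT `]c, +oo[%classic (measurable_itv _)).
rewrite setTI; congr (measurable _); apply/seteqP; split=> w /=; by rewrite in_itv/= andbT.
Qed.

Lemma past_alive t : 0 <= t -> pastm t (alive t).
Proof.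
move=> t0; rewrite (_ : alive t = \bigcap_(j in [set: Lam]) [set w | 0 < L t w j]).
  by apply: (@fin_bigcap_measurable _ (past t)) => // j _; exact: past_gt.
by apply/seteqP; split=> [w al j _|w H j]; [exact: al|exact: H].
Qed.

Lemma pastI t A B : pastm t A -> pastm t B -> pastm t (A `&` B).
Proof. exact: (@measurableI _ (past t)). Qed.

Lemma pastD t A B : pastm t A -> pastm t B -> pastm t (A `\` B).
Proof. exact: (@measurableD _ (past t)). Qed.

Lemma pastU t A B : pastm t A -> pastm t B -> pastm t (A `|` B).
Proof. exact: (@measurableU _ (past t)). Qed.

Lemma pastC t A : pastm t A -> pastm t (~` A).
Proof. exact: (@measurableC _ (past t)). Qed.

Lemma bmf_past t (f : Om -> R) (M : R) : measurable_fun (setT : set (past t)) (f : past t -> R) ->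
  (forall w, `|f w| <= M) -> bmf f.
Proof.
move=> mf fM; split; last by exists M.
by move=> _ B mB; apply: past_measurable; exact: mf.
Qed.

Let mX t i : 0 <= t -> measurable [set w | X t w = i].
Proof. exact: (vdjp_measurable V). Qed.

Let mXN t i : 0 <= t -> measurable [set w | X t w <> i].
Proof. by move=> t0; apply: measurableC; exact: mX. Qed.

Definition jump_event t i j h := [set w | alive t w /\ X t w = i /\ X (t + h) w = j].
Definition jump_rate t i j w := \1_(alive t `&` [set w | X t w = i]) w * (beta i j * L t w j).

Lemma measurable_jump_event t i j h : 0 <= t -> 0 < h -> measurable (jump_event t i j h).
Proof.
move=> t0 h0; apply: measurableI; first exact: past_measurable (past_alive t0).
by apply: measurableI; [exact: mX|apply: mX; rewrite addr_ge0// ltW].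
Qed.

Lemma jump_rate_le t i j w : 0 <= t -> 0 <= jump_rate t i j w <= beta i j.
Proof.
move=> t0; rewrite /jump_rate indicE; case: (boolP (_ \in _)) => [|_]; last first.
  by rewrite mul0r lexx beta_ge0.
rewrite inE => -[al _]; rewrite mul1r mulr_ge0 ?beta_ge0 ?(ltW (al j))//=.
by apply: ler_piMr => //; exact: diminished_le1.
Qed.

Lemma bmf_jump_rate t i j : 0 <= t -> bmf (jump_rate t i j).
Proof.
move=> t0; apply: bmfM.
  by apply: bmf_indic; apply: past_measurable (pastI (past_alive t0) _); apply: past_X;
    rewrite t0 lexx.
apply: bmfM; first exact: bmf_cst.
apply: (bmf_past (t := t) (M := 1 + t)); first exact: past_diminished.
by move=> w; rewrite ler_norml; have := diminished_le1 w j t0;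
  have := diminished_ge w j t0; move=> H1 H2; apply/andP; split; lra.
Qed.

(** The rate condition in the form to which [cvg_setwise_integral] applies. *)
Lemma jump_event_rate t i j B : 0 <= t -> i != j -> pastm t B ->
  h^-1 * pr (B `&` jump_event t i j h) @[h --> 0^'+] -->
  \int[P]_w (\1_B w * jump_rate t i j w).
Proof.
move=> t0 ij mB; have := vdjp_rate V t0 ij mB.
have al w : (t%:E < lifetime X z w)%E = alive t w :> Prop.
  by apply/propext; exact: lifetimeP.
rewrite (_ : \int[P]_(w in _) _ = \int[P]_w (\1_B w * jump_rate t i j w)); last first.
  rewrite Rintegral_mkcond; apply: eq_Rintegral => w _.
  rewrite patchE /jump_rate mulrA.
  have -> : \1_B w * \1_(alive t `&` [set w | X t w = i]) w =
      \1_(B `&` (alive t `&` [set w | X t w = i])) w :> R by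
    rewrite !indicE !in_setI; do 3! case: (_ \in _); rewrite ?mulr1 ?mulr0 ?mul0r.
  rewrite indicE (_ : B `&` [set _ | _ /\ _] = B `&` (alive t `&` [set w | X t w = i])).
    by case: ifP => _; rewrite ?mul1r ?mul0r.
  by apply/seteqP; split=> w' /= [Bw []]; rewrite al.
rewrite (_ : (fun h => _) = (fun h => h^-1 * pr (B `&` jump_event t i j h)))//.
apply/funext => h; rewrite (_ : B `&` _ = B `&` jump_event t i j h)//.
by apply/seteqP; split=> w' /= [Bw []]; rewrite al.
Qed.

Lemma after_lifetime : {ae P, forall w, forall t u, 0 <= t <= u -> ~ alive t w ->
  X t w = X u w}.
Proof.
apply: filterS (vdjp_stopped V) => w H t u /andP[t0 tu] nal.
have lt : (lifetime X z w <= t%:E)%E by rewrite leNgt; apply/negP => /(lifetimeP w t0).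
by rewrite (H t lt) (H u)// (le_trans lt)// lee_fin.
Qed.

Let mXneq t u : 0 <= t -> 0 <= u -> measurable [set w | X t w <> X u w].
Proof.
move=> t0 u0; rewrite (_ : mkset _ =
   \bigcup_(j in [set: Lam]) ([set w | X t w = j] `&` [set w | X u w <> j])).
  apply: fin_bigcup_measurable => // j _.
  by apply: measurableI; [exact: mX|exact: mXN].
apply/seteqP; split=> [w tu|w [j _ [/= <- nX]] /esym//].
by exists (X t w) => //; split => //= /esym.
Qed.

Definition total_rate : R := \sum_i \sum_j beta i j.
Notation C := total_rate.

Lemma total_rate_ge0 : 0 <= C.
Proof. by rewrite sumr_ge0// => i _; rewrite sumr_ge0. Qed.



Let row_le i : \sum_j beta i j <= C.
Proof.
by rewrite /total_rate [leRHS](bigD1 i)//= lerDl sumr_ge0// => j _; rewrite sumr_ge0.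
Qed.

(** As a function of the final time [v] the probability grows at rate at most [C * pr B]: what
    enters the event between [v] and [v + h] was at [i] at time [v] and has jumped, and [B] belongs
    to the past of every such [v]. Continuity in probability supplies the left condition of
    [growth_le]. *)
Lemma one_step t B i u : 0 <= t <= u -> pastm t B -> B `<=` [set w | X t w = i] ->
  pr (B `&` [set w | X u w <> i]) <= C * pr B * (u - t).
Proof.
move=> /andP[t0 tu] mB BX.
have mB' := past_measurable mB.
pose f v := pr (B `&` [set w | X v w <> i]).
have mf v : 0 <= v -> measurable (B `&` [set w | X v w <> i]).
  by move=> v0; apply: measurableI => //; exact: mXN.
have ft : f t = 0.
  rewrite /f (_ : _ `&` _ = set0) ?measure0//.
  by apply/seteqP; split=> w //= [/BX].
rewrite -[leLHS]/(f u) -[f u]subr0 -ft; apply: growth_le => //.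
- move=> v /andP[tv vu] e e0; have v0 : 0 <= v := le_trans t0 tv.
  have mBv := past_mono tv mB.
  pose e' := e / (#|Lam|.+1)%:R.
  have e'0 : 0 < e' by rewrite divr_gt0.
  have H : \forall h \near 0^'+, forall j, i != j ->
      h^-1 * pr (B `&` jump_event v i j h) <= beta i j * pr B + e'.
    apply: filter_forall => j; have [->|ij] := eqVneq i j; first exact: nearW.

    have lim_lt : \int[P]_w (\1_B w * jump_rate v i j w) < beta i j * pr B + e'.
      apply: (@le_lt_trans _ _ (beta i j * pr B)); last by rewrite ltrDl.
      rewrite -E_indic// -EZ; last exact: bmf_indic.
      apply: E_le.
      + by apply: bmfM; [exact: bmf_indic|exact: bmf_jump_rate].
      + by apply: bmfM; [exact: bmf_cst|exact: bmf_indic].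
      + move=> w; rewrite mulrC; apply: ler_wpM2r; first by rewrite indicE.
        by have /andP[] := jump_rate_le i j w v0.
    have HH : \forall h \near 0^'+,
        h^-1 * pr (B `&` jump_event v i j h) <= beta i j * pr B + e'.
      exact: cvgr_le (jump_event_rate v0 ij mBv) _ lim_lt.
    by apply: filterS HH => h.
  have [d0 d00 Hd] := near_right_ex H.
  apply: (near_right_of d00) => h /[dup] hd /andP[h0 _].
  have vh0 : 0 <= v + h by rewrite addr_ge0// ltW.
  (* Moves after the lifetime; this event is null because the process is stopped there. *)
  pose N := [set w | ~ alive v w /\ X v w <> X (v + h) w].
  have mN : measurable N.
    apply: measurableI; last exact: mXneq.
    by apply: measurableC; exact: past_measurable (past_alive v0).
  have N0 : pr N = 0.
    rewrite (_ : P N = 0%E)//; apply: (@measure_negligible _ _ _ P) => //.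
    apply: negligibleS after_lifetime => w [nal XX] /= HH; apply: XX.
    by apply: HH => //; rewrite v0 lerDl ltW.
  pose F j := if i == j then set0 else B `&` jump_event v i j h.
  have mF j : measurable (F j).
    rewrite /F; case: ifP => // _; apply: measurableI => //.
    exact: measurable_jump_event.
  have mUF : measurable (\bigcup_j F j) by apply: fin_bigcup_measurable.
  rewrite lerBlDl /f.
  apply: (@le_trans _ _ (f v + pr (\bigcup_j F j `|` N))).
    apply: pr_leU; [exact: mf|exact: mf|exact: measurableU|].
    move=> w [Bw XN]; have [Xv|Xv] := pselect (X v w = i); last by left.
    right; have [al|nal] := pselect (alive v w); last by right; split => //; rewrite Xv => /esym.
    left; exists (X (v + h) w) => //; rewrite /F ifN; first by split.
    by apply/eqP => /esym.
  rewrite lerD2l (@le_trans _ _ (pr (\bigcup_j F j) + pr N))//.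
    by apply: pr_leU => //; exact: measurableU.
  rewrite N0 addr0; apply: (@le_trans _ _ (\sum_j pr (F j))).
    by apply: pr_le_sum.
  apply: (@le_trans _ _ (\sum_j (beta i j * pr B + e') * h)).
    apply: ler_sum => j _; rewrite /F; case: eqP => [_|/eqP ij].
      by rewrite measure0 mulr_ge0 ?ltW// ltr_wpDl// mulr_ge0// pr_ge0.
    by rewrite mulrC -ler_pdivrMl//; exact: Hd.
  rewrite -mulr_suml ler_pM2r// big_split /= -mulr_suml lerD//.
    by apply: ler_wpM2r; [exact: pr_ge0|exact: row_le].
  rewrite sumr_const /e' -[_ *+ _]mulr_natl mulrCA ler_piMr ?ltW//.
  by rewrite ltr_pdivrMr// mul1r ltr_nat ltnS.
- move=> v /andP[tv vu] e e0.
  have v0 : 0 < v := le_lt_trans t0 tv.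
  have H0 : (fine \o (fun h => P [set w | X (v - h) w <> X v w])) h @[h --> 0^'+] --> (0 : R).
    by apply: fine_cvg; exact: (vdjp_continuous_in_probability V v0).
  have H : \forall h \near 0^'+, pr [set w | X (v - h) w <> X v w] <= e.
    exact: cvgr_le H0 _ e0.
  near=> h; have h0 : 0 < h by near: h; exact: nbhs_right_gt.
  have hv : 0 <= v - h.
    by rewrite subr_ge0; near: h; apply: nbhs_right_le.
  rewrite lerBlDl /f.
  apply: (@le_trans _ _ (f (v - h) + pr [set w | X (v - h) w <> X v w])).
    apply: pr_leU; [exact: mf (ltW v0)|exact: mf|exact: mXneq (ltW v0)|].
    move=> w [Bw XN]; have [Xv|Xv] := pselect (X (v - h) w = i); last by left.
    by right => /=; rewrite Xv => /esym.
  by rewrite lerD2l; near: h.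
Unshelve. all: by end_near. Qed.

Definition grid t i (e : R) (M : nat) :=
  [set w | exists2 m : nat, (m <= M)%N & X (t + m%:R * e) w <> i].

Lemma grid_past t i (e : R) M : 0 <= t -> 0 <= e -> pastm (t + M%:R * e) (grid t i e M).
Proof.
move=> t0 e0; elim: M => [|M IH].
  rewrite (_ : grid _ _ _ _ = ~` [set w | X t w = i]).
    by apply: pastC; apply: past_X; rewrite mul0r addr0 t0 lexx.
  apply/seteqP; split=> [w [m]|w nX]; first by rewrite leqn0 => /eqP ->; rewrite mul0r addr0.
  by exists 0%N => //; rewrite mul0r addr0.
have tM : t + M%:R * e <= t + M.+1%:R * e.
  by rewrite lerD2l ler_wpM2r// ler_nat.
rewrite (_ : grid _ _ _ _ = grid t i e M `|` ~` [set w | X (t + M.+1%:R * e) w = i]).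
  apply: pastU; first exact: past_mono tM IH.
  by apply: pastC; apply: past_X; rewrite lexx andbT addr_ge0// mulr_ge0.
apply/seteqP; split=> [w [m]|w [[m mM nX]|nX]].
- by rewrite leq_eqVlt => /predU1P[->|]; [right|left; exists m].
- by exists m => //; exact: leqW.
- by exists M.+1.
Qed.

(** The part [B] of [A] on which no exit has been seen up to grid index [M] is an event of the past
    on which the process sits at [i], so [one_step] applies afresh. This stands in for the Markov
    property. *)
Lemma grid_bound t i (e : R) M A : 0 <= t -> 0 <= e -> pastm t A ->
  A `<=` [set w | X t w = i] -> pr (A `&` grid t i e M) <= C * pr A * (M%:R * e).
Proof.
move=> t0 e0 mA AX; have mA' := past_measurable mA.
have mG m := past_measurable (@grid_past t i e m t0 e0).
elim: M => [|M IH].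
  rewrite mul0r mulr0 (_ : _ `&` _ = set0) ?measure0//.
  apply/seteqP; split=> w //= [/AX Xi [m]].
  by rewrite leqn0 => /eqP ->; rewrite mul0r addr0.
have tM0 : 0 <= t + M%:R * e by rewrite addr_ge0// mulr_ge0.
have tM1 : t + M%:R * e <= t + M.+1%:R * e by rewrite lerD2l ler_wpM2r// ler_nat.
pose B := A `\` grid t i e M.
have tM : t <= t + M%:R * e by rewrite lerDl mulr_ge0.
have mB : pastm (t + M%:R * e) B.
  by apply: pastD; [exact: past_mono mA|exact: grid_past].
have BX : B `<=` [set w | X (t + M%:R * e) w = i].
  by move=> w [Aw nG]; apply: contrapT => nX; apply: nG; exists M.
have mB' := past_measurable mB.
have mS : measurable [set w | X (t + M.+1%:R * e) w <> i].
  by apply: mXN; exact: le_trans tM1.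
apply: (@le_trans _ _ (pr (A `&` grid t i e M) +
    pr (B `&` [set w | X (t + M.+1%:R * e) w <> i]))).
  apply: pr_leU; try exact: measurableI.
  move=> w [Aw [m]]; have [G|nG] := pselect (grid t i e M w); first by left.
  rewrite leq_eqVlt => /predU1P[-> nX|mM nX]; first by right.
  by exfalso; apply: nG; exists m.
have H := @one_step (t + M%:R * e) B i (t + M.+1%:R * e).
rewrite tM0 tM1 in H; have {}H := H isT mB BX.
have -> : C * pr A * (M.+1%:R * e) = C * pr A * (M%:R * e) + C * pr A * e.
  by rewrite -natr1; ring.
apply: lerD => //; apply: (le_trans H).
rewrite (_ : t + M.+1%:R * e - _ = e); last by rewrite -natr1; ring.
rewrite ler_wpM2r// ler_wpM2l ?total_rate_ge0//; apply: pr_le => //.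
by move=> w [].
Qed.

Definition jumped t i h := [set w | exists2 s, t <= s <= t + h & X s w <> i].

(** By right-continuity a visit away from [i] at a time before [t + h] lasts long enough to be seen
    at a dyadic time, and [t + h] is itself a grid point. The uncountable union thus becomes
    countable. *)
Lemma jumpedE t i h : 0 <= t -> 0 < h ->
  jumped t i h = \bigcup_k grid t i (h / 2 ^+ k) (2 ^ k).
Proof.
move=> t0 h0; apply/seteqP; split=> [w [s /andP[ts sth] nX]|w [k _ [m mk nX]]]; last first.
  exists (t + m%:R * (h / 2 ^+ k)) => //; apply/andP; split.
    by rewrite lerDl mulr_ge0// divr_ge0 ?exprn_ge0// ltW.
  rewrite lerD2l mulrCA ler_piMr ?(ltW h0)// ler_pdivrMr ?exprn_gt0// mul1r.
  by rewrite -natrX ler_nat.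
move: sth; rewrite le_eqVlt => /predU1P[sE|sth].
  by exists 0%N => //; exists 1%N => //; rewrite mul1r expr0 divr1 -sE.
have s0 : 0 <= s := le_trans t0 ts.
have /near_right_ex[e e0 He] := vdjp_right_continuous V w s0.
have [k hk] : exists k, h / 2 ^+ k < e.
  have : (fun k => h / 2 ^+ k) @ \oo --> 0.
    rewrite (_ : (fun _ => _) = geometric h (2^-1)).
      by apply: cvg_geometric; rewrite ger0_norm// invf_lt1// ltr1n.
    by apply/funext => k; rewrite /geometric /= exprVn.
  move=> /cvgrPdist_lt/(_ _ e0)[N _ HN]; exists N.
  by have := HN N (leqnn N); rewrite sub0r normrN; apply: le_lt_trans; exact: ler_norm.
have k0 : 0 < (2 : R) ^+ k by rewrite exprn_gt0.
pose c := h / 2 ^+ k; have c0 : 0 < c by rewrite divr_gt0.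
(* The first grid point strictly to the right of [s]. *)
pose m := (Num.truncn ((s - t) / c)).+1.
have q0 : 0 <= (s - t) / c by rewrite divr_ge0 ?subr_ge0// ltW.
have /andP[m1 m2] := truncn_itv q0.
exists k => //; exists m.
  rewrite /m -ltnS ltnS truncn_lt_nat// natrX ltr_pdivrMr// /c mulrCA divff ?gt_eqF//.
  by rewrite mulr1; lra.
rewrite -/c (_ : t + m%:R * c = s + (t + m%:R * c - s)); last by ring.
rewrite He//; apply/andP; split.
  by move: m2; rewrite ltr_pdivrMr// -/m; lra.
apply: le_lt_trans hk; rewrite -/c.
by move: m1; rewrite ler_pdivlMr// /m -natr1; lra.
Qed.

Lemma measurable_jumped t i h : 0 <= t -> 0 < h -> measurable (jumped t i h).
Proof.
move=> t0 h0; rewrite jumpedE//; apply: bigcupT_measurable => k.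
by apply: past_measurable; apply: grid_past => //; rewrite divr_ge0 ?exprn_ge0// ltW.
Qed.

(** The dyadic grids increase, and [2^k] steps of size [h / 2^k] give the same bound for every [k],
    so continuity from below applies. *)
Lemma jumped_bound t i h A : 0 <= t -> 0 < h -> pastm t A ->
  A `<=` [set w | X t w = i] -> pr (A `&` jumped t i h) <= C * pr A * h.
Proof.
move=> t0 h0 mA AX; have mA' := past_measurable mA.
pose G k := A `&` grid t i (h / 2 ^+ k) (2 ^ k).
have hk0 k : 0 <= h / 2 ^+ k by rewrite divr_ge0 ?exprn_ge0// ltW.
have mG k : measurable (G k).
  by apply: measurableI => //; apply: past_measurable; exact: grid_past.
have JE : A `&` jumped t i h = \bigcup_k G k by rewrite jumpedE// setI_bigcupr.
have mJ : measurable (\bigcup_k G k) by exact: bigcupT_measurable.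
have ndG : nondecreasing_seq G.
  apply/nondecreasing_seqP => k; apply/subsetPset => w [Aw [m mk nX]]; split => //.
  exists (m * 2)%N; first by rewrite expnSr leq_mul2r.
  rewrite (_ : (m * 2)%:R * (h / 2 ^+ k.+1) = m%:R * (h / 2 ^+ k))//.
  by rewrite natrM exprS invfM; field; rewrite expf_neq0.
have cG : fine (P (G k)) @[k --> \oo] --> fine (P (\bigcup_k G k)).
  apply: fine_cvg; rewrite fineK ?fin_num_measure//.
  exact: nondecreasing_cvg_mu.
rewrite JE; apply: (cvgr_to_le cG); apply: nearW => k /=.
apply: (le_trans (@grid_bound t i (h / 2 ^+ k) _ A t0 (hk0 k) mA AX)).
by rewrite natrX [2 ^+ k * _]mulrC divfK// expf_neq0.
Qed.

Section stopped_martingale.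
Variables (gam : R) (F : Lam -> (Lam -> R) -> R).
Hypotheses (gam0 : 0 < gam) (bF : forall i, bucont (F i)).
Hypothesis F_vanish : forall i (l : Lam -> R) j, j != a -> l j <= 0 -> F i l = 0.
Hypothesis F_stop : forall l, l a <= gam -> F a l = F a (upd l a gam).
Hypothesis F_der : forall i (l : Lam -> R), l i < 2 -> (i = a -> gam < l a) ->
  is_derive (l i) 1 (fun x => F i (upd l i x)) (drift beta F i l).

(* [stopped_value] is [F] evaluated along the process frozen when the local
   time left at [a] falls to [gam]; its expectation is constant in time. *)
Definition running w j s := (X s w == j) && (gam < L s w a).
(** Freezing acts on the integrand instead of producing a random upper limit, so this is again [z]
    minus an occupation time, with the monotonicity and measurability already proved for those. *)
Definition stopped_local t w j := z j - occ (running w j) t.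
(** The local time left at [a] decreases only while the process is at [a], so this is the site at
    which freezing takes place. *)
Definition stopped_site t w := if gam < L t w a then X t w else a.
Definition stopped_value t w := F (stopped_site t w) (stopped_local t w).
Notation Lh := stopped_local.
Notation Zh := stopped_site.
Notation Y := stopped_value.

Lemma running_rlc w j : right_locally_constant (running w j).
Proof.
move=> t t0; have HX := vdjp_rlc w j t0.
have [gL|Lg] := ltP gam (L t w a).
  have HL : \forall h \near 0^'+, gam < L (t + h) w a.
    apply: (near_right_of (d := L t w a - gam)); first by rewrite subr_gt0.
    move=> h /andP[h0 hL]; have := @diminished_incr t (t + h) w a.
    by rewrite t0 lerDl (ltW h0) => /(_ isT) /andP[_]; lra.
  by apply: filterS2 HX HL => h; rewrite /running => -> ->; rewrite gL.
apply: (near_right_of (d := 1)) => // h /andP[h0 _]; rewrite /running.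
have Lg' : L (t + h) w a <= gam.
  have := @diminished_incr t (t + h) w a.
  by rewrite t0 lerDl (ltW h0) => /(_ isT) /andP[+ _]; lra.
by rewrite !ltNge Lg Lg' !andbF.
Qed.

Lemma stopped_local_incr t u w j : 0 <= t <= u -> 0 <= Lh t w j - Lh u w j <= u - t.
Proof.
move=> tu; have /andP[H1 H2] := occ_incr (running_rlc w j) tu.
by rewrite /stopped_local; apply/andP; split; lra.
Qed.

(** This includes the first passage time itself, thanks to the exempt endpoint in [occ_eq]. *)
Lemma stopped_local_before u w : 0 <= u -> (forall s, 0 <= s < u -> gam < L s w a) ->
  Lh u w = L u w.
Proof.
move=> u0 H; apply/funext => j; rewrite /stopped_local diminishedE; congr (_ - _).
apply: occ_eq => //; [exact: running_rlc|exact: vdjp_rlc|].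
by move=> s su; rewrite /running H// andbT.
Qed.

Lemma stopped_local_eq u w : 0 <= u -> gam < L u w a -> Lh u w = L u w.
Proof.
move=> u0 gL; apply: stopped_local_before => // s /andP[s0 su].
have := @diminished_incr s u w a; rewrite s0 (ltW su) => /(_ isT) /andP[+ _].
by lra.
Qed.

Lemma stopped_local_after t u w : 0 <= t <= u -> L t w a <= gam -> Lh u w = Lh t w.
Proof.
move=> /[dup] tu /andP[t0 tu'] Lg; apply/funext => j.
have := occ_const (c := false) (running_rlc w j) tu.
rewrite /stopped_local mul0r => H; rewrite -[occ _ u](subrK (occ (running w j) t)) H ?add0r//.
move=> s /andP[ts su]; rewrite /running ltNge (_ : L s w a <= gam) ?andbF//.
have := @diminished_incr t s w a; rewrite t0 (ltW ts) => /(_ isT) /andP[+ _]; lra.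
Qed.



Let mgt t : 0 <= t -> measurable [set w | gam < L t w a].
Proof. by move=> t0; apply: past_measurable; exact: past_gt. Qed.

Lemma measurable_stopped_local t j : 0 <= t -> measurable_fun setT (fun w => Lh t w j).
Proof.
move=> t0; apply: measurable_funB => //.
apply: (@measurable_occ R _ Om (fun s w => running w j s) t t0); last first.
  by move=> w; exact: running_rlc.
move=> s /andP[s0 _]; rewrite (_ : mkset _ = [set w | X s w = j] `&` [set w | gam < L s w a]).
  by apply: measurableI; [exact: mX|exact: mgt].
apply/seteqP; split=> w /=; rewrite /running; first by move=> /andP[/eqP].
by move=> [-> ->]; rewrite eqxx.
Qed.

Lemma F_bound : exists2 M : R, 0 < M & forall i l, `|F i l| <= M.
Proof.
have [M_ HM] := choice (fun i => (bF i).2).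
exists (1 + \sum_i `|M_ i|); first by rewrite ltr_wpDr// sumr_ge0.
move=> i l; rewrite (le_trans (HM i l))// (le_trans (ler_norm _))//.
by rewrite ler_wpDl// (bigD1 i)//= lerDl sumr_ge0.
Qed.

Lemma bmf_stopped_value t : 0 <= t -> bmf (Y t).
Proof.
move=> t0; have [M _ HM] := F_bound; split; last by exists M => w; exact: HM.
rewrite (_ : Y t = (fun w => \sum_i (\1_[set w | Zh t w = i] w * F i (Lh t w)))); last first.
  apply/funext => w; rewrite (bigD1 (Zh t w))//= indicE mem_set// mul1r big1 ?addr0//.
  move=> i iZ; rewrite indicE memNset ?mul0r// => Zi.
  by move: iZ; rewrite -Zi eqxx.
apply: measurable_sum => i.
apply: measurable_funM.
  apply: measurable_indic.
  rewrite (_ : mkset _ = ([set w | gam < L t w a] `&` [set w | X t w = i]) `|`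
    (~` [set w | gam < L t w a] `&` [set w | a = i])).
    apply: measurableU; apply: measurableI; [exact: mgt|exact: mX|..].
      by apply: measurableC; exact: mgt.
    have [->|ai] := eqVneq a i; first by rewrite (_ : mkset _ = setT)//; apply/seteqP.
    by rewrite (_ : mkset _ = set0)//; apply/seteqP; split => w //= /eqP; rewrite (negbTE ai).
  apply/seteqP; split=> w /=; rewrite /stopped_site; case: ifP => gL.
  - by left.
  - by right.
  - by case=> [[]|[]].
  - by case=> [[]|[]].
apply: (ucont_measurable (phi := fun j w => Lh t w j)); first exact: (bF i).1.
by move=> j; exact: measurable_stopped_local.
Qed.

(** For [i = a] the derivative is known only strictly above [gam]; the mean value theorem asks for
    mere continuity at the ends, so [x = gam] is allowed. *)
Lemma mvt_own i l (x y : R) : x < y -> y < 2 -> (i = a -> gam <= x) ->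
  exists2 c, x < c < y &
    F i (upd l i y) - F i (upd l i x) = drift beta F i (upd l i c) * (y - x).
Proof.
move=> xy y2 ia.
have [] := @MVT R (fun r => F i (upd l i r)) (fun r => drift beta F i (upd l i r)) x y xy.
- move=> c; rewrite in_itv /= => /andP[xc cy].
  have := @F_der i (upd l i c); rewrite {1 2}/upd eqxx.
  have cE : upd l i c i = c by rewrite /upd eqxx.
  rewrite cE => H; have {}H := H (lt_trans cy y2).
  rewrite (_ : (fun r => _) = (fun r => F i (upd (upd l i c) i r))).
    by apply: H => ia'; move: (ia ia'); rewrite /upd -ia' eqxx; lra.
  by apply/funext => r; rewrite upd_upd.
- by apply: continuous_subspaceT; exact: bucont_upd_continuous.
by move=> c; rewrite in_itv /= => cxy ->; exists c.
Qed.

(** A step at [a] may overshoot [gam]. As [F a] is constant in [l a] below [gam], the step can be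
    cut off there before the mean value theorem is applied. *)
Lemma own_step_lip i l h (D : R) : 0 < h -> l i <= 1 -> (i = a -> gam < l a) ->
  (forall l', `|drift beta F i l'| <= D) ->
  `|F i (upd l i (l i - h)) - F i l| <= D * h.
Proof.
move=> h0 l1 ia HD.
pose x := if i == a then Num.max gam (l i - h) else l i - h.
have xl : x < l i.
  rewrite /x; case: eqP => [/[dup] /ia + ->|_]; last by lra.
  by rewrite gt_max => ->/=; lra.
have -> : F i (upd l i (l i - h)) = F i (upd l i x).
  rewrite /x; case: eqP => [->|//]; have [//|lg] := leP gam (l a - h).
  by rewrite F_stop ?upd_upd// /upd eqxx ltW.
have xa : i = a -> gam <= x.
  by move=> ia'; rewrite /x ia' eqxx le_max lexx.
have [c _] := @mvt_own i l x (l i) xl ltac:(lra) xa.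
rewrite upd_id distrC => ->; rewrite normrM ler_pM//.
rewrite ger0_norm ?subr_ge0 ?(ltW xl)//.
suff : l i - h <= x by lra.
by rewrite /x; case: ifP => // _; rewrite le_max lexx orbT.
Qed.

(** The mean value theorem evaluates the drift within distance [h] of [l], where it is compared with
    the drift at [l]. *)
Lemma own_step_der i l h (e : R) : 0 < h -> l i <= 1 -> (i = a -> gam <= l a - h) ->
  (forall l l', (forall j, `|l j - l' j| <= h) ->
     `|drift beta F i l - drift beta F i l'| <= e) ->
  `|F i (upd l i (l i - h)) - F i l + h * drift beta F i l| <= h * e.
Proof.
move=> h0 l1 ia De.
have xa : i = a -> gam <= l i - h by move=> /[dup] ia' /ia; rewrite ia'.
have [c /andP[c1 c2]] := @mvt_own i l (l i - h) (l i) ltac:(lra) ltac:(lra) xa.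
rewrite upd_id => E.
rewrite (_ : F i (upd l i (l i - h)) - F i l + h * drift beta F i l =
  h * (drift beta F i l - drift beta F i (upd l i c))); last first.
  by rewrite -[F i _ - _]opprB E; ring.
rewrite normrM (ger0_norm (ltW h0)) ler_wpM2l ?(ltW h0)//.
apply: De => j; rewrite /upd; case: eqP => [->|_]; last by rewrite subrr normr0 ltW.
by rewrite ler_norml; apply/andP; split; lra.
Qed.

(** Either the process is already frozen at [a], or some local time is exhausted and [F] vanishes
    from then on; the exhausted site differs from [a] because [gam > 0]. *)
Lemma stopped_value_frozen t h w : 0 <= t -> 0 < h ->
  ~ (alive t w /\ gam < L t w a) -> Y (t + h) w = Y t w.
Proof.
move=> t0 h0 nA; have th : 0 <= t <= t + h by rewrite t0 lerDl ltW.
have [gL|Lg] := ltP gam (L t w a); last first.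
  have Lg' : L (t + h) w a <= gam.
    by have /andP[+ _] := diminished_incr w a th; lra.
  rewrite /stopped_value /stopped_site !ltNge Lg Lg' /=.
  by rewrite (stopped_local_after th Lg).
have [j Lj] : exists j, L t w j <= 0.
  apply: contrapT => nj; apply: nA; split => // j; rewrite ltNge; apply/negP => Lj.
  by apply: nj; exists j.
have ja : j != a by apply: contraTneq Lj => ->; rewrite -ltNge (lt_trans gam0).
have Hj : Lh t w j <= 0 by rewrite stopped_local_eq.
rewrite /stopped_value !(F_vanish _ ja)//.
by have /andP[+ _] := stopped_local_incr w j th; lra.
Qed.

(** Without a jump only the coordinate of the current site moves, at unit speed. The formula
    survives a freezing inside [[t, t + h]], which can occur only for [i = a], since [F a] does not
    depend on [l a] below [gam]. *)
Lemma stopped_value_nojump t h w i : 0 <= t -> 0 < h -> gam < L t w a ->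
  X t w = i -> ~ jumped t i h w ->
  Y (t + h) w = F i (upd (L t w) i (L t w i - h)).
Proof.
move=> t0 h0 gL Xi nJ; have th : 0 <= t <= t + h by rewrite t0 lerDl ltW.
have th0 : 0 <= t + h by rewrite addr_ge0// ltW.
have Xs s : t <= s <= t + h -> X s w = i.
  by move=> st; apply: contrapT => nX; apply: nJ; exists s.
have LE' s j : t <= s <= t + h -> L s w j = L t w j - (j == i)%:R * (s - t).
  move=> /andP[ts sth]; apply: diminished_const; first by rewrite t0.
  by move=> r /andP[tr rs]; apply: Xs; rewrite (ltW tr) (le_trans rs).
have thh : t <= t + h <= t + h by rewrite lexx lerDl ltW.
have LthE : L (t + h) w = upd (L t w) i (L t w i - h).
  apply/funext => j; rewrite (LE' _ _ thh) /upd; case: eqP => [->|_].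
    by rewrite mul1r; ring.
  by rewrite mul0r subr0.
have [gL'|Lg'] := ltP gam (L (t + h) w a).
  rewrite /stopped_value /stopped_site gL' (Xs _ thh).
  by rewrite stopped_local_eq// LthE.
have ia : i = a.
  apply: contrapT => /eqP /negbTE ia; move: Lg'; rewrite (LE' _ _ thh) eq_sym ia mul0r; lra.
(* The time left until the local time at [a] meets [gam]. *)
pose del := L t w a - gam.
have Ltha : L (t + h) w a = L t w a - h by rewrite (LE' _ _ thh) ia eqxx mul1r; ring.
have del0 : 0 < del by rewrite subr_gt0.
have delh : del <= h by move: Lg'; rewrite Ltha /del; lra.
have tdel : t <= t + del <= t + h by rewrite lerDl (ltW del0) lerD2l.
have Ldel : L (t + del) w a = gam by rewrite (LE' _ _ tdel) ia eqxx mul1r /del; ring.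
rewrite /stopped_value /stopped_site ltNge Lg' /= ia.
rewrite (@stopped_local_after (t + del) (t + h)); last first.
- by rewrite Ldel.
- by rewrite addr_ge0 ?(ltW del0)//= lerD2l.
rewrite stopped_local_before.
- rewrite F_stop ?Ldel// [RHS]F_stop ?upd_upd; last by rewrite /upd eqxx -Ltha.
  congr (F a _); apply/funext => j; rewrite /upd; case: eqP => // /eqP/negbTE ja.
  by rewrite (LE' _ _ tdel) ia ja mul0r subr0.
- by rewrite addr_ge0 ?(ltW del0).
- move=> s /andP[s0 std]; have [st|ts] := leP s t.
    have := @diminished_incr s t w a; rewrite s0 st => /(_ isT)/andP[+ _]; lra.
  have sth : t <= s <= t + h by rewrite (ltW ts)/=; lra.
  by rewrite (LE' _ _ sth) ia eqxx mul1r; move: std; rewrite /del; lra.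
Qed.

Lemma ucont_near (f : (Lam -> R) -> R) (e : R) : ucont f -> 0 < e ->
  \forall h \near 0^'+, forall l l', (forall j, `|l j - l' j| <= h) -> `|f l - f l'| <= e.
Proof.
move=> uf e0; have [d0 d00 H] := uf e e0.
apply: (near_right_of d00) => h /andP[_ hd] l l' ll'; apply: H => j.
by rewrite (le_trans (ll' j))// ltW.
Qed.



(** The bound does not involve [t], so it can be used with starting time [t - h] and yields
    continuity from the left. The rate estimate below cannot serve for this, as its range of [h]
    depends on [t]. *)
Lemma stopped_value_cont t h (e M : R) : 0 <= t -> 0 < h ->
  (forall i l, `|F i l| <= M) ->
  (forall i l l', (forall j, `|l j - l' j| <= h) -> `|F i l - F i l'| <= e) ->
  `|\int[P]_w Y (t + h) w - \int[P]_w Y t w| <= e + 2 * M * (#|Lam|%:R * C * h).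
Proof.
move=> t0 h0 HM He.
have th0 : 0 <= t + h by rewrite addr_ge0// ltW.
have bY := bmf_stopped_value t0; have bYh := bmf_stopped_value th0.
have mJ i : measurable ([set w | X t w = i] `&` jumped t i h).
  by apply: measurableI; [exact: mX|exact: measurable_jumped].
have bJ i : bmf (\1_([set w | X t w = i] `&` jumped t i h) : Om -> R) by exact: bmf_indic.
rewrite -EB//; apply: (le_trans (E_norm P _)); first exact: bmfB.
apply: (@le_trans _ _ (\int[P]_w (e + 2 * M *
    \sum_i \1_([set w | X t w = i] `&` jumped t i h) w))).
  apply: E_le.
  - by apply: bmf_norm; exact: bmfB.
  - by apply: bmfD; [exact: bmf_cst|apply: bmfM; [exact: bmf_cst|exact: bmf_sum]].
  move=> w.
  have e0 : 0 <= e.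
    apply: le_trans (He a z z _); first exact: normr_ge0.
    by move=> j; rewrite subrr normr0 ltW.
  have M0 : 0 <= M := le_trans (normr_ge0 _) (HM a z).
  have s0 : 0 <= \sum_i (\1_([set w | X t w = i] `&` jumped t i h) w : R).
    by rewrite sumr_ge0.
  have [A|nA] := pselect (alive t w /\ gam < L t w a); last first.
    by rewrite stopped_value_frozen// subrr normr0 addr_ge0// !mulr_ge0.
  have [J|nJ] := pselect (jumped t (X t w) h w).
    apply: (@le_trans _ _ (2 * M)).
      by rewrite (le_trans (ler_normB _ _))// mulrDl mul1r lerD// HM.
    rewrite ler_wpDl// ler_peMr ?mulr_ge0//.
    by rewrite (bigD1 (X t w))//= indicE mem_set//= lerDl sumr_ge0.
  rewrite (stopped_value_nojump t0 h0 A.2 erefl nJ).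
  rewrite ler_wpDr ?mulr_ge0//.
  rewrite /stopped_value /stopped_site A.2 stopped_local_eq//; last exact: A.2.
  apply: He => j; rewrite /upd; case: eqP => [->|_]; last by rewrite subrr normr0 ltW.
  by rewrite addrAC subrr add0r normrN ger0_norm// ltW.
rewrite ED; [|exact: bmf_cst|by apply: bmfM; [exact: bmf_cst|exact: bmf_sum]].
rewrite E_cst lerD2l EZ; last exact: bmf_sum.
have M0 : 0 <= M := le_trans (normr_ge0 _) (HM a z).
rewrite ler_wpM2l ?mulr_ge0// E_sum//.
apply: (@le_trans _ _ (\sum_(i : Lam) C * h)).
  apply: ler_sum => i _; rewrite E_indic//.
  have mXi : pastm t [set w | X t w = i] by apply: past_X; rewrite t0 lexx.
  apply: (le_trans (@jumped_bound t i h _ t0 h0 mXi _)) => //.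
  have C0 := total_rate_ge0.
  by rewrite ler_wpM2r ?(ltW h0)// ler_piMr// pr_le1//; exact: mX.
by rewrite sumr_const -[leLHS]mulr_natl mulrA.
Qed.

Definition running_at t i := alive t `&` [set w | gam < L t w a] `&` [set w | X t w = i].
Notation A_ := running_at.

Lemma past_running_at t i : 0 <= t -> pastm t (A_ t i).
Proof.
move=> t0; apply: pastI; first by apply: pastI; [exact: past_alive|exact: past_gt].
by apply: past_X; rewrite t0 lexx.
Qed.

(* Off this event the local time left at [a] stays above [gam] on [[t, t + h]]. *)
Let near_hit t h := [set w | L t w a <= gam + h].

Let mnear_hit t h : 0 <= t -> pastm t (near_hit t h).
Proof.
move=> t0; rewrite (_ : near_hit t h = ~` [set w | gam + h < L t w a]).
  by apply: pastC; exact: past_gt.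
by apply/seteqP; split=> w /=; rewrite /near_hit /= leNgt => /negP.
Qed.

(** On [running_at t i] the local time at [a] exceeds [gam], so the events decrease to the empty set
    as [h] tends to 0. *)
Lemma near_hit_small t i (e : R) : 0 <= t -> 0 < e ->
  \forall h \near 0^'+, pr (A_ t i `&` near_hit t h) <= e.
Proof.
move=> t0 e0.
pose G n := A_ t i `&` near_hit t (n.+1%:R^-1).
have mA := past_measurable (past_running_at i t0).
have mG n : measurable (G n).
  by apply: measurableI => //; exact: past_measurable (mnear_hit _ t0).
have G0 : \bigcap_n G n = set0.
  apply/seteqP; split=> // w H; have [[[_ /= gL] _] _] := H 0%N I.
  have d0 : 0 < L t w a - gam by rewrite subr_gt0.
  have := @cvg_harmonic R; move=> /cvgrPdist_lt/(_ _ d0)[N _ HN].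
  have hN : (N.+1%:R^-1 : R) < L t w a - gam.
    by have := HN N (leqnn N); rewrite sub0r normrN ger0_norm ?invr_ge0.
  have [_ Kw] := H N I; have {}Kw : L t w a <= gam + N.+1%:R^-1 by [].
  by move: Kw; rewrite leNgt -ltrBrDl hN.
have niG : nonincreasing_seq G.
  apply/nonincreasing_seqP => n; apply/subsetPset => w [Aw Gw]; split => //.
  rewrite /near_hit /= (le_trans Gw)// lerD2l lef_pV2 ?posrE// ler_nat//.
have cG : fine (P (G n)) @[n --> \oo] --> (0 : R).
  apply: fine_cvg; rewrite -[0%:E](measure0 P) -G0.
  apply: nonincreasing_cvg_mu => //.
  - by rewrite (le_lt_trans (probability_le1 P (mG 0%N)))// ltry.
  - by rewrite G0.
have [N _ HN] := cvgr_le _ cG _ e0.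
apply: (near_right_of (d := N.+1%:R^-1)) => // h /andP[h0 hN].
apply: le_trans (HN N (leqnn N)); apply: pr_le => //.
  by apply: measurableI => //; exact: past_measurable (mnear_hit _ t0).
move=> w [Aw]; rewrite /near_hit /= => Kw; split => //=.
by rewrite /near_hit /= (le_trans Kw)// lerD2l ltW.
Qed.

Lemma past_F t i : 0 <= t -> measurable_fun (setT : set (past t)) (fun w : past t => F i (L t w)).
Proof.
move=> t0; apply: (@ucont_measurable _ _ _ _ (past t) (fun j w => L t w j)).
  exact: (bF i).1.
by move=> j; exact: past_diminished.
Qed.

Lemma past_drift t i : 0 <= t ->
  measurable_fun (setT : set (past t)) (fun w : past t => drift beta F i (L t w)).
Proof.
move=> t0; apply: (@ucont_measurable _ _ _ _ (past t) (fun j w => L t w j)).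
  exact: (bucont_drift beta i bF).1.
by move=> j; exact: past_diminished.
Qed.

(** The jump part of the generator. The differences [F j - F i] at time [t] are bounded and
    measurable for the past, so the rate condition integrates against them; on the running event the
    local times lie in []0, 1]], where [clip2] has no effect. *)
Lemma running_rate t i : 0 <= t ->
  h^-1 * \int[P]_w (\sum_(j | j != i) \1_(jump_event t i j h) w *
     (\1_[set w | gam < L t w a] w * (F j (L t w) - F i (L t w)))) @[h --> 0^'+] -->
  \int[P]_w (\1_(A_ t i) w * drift beta F i (L t w)).
Proof.
move=> t0; have [M M0 HM] := F_bound.
pose phi j w : R := \1_[set w | gam < L t w a] w * (F j (L t w) - F i (L t w)).
have mphi j : measurable_fun (setT : set (past t)) (phi j : past t -> R).
  apply: measurable_funM; first by apply: measurable_indic; exact: past_gt.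
  by apply: measurable_funB; exact: past_F.
have bphi j : bmf (phi j).
  apply: (bmf_past (t := t) (M := 2 * M)); first exact: mphi.
  move=> w; rewrite /phi indicE.
  case: (_ \in _); rewrite ?mul1r ?mul0r ?normr0 ?mulr_ge0 ?(ltW M0)//.
  by rewrite (le_trans (ler_normB _ _))// mulrDl mul1r lerD.
have Gphi j r : pastm t [set w | r <= phi j w].
  have := mphi j measurableT `[r, +oo[%classic (measurable_itv _).
  by rewrite setTI; congr (measurable _); apply/seteqP; split=> w /=; rewrite in_itv/= andbT.
have cj j : i != j -> h^-1 * \int[P]_w (\1_(jump_event t i j h) w * phi j w) @[h --> 0^'+]
    --> \int[P]_w (phi j w * jump_rate t i j w).
  move=> ij; apply: (cvg_setwise_integral (G := fun A => pastm t A)) => //.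
  - exact: (@measurableT _ (past t)).
  - exact: past_measurable.
  - by move=> h h0; exact: measurable_jump_event.
  - exact: bmf_jump_rate.
  - by move=> A mA; exact: jump_event_rate.
rewrite (_ : \int[P]_w (\1_(A_ t i) w * drift beta F i (L t w)) =
  \sum_(j | j != i) \int[P]_w (phi j w * jump_rate t i j w)); last first.
  rewrite [RHS]big_mkcond /=.
  rewrite (eq_bigr (fun j => \int[P]_w ((j != i)%:R * (phi j w * jump_rate t i j w)))); last first.
    move=> j _; rewrite EZ; last by apply: bmfM => //; exact: bmf_jump_rate.
    by case: ifP => _; rewrite ?mul1r ?mul0r.
  rewrite -E_sum; last first.
    by move=> j; apply: bmfM; [exact: bmf_cst|apply: bmfM => //; exact: bmf_jump_rate].
  apply: eq_Rintegral => w _; rewrite /drift mulr_sumr; apply: eq_bigr => j _.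
  rewrite /phi /jump_rate !indicE.
  have [->|ji] := eqVneq j i; first by rewrite subrr !mulr0 !mul0r.
  have [Aw|nA] := pselect (A_ t i w).
    have [[al gL] Xi] := Aw.
    have AX : (alive t `&` [set w | X t w = i]) w by [].
    rewrite (mem_set Aw) (mem_set gL) (mem_set AX) /= !mul1r clip2_id; first by ring.
    by rewrite (ltW (al j))/=; have := diminished_le1 w j t0; lra.
  rewrite [in LHS]memNset// mul0r.
  have [gL|Lg] := pselect (gam < L t w a); last first.
    by rewrite [w \in [set w | gam < L t w a]]memNset// mul0r !(mul0r, mulr0).
  rewrite [w \in alive t `&` _]memNset ?mul0r ?mulr0//.
  by move=> [al Xi]; apply: nA; split => //; split.
pose S h := \sum_(j | j != i) (h^-1 * \int[P]_w (\1_(jump_event t i j h) w * phi j w)).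
have cS : S h @[h --> 0^'+] --> \sum_(j | j != i) \int[P]_w (phi j w * jump_rate t i j w).
  by apply: cvg_big => [|j ji]; [exact: add_continuous|apply: cj; rewrite eq_sym].
have ES : \forall h \near 0^'+, S h =
    h^-1 * \int[P]_w (\sum_(j | j != i) \1_(jump_event t i j h) w * phi j w).
  apply: (near_right_of (d := 1)) => // h /andP[h0 _].
  rewrite /S -mulr_sumr; congr (_ * _).
  have bj j : bmf (fun w => (j != i)%:R * (\1_(jump_event t i j h) w * phi j w)).
    apply: bmfM; first exact: bmf_cst.
    by apply: bmfM => //; apply: bmf_indic; exact: measurable_jump_event.
  rewrite big_mkcond /=.
  rewrite (eq_bigr (fun j =>
    \int[P]_w ((j != i)%:R * (\1_(jump_event t i j h) w * phi j w)))); last first.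
    move=> j _; rewrite EZ; last first.
      by apply: bmfM => //; apply: bmf_indic; exact: measurable_jump_event.
    by case: ifP => _; rewrite ?mul1r ?mul0r.
  rewrite -E_sum//; apply: eq_Rintegral => w _; rewrite [RHS]big_mkcond /=.
  by apply: eq_bigr => j _; case: ifP => _; rewrite ?mul1r ?mul0r.
exact: cvg_trans (near_eq_cvg ES) cS.
Qed.

Let mL t j : 0 <= t -> measurable_fun setT (fun w => L t w j).
Proof.
by move=> t0 _ B mB; apply: (@past_measurable t); exact: past_diminished.
Qed.

(** The generator annihilates [F]: the decrease of the local time at the current site contributes
    [- h * drift], the jumps contribute [+ h * drift]. The first expansion may fail near the level
    [gam], an event of small probability. The error due to a jump is small off that event and
    bounded on it, against a probability of order [h]. *)
Lemma stopped_value_rate t i (e : R) : 0 <= t -> 0 < e ->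
  \forall h \near 0^'+,
    `|\int[P]_w (\1_(A_ t i) w * (Y (t + h) w - Y t w))| <= e * h.
Proof.
move=> t0 e0; have [M M0 HM] := F_bound.
have [D D0 HD] := bucont_bound (bucont_drift beta i bF).
have e5 : 0 < e / 5 by rewrite divr_gt0.
have C0 := total_rate_ge0.
(* [e1] bounds the variation of [F] over a time [h] and [e2] the probability of [near_hit]; the
   denominators are the constants that multiply them in the final estimate. *)
pose e1 := e / 5 / (2 * C + 1); pose e2 := e / 5 / (2 * D + 4 * M * C + 1).
have c1 : 0 < 2 * C + 1 by rewrite ltr_wpDl// mulr_ge0.
have c2 : 0 < 2 * D + 4 * M * C + 1.
  by rewrite ltr_wpDl// addr_ge0 ?mulr_ge0// ltW.
have e10 : 0 < e1 by rewrite divr_gt0.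
have e20 : 0 < e2 by rewrite divr_gt0.
have N1 : \forall h \near 0^'+, forall k (l l' : Lam -> R),
    (forall j, `|l j - l' j| <= h) -> `|F k l - F k l'| <= e1.
  by apply: filter_forall => k; exact: (ucont_near (bF k).1 e10).
have N2 := ucont_near (bucont_drift beta i bF).1 e5.
have N3 := near_hit_small i t0 e20.
have := @running_rate t i t0 => /cvgrPdist_le /(_ _ e5) N4.
near=> h.
have h0 : 0 < h by near: h; exact: nbhs_right_gt.
have W1 : forall k (l l' : Lam -> R),
    (forall j, `|l j - l' j| <= h) -> `|F k l - F k l'| <= e1 by near: h.
have W2 : forall (l l' : Lam -> R), (forall j, `|l j - l' j| <= h) ->
    `|drift beta F i l - drift beta F i l'| <= e / 5 by near: h.
have W3 : pr (A_ t i `&` near_hit t h) <= e2 by near: h.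
have W4 : `|\int[P]_w (\1_(A_ t i) w * drift beta F i (L t w)) -
    h^-1 * \int[P]_w (\sum_(j | j != i) \1_(jump_event t i j h) w *
      (\1_[set w | gam < L t w a] w * (F j (L t w) - F i (L t w))))| <= e / 5 by near: h.
pose U2 w := \sum_(j | j != i) \1_(jump_event t i j h) w *
     (\1_[set w | gam < L t w a] w * (F j (L t w) - F i (L t w))).
pose Vd w := \1_(A_ t i) w * drift beta F i (L t w).
have {}W4 : `|\int[P]_w Vd w - h^-1 * \int[P]_w U2 w| <= e / 5 by exact: W4.
pose U1 w := \1_(A_ t i) w * (F i (upd (L t w) i (L t w i - h)) - F i (L t w)
  + h * drift beta F i (L t w)).
(* [U1] is the effect of the elapsed time compensated by the drift, [U2 - h * Vd] that of the jumps
   with the opposite compensation. On the running event the remainder vanishes unless a jump occurs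
   in [[t, t + h]]. *)
pose Err w := \1_(A_ t i) w * (Y (t + h) w - Y t w) - U1 w - (U2 w - h * Vd w).
have th0 : 0 <= t + h by rewrite addr_ge0// ltW.
have th : 0 <= t <= t + h by rewrite t0 lerDl ltW.
have bY := bmf_stopped_value t0; have bYh := bmf_stopped_value th0.
have pA := past_running_at i t0; have mA := past_measurable pA.
have bA : bmf (\1_(A_ t i) : Om -> R) by exact: bmf_indic.
have bFL k : bmf (fun w => F k (L t w)).
  by apply: (bmf_past (t := t) (M := M)); [exact: past_F|move=> w; exact: HM].
have bDL : bmf (fun w => drift beta F i (L t w)).
  by apply: (bmf_past (t := t) (M := D)); [exact: past_drift|move=> w; exact: HD].
have bFu : bmf (fun w => F i (upd (L t w) i (L t w i - h))).
  split; last by exists M => w; exact: HM.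
  apply: (ucont_measurable (phi := fun j w => upd (L t w) i (L t w i - h) j)).
    exact: (bF i).1.
  move=> j; rewrite /upd; case: eqP => _; last exact: mL.
  by apply: measurable_funB => //; exact: mL.
have bVd : bmf Vd by exact: bmfM.
have bU1 : bmf U1.
  apply: bmfM => //; apply: bmfD; first exact: bmfB.
  by apply: bmfM => //; exact: bmf_cst.
have bU2 : bmf U2.
  rewrite (_ : U2 = (fun w => \sum_j (j != i)%:R * (\1_(jump_event t i j h) w *
     (\1_[set w | gam < L t w a] w * (F j (L t w) - F i (L t w)))))); last first.
    apply/funext => w; rewrite /U2 big_mkcond; apply: eq_bigr => j _.
    by case: ifP => _; rewrite ?mul1r ?mul0r.
  apply: bmf_sum => j; apply: bmfM; first exact: bmf_cst.
  apply: bmfM; first by apply: bmf_indic; exact: measurable_jump_event.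
  by apply: bmfM; [apply: bmf_indic; exact: mgt|exact: bmfB].
have bhV : bmf (fun w => h * Vd w) by apply: bmfM => //; exact: bmf_cst.
have bU2V : bmf (fun w => U2 w - h * Vd w) by exact: bmfB.
have bT : bmf (fun w => \1_(A_ t i) w * (Y (t + h) w - Y t w)).
  by apply: bmfM => //; exact: bmfB.
have bTU : bmf (fun w => \1_(A_ t i) w * (Y (t + h) w - Y t w) - U1 w) by exact: bmfB.
have bErr : bmf Err by exact: bmfB.
have -> : \int[P]_w (\1_(A_ t i) w * (Y (t + h) w - Y t w)) =
    \int[P]_w U1 w + (\int[P]_w U2 w - h * \int[P]_w Vd w) + \int[P]_w Err w.
  rewrite -EZ// -EB// -ED// -ED//; last exact: bmfD.
  by apply: eq_Rintegral => w _; rewrite /Err; ring.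
have mJ : measurable (jumped t i h) by exact: measurable_jumped.
have mK : measurable (near_hit t h) by exact: past_measurable (mnear_hit _ t0).
have mAK : measurable (A_ t i `&` near_hit t h) by exact: measurableI.
have mAJ : measurable (A_ t i `&` jumped t i h) by exact: measurableI.
have mAKJ : measurable (A_ t i `&` near_hit t h `&` jumped t i h) by exact: measurableI.
have bAK : bmf (\1_(A_ t i `&` near_hit t h) : Om -> R) by exact: bmf_indic.
have bAJ : bmf (\1_(A_ t i `&` jumped t i h) : Om -> R) by exact: bmf_indic.
have bAKJ : bmf (\1_(A_ t i `&` near_hit t h `&` jumped t i h) : Om -> R).
  exact: bmf_indic.
(* Off [near_hit] the level [gam] is out of reach and the expansion holds up to [h * (e / 5)]. On it
   the Lipschitz bound still gives order [h], times a small probability. *)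
have B1 : `|\int[P]_w U1 w| <= h * (e / 5) + 2 * D * h * pr (A_ t i `&` near_hit t h).
  apply: (le_trans (E_norm P bU1)).
  apply: (@le_trans _ _ (\int[P]_w (h * (e / 5) +
      2 * D * h * \1_(A_ t i `&` near_hit t h) w))); last first.
    rewrite ED; [|exact: bmf_cst|by apply: bmfM => //; exact: bmf_cst].
    by rewrite E_cst EZ// E_indic.
  apply: E_le; [exact: bmf_norm| |].
    by apply: bmfD; [exact: bmf_cst|apply: bmfM => //; exact: bmf_cst].
  move=> w; have he : 0 <= h * (e / 5) by rewrite mulr_ge0 ?ltW.
  have Dh : 0 <= 2 * D * h by rewrite !mulr_ge0 ?ltW.
  have [Aw|nA] := pselect (A_ t i w); last first.
    by rewrite /U1 indicE memNset// mul0r normr0 addr_ge0// mulr_ge0.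
  have [[al gL] Xi] := Aw.
  rewrite /U1 indicE (mem_set Aw) mul1r.
  have l1 : L t w i <= 1 by exact: diminished_le1.
  have [Kw|nK] := pselect (near_hit t h w).
    rewrite indicE (mem_set (conj Aw Kw : (A_ t i `&` near_hit t h) w)) mulr1.
    rewrite ler_wpDl// (_ : 2 * D * h = D * h + h * D); last by ring.
    rewrite (le_trans (ler_normD _ _))// lerD//.
      by apply: own_step_lip => // ->.
    by rewrite normrM (ger0_norm (ltW h0)) ler_wpM2l ?(ltW h0).
  apply: (@le_trans _ _ (h * (e / 5))); last by rewrite lerDl mulr_ge0.
  apply: (@own_step_der i (L t w) h (e / 5) h0 l1 _ W2) => _.
  by move/negP : nK; rewrite /near_hit /= -ltNge; lra.
have B2 : `|\int[P]_w U2 w - h * \int[P]_w Vd w| <= h * (e / 5).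
  rewrite (_ : _ - _ = - (h * (\int[P]_w Vd w - h^-1 * \int[P]_w U2 w))); last first.
    by rewrite mulrBr mulrA divff ?gt_eqF// mul1r opprB.
  by rewrite normrN normrM (ger0_norm (ltW h0)) ler_wpM2l ?(ltW h0).
(* After a jump, off [near_hit], the remainder consists of two differences of values of [F] at local
   times at most [h] apart. On [near_hit] only the bound by four values of [F] is left. *)
have B3 : `|\int[P]_w Err w| <= 2 * e1 * pr (A_ t i `&` jumped t i h) +
    4 * M * pr (A_ t i `&` near_hit t h `&` jumped t i h).
  apply: (le_trans (E_norm P bErr)).
  apply: (@le_trans _ _ (\int[P]_w (2 * e1 * \1_(A_ t i `&` jumped t i h) w +
      4 * M * \1_(A_ t i `&` near_hit t h `&` jumped t i h) w))); last first.
    rewrite ED; [|by apply: bmfM => //; exact: bmf_cst|by apply: bmfM => //; exact: bmf_cst].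
    by rewrite !EZ// !E_indic.
  apply: E_le; [exact: bmf_norm|by apply: bmfD; apply: bmfM => //; exact: bmf_cst|].
  move=> w; have ee : 0 <= 2 * e1 by rewrite mulr_ge0 ?ltW.
  have MM : 0 <= 4 * M by rewrite mulr_ge0 ?ltW.
  have R0 : 0 <= 2 * e1 * \1_(A_ t i `&` jumped t i h) w +
      4 * M * \1_(A_ t i `&` near_hit t h `&` jumped t i h) w.
    by rewrite addr_ge0// mulr_ge0.
  have [Aw|nA] := pselect (A_ t i w); last first.
    suff -> : Err w = 0 by rewrite normr0.
    rewrite /Err /U1 /Vd indicE memNset// !mul0r mulr0 !subr0 sub0r.
    rewrite /U2 big1 ?oppr0// => j _; rewrite !indicE.
    have [[al [Xi _]]|nj] := pselect (jump_event t i j h w); last first.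
      by rewrite [w \in jump_event _ _ _ _]memNset// mul0r.
    rewrite [w \in [set _ | gam < _]]memNset ?mul0r ?mulr0// => gL.
    by apply: nA; split => //; split.
  have [[al gL] Xi] := Aw.
  have U2E : U2 w = F (X (t + h) w) (L t w) - F i (L t w).
    have EJ j : \1_(jump_event t i j h) w = (X (t + h) w == j)%:R :> R.
      rewrite indicE; congr (_%:R); case: eqP => [Xj|nX]; first by rewrite mem_set.
      by rewrite memNset// => -[_ []].
    have [XE|XN] := eqVneq (X (t + h) w) i.
      rewrite XE subrr /U2 big1// => j /negbTE ji.
      by rewrite EJ XE eq_sym ji mul0r.
    rewrite /U2 (bigD1 (X (t + h) w))//= EJ eqxx mul1r indicE (mem_set gL) mul1r.
    rewrite big1 ?addr0// => j /andP[_ /negbTE ji].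
    by rewrite EJ eq_sym ji mul0r.
  have YtE : Y t w = F i (L t w).
    by rewrite /stopped_value /stopped_site gL Xi stopped_local_eq.
  have ErrE : Err w = Y (t + h) w - F i (upd (L t w) i (L t w i - h))
      - F (X (t + h) w) (L t w) + F i (L t w).
    by rewrite /Err /U1 /Vd U2E YtE indicE (mem_set Aw) /= !mul1r; ring.
  have [Jw|nJ] := pselect (jumped t i h w); last first.
    suff -> : Err w = 0 by rewrite normr0.
    have Xh : X (t + h) w = i.
      by apply: contrapT => nX; apply: nJ; exists (t + h) => //; rewrite lexx lerDl ltW.
    rewrite ErrE (stopped_value_nojump t0 h0 gL Xi nJ) Xh; ring.
  have [Kw|nK] := pselect (near_hit t h w).
    rewrite [\1_(_ `&` near_hit t h `&` _) w]indicE.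
    rewrite (mem_set (conj (conj Aw Kw) Jw : (A_ t i `&` near_hit t h `&` jumped t i h) w)).
    rewrite mulr1; apply: (@le_trans _ _ (4 * M)); last by rewrite lerDr mulr_ge0.
    rewrite ErrE.
    rewrite (_ : 4 * M = M + M + M + M); last by ring.
    apply: (le_trans (ler_normD _ _)); apply: lerD => //.
    apply: (le_trans (ler_normB _ _)); apply: lerD => //.
    by apply: (le_trans (ler_normB _ _)); apply: lerD => //; exact: HM.
  rewrite [\1_(A_ t i `&` jumped _ _ _) w]indicE.
  rewrite (mem_set (conj Aw Jw : (A_ t i `&` jumped t i h) w)) mulr1.
  apply: (@le_trans _ _ (2 * e1)); last by rewrite lerDl mulr_ge0.
  have gLh : gam < L (t + h) w a.
    have /andP[_] := diminished_incr w a th.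
    by move/negP : nK; rewrite /near_hit /= -ltNge; lra.
  have YhE : Y (t + h) w = F (X (t + h) w) (L (t + h) w).
    by rewrite /stopped_value /stopped_site gLh stopped_local_eq.
  rewrite ErrE YhE (_ : _ + _ = (F (X (t + h) w) (L (t + h) w) - F (X (t + h) w) (L t w))
    + (F i (L t w) - F i (upd (L t w) i (L t w i - h)))); last by ring.
  rewrite (_ : 2 * e1 = e1 + e1); last by ring.
  apply: (le_trans (ler_normD _ _)); apply: lerD; apply: W1 => j.
    have /andP[H1 H2] := diminished_incr w j th.
    rewrite distrC ler_norml; apply/andP; split.
      by apply: le_trans H1; rewrite oppr_le0 ltW.
    by move: H2; rewrite (addrC t) addrK.
  rewrite /upd; case: eqP => [->|_]; last by rewrite subrr normr0 ltW.
  by rewrite subKr gtr0_norm.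
have AX : A_ t i `<=` [set w | X t w = i] by move=> w [].
have J1 := @jumped_bound t i h _ t0 h0 pA AX.
have AKX : A_ t i `&` near_hit t h `<=` [set w | X t w = i] by move=> w [[]].
(* [near_hit] is an event of the past, so the jump bound multiplies its probability by [C * h]. *)
have J2 := @jumped_bound t i h _ t0 h0 (pastI pA (mnear_hit _ t0)) AKX.
have prA1 : pr (A_ t i) <= 1 by exact: pr_le1.
have hC : 0 <= C * h by rewrite mulr_ge0// ltW.
have J1' : pr (A_ t i `&` jumped t i h) <= C * h.
  by apply: (le_trans J1); rewrite mulrAC ler_piMr.
have J2' : pr (A_ t i `&` near_hit t h `&` jumped t i h) <= C * h * e2.
  by apply: (le_trans J2); rewrite mulrAC ler_wpM2l.
have K1 : 2 * e1 * pr (A_ t i `&` jumped t i h) <= h * (e / 5).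
  apply: (@le_trans _ _ (2 * e1 * (C * h))); first by rewrite ler_wpM2l// mulr_ge0 ?ltW.
  rewrite (_ : 2 * e1 * (C * h) = h * (e1 * (2 * C))); last by ring.
  rewrite ler_wpM2l ?(ltW h0)// /e1 mulrAC -mulrA ler_piMr ?(ltW e5)//.
  by rewrite ler_pdivrMr// mul1r lerDl.
have K2 : 2 * D * h * pr (A_ t i `&` near_hit t h) +
    4 * M * pr (A_ t i `&` near_hit t h `&` jumped t i h) <= h * (e / 5).
  apply: (@le_trans _ _ (2 * D * h * e2 + 4 * M * (C * h * e2))).
    by apply: lerD; apply: ler_wpM2l => //; rewrite !mulr_ge0 ?ltW.
  rewrite (_ : _ + _ = h * (e2 * (2 * D + 4 * M * C))); last by ring.
  rewrite ler_wpM2l ?(ltW h0)// /e2 mulrAC -mulrA ler_piMr ?(ltW e5)//.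
  by rewrite ler_pdivrMr// mul1r lerDl.
apply: (le_trans (ler_normD _ _)).
apply: (le_trans (lerD (ler_normD _ _) (lexx _))).
have -> : e * h = h * (e / 5) * 5 by field.
have he : 0 <= h * (e / 5) by rewrite mulr_ge0 ?ltW.
move: B1 B2 B3 K1 K2 he.
move: (`|\int[P]_w U1 w|) (`|\int[P]_w U2 w - h * \int[P]_w Vd w|)
  (`|\int[P]_w Err w|) => x1 x2 x3.
move: (pr (A_ t i `&` near_hit t h `&` jumped t i h)) (pr (A_ t i `&` near_hit t h))
  (pr (A_ t i `&` jumped t i h)) => p1 p2 p3.
move: (h * (e / 5)) => q.
move: (2 * D * h * p2) (4 * M * p1) (2 * e1 * p3) => y1 y2 y3 *.
lra.
Unshelve. all: by end_near. Qed.

Lemma stopped_value_deriv t (e : R) : 0 <= t -> 0 < e ->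
  \forall h \near 0^'+, `|\int[P]_w Y (t + h) w - \int[P]_w Y t w| <= e * h.
Proof.
move=> t0 e0; pose e' := e / (#|Lam|.+1)%:R.
have e'0 : 0 < e' by rewrite divr_gt0.
have H : \forall h \near 0^'+, forall i,
    `|\int[P]_w (\1_(A_ t i) w * (Y (t + h) w - Y t w))| <= e' * h.
  by apply: filter_forall => i; exact: stopped_value_rate.
have [d0 d00 Hd] := near_right_ex H.
apply: (near_right_of d00) => h /[dup] hd /andP[h0 _].
have th0 : 0 <= t + h by rewrite addr_ge0// ltW.
have bY := bmf_stopped_value t0; have bYh := bmf_stopped_value th0.
have bT i : bmf (fun w => \1_(A_ t i) w * (Y (t + h) w - Y t w)).
  apply: bmfM; last exact: bmfB.
  by apply: bmf_indic; exact: past_measurable (past_running_at i t0).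
rewrite -EB// (_ : \int[P]_w _ =
    \int[P]_w (\sum_i \1_(A_ t i) w * (Y (t + h) w - Y t w))); last first.
  apply: eq_Rintegral => w _.
  have [A|nA] := pselect (alive t w /\ gam < L t w a).
    rewrite (bigD1 (X t w))//= indicE mem_set; last by split.
    rewrite mul1r big1 ?addr0// => i iX; rewrite indicE memNset ?mul0r// => -[_ /= Xi].
    by move: iX; rewrite -Xi eqxx.
  rewrite (stopped_value_frozen t0 h0 nA) subrr big1// => i _.
  by rewrite mulr0.
rewrite E_sum// (le_trans (ler_norm_sum _ _ _))//.
apply: (@le_trans _ _ (\sum_(i : Lam) e' * h)).
  by apply: ler_sum => i _; exact: Hd.
rewrite sumr_const -[leLHS]mulr_natl mulrA ler_wpM2r ?(ltW h0)//.
rewrite /e' mulrCA ler_piMr ?(ltW e0)// ler_pdivrMr// mul1r ler_nat.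
exact: leqnSn.
Qed.

(** [growth_le] with slope 0, applied to the expectation and to its negative. *)
Lemma stopped_value_const T : 0 <= T -> \int[P]_w Y T w = \int[P]_w Y 0 w.
Proof.
move=> T0; have [M M0 HM] := F_bound.
have left t (e : R) : 0 < t -> 0 < e ->
    \forall h \near 0^'+, `|\int[P]_w Y t w - \int[P]_w Y (t - h) w| <= e.
  move=> t0 e0; have e20 : 0 < e / 2 by rewrite divr_gt0.
  have N1 : \forall h \near 0^'+, forall k (l l' : Lam -> R),
      (forall j, `|l j - l' j| <= h) -> `|F k l - F k l'| <= e / 2.
    by apply: filter_forall => k; exact: (ucont_near (bF k).1 e20).
  pose c := 2 * M * (#|Lam|%:R * C) + 1.
  have c0 : 0 < c by rewrite ltr_wpDl// !mulr_ge0 ?total_rate_ge0// ltW.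
  near=> h.
  have h0 : 0 < h by near: h; exact: nbhs_right_gt.
  have ht : h <= t by near: h; exact: nbhs_right_le.
  have hc : h <= e / 2 / c by near: h; apply: nbhs_right_le; rewrite divr_gt0.
  have := @stopped_value_cont (t - h) h (e / 2) M.
  rewrite subrK subr_ge0 => /(_ ht h0 HM) H.
  have W : forall k (l l' : Lam -> R),
      (forall j, `|l j - l' j| <= h) -> `|F k l - F k l'| <= e / 2 by near: h.
  have {}H := H W.
  apply: (le_trans H); rewrite [leRHS]splitr lerD2l.
  apply: (@le_trans _ _ (c * h)); last by rewrite mulrC -ler_pdivlMr.
  rewrite (_ : 2 * M * (_ * _ * h) = 2 * M * (#|Lam|%:R * C) * h); last by ring.
  by rewrite /c [leRHS]mulrDl mul1r lerDl ltW.
have H1 : \int[P]_w Y T w - \int[P]_w Y 0 w <= 0 * (T - 0).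
  apply: (growth_le (f := fun t => \int[P]_w Y t w)) => // t /andP[t0 t1] e e0.
    apply: filterS (stopped_value_deriv t0 e0) => h.
    by rewrite add0r; apply: le_trans; exact: ler_norm.
  apply: filterS (left t e t0 e0) => h.
  by apply: le_trans; exact: ler_norm.
have H2 : - (\int[P]_w Y T w) - - (\int[P]_w Y 0 w) <= 0 * (T - 0).
  apply: (growth_le (f := fun t => - \int[P]_w Y t w)) => // t /andP[t0 t1] e e0.
    apply: filterS (stopped_value_deriv t0 e0) => h.
    by rewrite add0r -opprD => H; apply: le_trans H; rewrite -normrN; exact: ler_norm.
  apply: filterS (left t e t0 e0) => h.
  by rewrite -opprD => H; apply: le_trans H; rewrite -normrN; exact: ler_norm.
move: H1 H2; rewrite mul0r; move: (\int[P]_w Y T w) (\int[P]_w Y 0 w) => u v H1 H2.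
by apply: le_anti; apply/andP; split; lra.
Unshelve. all: by end_near. Qed.

Lemma exists_dead t w : #|Lam|%:R <= t -> exists j, L t w j <= 0.
Proof.
move=> tT; have t0 : 0 <= t by exact: le_trans tT.
apply: contrapT => nj.
have Lpos j : 0 < L t w j by rewrite ltNge; apply/negP => Lj; apply: nj; exists j.
have : \sum_j L t w j <= 0.
  rewrite sum_diminished// subr_le0 (le_trans _ tT)//.
  rewrite (_ : #|Lam|%:R = \sum_(j : Lam) 1).
    by apply: ler_sum => j _; have /andP[] := z_cube j.
  by rewrite sumr_const.
rewrite (bigD1 a)//= leNgt => /negP; apply.
by rewrite ltr_wpDr ?Lpos// sumr_ge0// => j _; exact: ltW.
Qed.

Lemma stopped_expectation (g : (Lam -> R) -> R) : gam <= z a ->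
  (forall l, unit_cube l -> l a = gam -> F a l = g l) ->
  fine 'E_P[fun w => let tau := hitting_time X z a gam w in
    g (L (fine tau) w) * (tau < lifetime X z w)%E%:R] = F a z.
Proof.
move=> gz Fg; pose T : R := #|Lam|%:R; have T0 : 0 <= T by [].
have E0 : \int[P]_w Y 0 w = F a z.
  rewrite -[RHS](E_cst P); apply: E_ae_eq; [exact: bmf_stopped_value|exact: bmf_cst|].
  apply: filterS (vdjp_start V) => w X0; rewrite /stopped_value /stopped_site.
  rewrite X0 if_same; congr (F a _).
  by apply/funext => j; rewrite /stopped_local occ0 subr0.
rewrite -E0 -(stopped_value_const T0) unlock /Rintegral; congr fine.
apply: eq_integral => w _; congr (_%:E) => /=.
have [gL|Lg] := ltP gam (L T w a).
  have [j Lj] := @exists_dead T w (lexx _).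
  have ja : j != a by apply: contraTneq Lj => ->; rewrite -ltNge (lt_trans gam0).
  have Tt := (hitting_timeP gam w T0).2 gL.
  have lT : (lifetime X z w <= T%:E)%E.
    by rewrite leNgt; apply/negP => /(lifetimeP w T0) /(_ j); rewrite ltNge Lj.
  rewrite [(_ < _)%E](_ : _ = false) ?mulr0; last first.
    by apply/negbTE; rewrite -leNgt (le_trans lT)// ltW.
  by rewrite /stopped_value (F_vanish _ ja)// stopped_local_eq.
set tau := hitting_time X z a gam w.
have tauT : (tau <= T%:E)%E.
  by rewrite leNgt; apply/negP => /(hitting_timeP gam w T0); rewrite ltNge Lg.
have tau0 : (0 <= tau)%E.
  by apply: le_ereal_inf_tmp => _ [u [u0 _] <-]; rewrite lee_fin.
have tauE : tau = (fine tau)%:E.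
  by rewrite fineK// ge0_fin_numE// (le_lt_trans tauT)// ltry.
set r := fine tau in tauE *; rewrite tauE lee_fin in tau0; rewrite tauE lee_fin in tauT.
have rbelow s : 0 <= s < r -> gam < L s w a.
  by move=> /andP[s0 sr]; apply/(hitting_timeP gam w s0); rewrite -/tau tauE lte_fin.
have Lr1 : L r w a <= gam.
  rewrite leNgt; apply/negP => /(hitting_timeP gam w tau0).
  by rewrite -/tau tauE ltxx.
(* The local time is continuous, so the level is met exactly; for [r = 0] this uses [gam <= z a]. *)
have Lr : L r w a = gam.
  apply: le_anti; rewrite Lr1/=.
  have [rle0|r0] := leP r 0.
    by rewrite (_ : r = 0) ?diminished0//; apply: le_anti; rewrite rle0 tau0.
  apply/ler_addgt0Pr => /= e e0.
  pose s := Num.max 0 (r - e).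
  have sr : 0 <= s < r by rewrite le_max lexx/= gt_max r0/= ltrBlDr ltrDl.
  have := rbelow s sr; have /andP[s0 sr'] := sr.
  have := @diminished_incr s r w a; rewrite s0 (ltW sr') => /(_ isT) /andP[_].
  have : r - e <= s by rewrite le_max lexx orbT.
  lra.
have YE : Y T w = F a (L r w).
  rewrite /stopped_value /stopped_site ltNge Lg /=; congr (F a _).
  rewrite (@stopped_local_after r T) ?tau0//.
  exact: stopped_local_before.
rewrite YE tauE; have [al|nal] := pselect (alive r w).
  rewrite ((lifetimeP w tau0).2 al) mulr1 Fg// => j.
  by rewrite al/=; exact: diminished_le1.
rewrite [(_ < _)%E](_ : _ = false) ?mulr0; last first.
  by apply/negbTE/negP => /(lifetimeP w tau0).
have [j Lj] : exists j, L r w j <= 0.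
  apply: contrapT => nj; apply: nal => j; rewrite ltNge; apply/negP => Lj.
  by apply: nj; exists j.
rewrite (F_vanish _ (j := j))//.
by apply: contraTneq Lj => ->; rewrite -ltNge Lr.
Qed.

End stopped_martingale.

End vdjp_process.

(** * Integration over powers of a measure *)

Section bounded_support.
Context d (T : measurableType d) (R : realType).
Implicit Types (B : set T) (f : T -> R).

Definition bounded_on_support B f := [/\ measurable_fun setT f,
  exists M : R, forall y, `|f y| <= M & forall y, ~ B y -> f y = 0].

Lemma bounded_on_support_integrable (mu : {measure set T -> \bar R}) B f :
  measurable B -> (mu B < +oo)%E -> bounded_on_support B f ->
  mu.-integrable setT (EFin \o f).
Proof.
move=> mB Boo [mf [M fM] f0].
have iB : mu.-integrable B (EFin \o f).
  apply: measurable_bounded_integrable => //; first exact: measurable_funTS.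
  exists M; split; first by rewrite num_real.
  by move=> x Mx y _ /=; rewrite (le_trans (fM y))// ltW.
move/(integrable_mkcond _ mB) : iB; congr (_.-integrable _ _).
apply/funext => y; rewrite patchE; case: ifPn => //.
by move=> /negP; rewrite inE => By /=; rewrite f0.
Qed.

Lemma Rintegral_sum (mu : {measure set T -> \bar R}) (I : Type) (s : seq I)
    (f : I -> T -> R) : (forall i, mu.-integrable setT (EFin \o f i)) ->
  \int[mu]_y (\sum_(i <- s) f i y) = \sum_(i <- s) \int[mu]_y f i y.
Proof.
move=> intf; elim: s => [|i s ih].
  under eq_Rintegral do rewrite big_nil.
  by rewrite big_nil [LHS]Rintegral_cst// mul0r.
under eq_Rintegral do rewrite big_cons.
rewrite big_cons RintegralD//; first by rewrite ih.
rewrite (_ : _ \o _ = fun y => (\sum_(i <- s) (f i y)%:E)%E).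
  by apply: integrable_sum => // i0 _; exact: intf.
by apply/funext => y /=; rewrite sumEFin.
Qed.

End bounded_support.

Section power_measure.
Context d (T : measurableType d) (R : realType)
  (mu : {sigma_finite_measure set T -> \bar R}).

Definition box m (A : set T) : set (m.-tuple T) :=
  [set t : m.-tuple T | forall k, A (tnth t k)].

Definition set_tnth m (t : m.-tuple T) (k : 'I_m) (x : T) : m.-tuple T :=
  [tuple if i == k then x else tnth t i | i < m].

Lemma tnth_set_tnth m (t : m.-tuple T) k x i :
  tnth (set_tnth t k x) i = if i == k then x else tnth t i.
Proof. by rewrite tnth_mktuple. Qed.

Lemma measurable_set_tnth m (t : m.-tuple T) k :
  measurable_fun setT (set_tnth t k).
Proof.
apply/measurable_fun_tnthP => i; rewrite /comp /=.
under eq_fun do rewrite tnth_set_tnth.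
by case: (i == k); [apply: measurable_id|apply: measurable_cst].
Qed.

Lemma cons_pair_set_tnth0 m x x' (t : m.-tuple T) :
  cons_pair (x, t) = set_tnth (cons_pair (x', t)) ord0 x.
Proof.
apply: eq_from_tnth => i; rewrite tnth_set_tnth.
have [->|] := eqVneq i ord0; first by [].
by case: (unliftP ord0 i) => [j ->|->]; rewrite ?eqxx// !tnthS.
Qed.

Lemma cons_pair_set_tnthS m x (t : m.-tuple T) k v :
  cons_pair (x, set_tnth t k v) = set_tnth (cons_pair (x, t)) (lift ord0 k) v.
Proof.
apply: eq_from_tnth => i; rewrite tnth_set_tnth.
case: (unliftP ord0 i) => [j ->|->]; last by [].
by rewrite !tnthS tnth_set_tnth (inj_eq lift_inj).
Qed.

Lemma measurable_box m A : measurable A -> measurable (@box m A).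
Proof.
move=> mA; rewrite (_ : box A = \bigcap_(k in [set: 'I_m]) ((@tnth _ T ^~ k) @^-1` A)).
  apply: fin_bigcap_measurable => // k _.
  by rewrite -[X in measurable X]setTI; exact: measurable_tnth.
by apply/seteqP; split => t /=; [move=> h k _; exact: h|move=> h k; exact: h].
Qed.

Lemma power_measure_box m A : measurable A -> (mu A < +oo)%E ->
  (power_measure mu m (@box m A) < +oo)%E.
Proof.
move=> mA Aoo; elim: m => [|m ih].
  rewrite /= /dirac indicE mem_set ?ltry//= => -[]//.
rewrite /= /cons_measure /pushforward.
rewrite (_ : _ @^-1` _ = A `*` @box m A).
  rewrite product_measure1E//; last exact: measurable_box.
  by rewrite lte_mul_pinfty// ge0_fin_numE.
apply/seteqP; split => -[x t] /=.
  move=> h; split; first exact: (h ord0).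
  by move=> k; have := h (lift ord0 k); rewrite tnthS.
move=> [Ax At] k; case: (unliftP ord0 k) => [j ->|->//].
by rewrite tnthS; exact: At.
Qed.

(* Fubini, integrating the [k]-th coordinate first. *)
Lemma integral_power_measure0 m (A : set T) (f : m.-tuple T -> R) (k : 'I_m) :
  measurable A -> (mu A < +oo)%E -> bounded_on_support (@box m A) f ->
  (forall t, \int[mu]_x f (set_tnth t k x) = 0) ->
  \int[power_measure mu m]_t f t = 0.
Proof.
move=> mA Aoo; elim: m f k => [? []//|m ih] f k [mf [M fM] f0] fk.
have mbox := @measurable_box m A mA.
have boo := @power_measure_box m A mA Aoo.

have bf : bounded_on_support (A `*` box A) (f \o @cons_pair d T m).
  split; first by apply: measurableT_comp => //; exact: measurable_cons_pair.
    by exists M => y; exact: fM.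
  move=> [x t] /= nA; apply: f0 => At; apply: nA; split; first exact: (At ord0).
  by move=> i; have := At (lift ord0 i); rewrite tnthS.
have iF : (mu \x power_measure mu m)%E.-integrable setT
    (EFin \o (f \o @cons_pair d T m)).
  apply: (bounded_on_support_integrable _ _ bf); first exact: measurableX.
  rewrite [X in (X < _)%E]product_measure1E//.
  by rewrite lte_mul_pinfty// ge0_fin_numE.
rewrite /Rintegral /= integral_pushforward//; last 2 first.
- exact: measurable_cons_pair.
- by apply/measurable_EFinP.
rewrite preimage_setT.
case: (unliftP ord0 k) => [j kE|kE]; subst k; last first.
  rewrite -integral21_prod_meas1// /fubini_G integral0_eq// => t _.
  (* A point of [T] is needed to form the tuple whose first entry is overwritten; if [T] is empty
     the inner integral is 0. *)
  have [x0|noT] := pselect (exists x : T, True); last first.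
    by apply: integral0_eq => x _; case: noT; exists x.
  case: x0 => x0 _; rewrite -[RHS](congr1 EFin (fk (cons_pair (x0, t)))).
  rewrite /Rintegral fineK.
    by apply: eq_integral => x _ /=; rewrite (cons_pair_set_tnth0 x x0).
  apply: integrable_fin_num => //.
  apply: (bounded_on_support_integrable mA Aoo); split.
  - by apply: measurableT_comp => //; exact: measurable_set_tnth.
  - by exists M => y; exact: fM.
  - move=> x nA; apply: f0 => /(_ ord0).
    by rewrite tnth_set_tnth eqxx.
rewrite -integral12_prod_meas1// /fubini_F integral0_eq// => x _.
have bx : bounded_on_support (@box m A) (fun t => f (cons_pair (x, t))).
  split.
  - apply: measurableT_comp => //.
    by apply: measurableT_comp => //; exact: measurable_cons_pair.
  - by exists M => y; exact: fM.
  - move=> t nA; apply: f0 => At; apply: nA => i.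
    by have := At (lift ord0 i); rewrite tnthS.
have := ih _ j bx; rewrite /Rintegral => h.
have /h h0 : forall t : m.-tuple T,
    \int[mu]_v f (cons_pair (x, set_tnth t j v)) = 0.
  by move=> t; under eq_Rintegral do rewrite cons_pair_set_tnthS; exact: fk.
rewrite -[LHS]fineK ?h0//; apply: integrable_fin_num => //.
exact: (bounded_on_support_integrable mbox boo).
Qed.

End power_measure.

(** * Rotational derivatives *)

Section flux.
Context (R : realType) (Lam : finType) (b : Lam -> Lam -> R).
Hypothesis b_sym : forall i j, b i j = b j i.
Implicit Types (l z x : Lam -> R) (i j : Lam).

Definition quad l := 2^-1 * \sum_i \sum_j b i j * (l i * l j).

(** For symmetric [b], the partial derivative of [quad] in the coordinate [i]. *)
Definition spin_field i l := \sum_j b i j * l j.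

(** The Taylor expansion of a quadratic polynomial is exact; its second-order term carries the
    diagonal weight [b i i], which may be nonzero. *)
Lemma quad_upd l i (r : R) : quad (upd l i r) =
  quad l + (r - l i) * spin_field i l + 2^-1 * b i i * (r - l i) ^+ 2.
Proof.
set h := r - l i.
have updE j : upd l i r j = l j + (j == i)%:R * h.
  by rewrite /upd; case: eqP => [->|_]; rewrite ?mul1r ?mul0r ?addr0// /h addrCA subrr addr0.
have sel (G : Lam -> R) : \sum_j (j == i)%:R * G j = G i.
  rewrite (bigD1 i)//= eqxx mul1r big1 ?addr0// => j /negbTE ->.
  by rewrite mul0r.
rewrite /quad.
have -> : \sum_j \sum_k b j k * (upd l i r j * upd l i r k) =
    \sum_j \sum_k b j k * (l j * l k) + h * (\sum_j (b j i * l j))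
    + h * spin_field i l + h ^+ 2 * b i i.
  under eq_bigr => j _.
    under eq_bigr => k _.
      rewrite !updE.
      rewrite (_ : _ * _ = b j k * (l j * l k) + (k == i)%:R * (b j k * l j * h)
          + (j == i)%:R * (b j k * l k * h + (k == i)%:R * (b j k * h ^+ 2))); last by ring.
      over.
    rewrite !big_split/= sel -mulr_sumr big_split/= sel.
    over.
  rewrite !big_split/= sel /spin_field -!mulr_suml; ring.
rewrite (_ : \sum_j b j i * l j = spin_field i l); last first.
  by apply: eq_bigr => j _; rewrite b_sym.
by field.
Qed.

Lemma is_derive_quad l i (f : R -> R) (t df : R) : l i = f t ->
  is_derive t 1 f df ->
  is_derive t 1 (fun u => quad (upd l i (f u))) (df * spin_field i l).
Proof.
move=> lf fd.
rewrite (_ : (fun u => _) = fun u => quad l + (f u - l i) * spin_field i l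
    + 2^-1 * b i i * (f u - l i) ^+ 2); last first.
  by apply/funext => u; rewrite quad_upd.
apply: is_derive_eq; rewrite lf subrr /=.
rewrite /GRing.scale/=; ring.
Qed.

Variable F : Lam -> (Lam -> R) -> R.

(** Only the two components mixed by the rotation enter here; the weight of the others is left to
    [density]. *)
Definition weighted i z x := F i z * expR (quad z + quad x).

Definition spin_flux i z x :=
  \sum_j b i j * (z i * x j * weighted i z x - x i * z j * weighted j z x).

Lemma sum_flux z x : \sum_i spin_flux i z x = 0.
Proof.
rewrite /spin_flux.
under eq_bigr do under eq_bigr do rewrite mulrBr.
under eq_bigr do rewrite big_split/= sumrN.
rewrite big_split/= sumrN [X in _ - X]exchange_big/= -sumrB.
rewrite big1// => i _; rewrite -sumrB big1// => j _.
rewrite b_sym; ring.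
Qed.

Lemma is_derive_weighted i z x (f h : R -> R) (t df dh : R) :
  is_derive (z i) 1 (fun r => F i (upd z i r))
    (\sum_j b i j * z j * (F j z - F i z)) ->
  z i = f t -> x i = h t -> is_derive t 1 f df -> is_derive t 1 h dh ->
  is_derive t 1 (fun u => weighted i (upd z i (f u)) (upd x i (h u)))
    (df * (\sum_j b i j * z j * weighted j z x)
     + dh * (weighted i z x * spin_field i x)).
Proof.
move=> dF zf xh fd hd.
have dz := is_derive_quad zf fd; have dx := is_derive_quad xh hd.
rewrite zf in dF; have dFf := is_derive1_comp dF fd.
apply: is_derive_eq; rewrite /=.
rewrite -zf -xh !upd_id /weighted /GRing.scale/=.
set e := expR _.
(* The term [- F i z] of the backward equation cancels against the derivative of [expR (quad z)]. *)
rewrite (_ : \sum_j b i j * z j * (F j z * e) =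
    e * (\sum_j b i j * z j * (F j z - F i z)) + e * F i z * spin_field i z); last first.
  rewrite /spin_field !mulr_sumr -big_split/=; apply: eq_bigr => j _; ring.
ring.
Qed.

End flux.

Section flux_regularity.
Context (R : realType) (Lam : finType) (b : Lam -> Lam -> R).
Implicit Types (l z x : Lam -> R) (i j : Lam).
Local Notation quad := (quad b).
Local Notation local_field := (spin_field b).

Lemma continuous_quad (V : topologicalType) (phi : Lam -> V -> R) (v : V) :
  (forall j, {for v, continuous (phi j)}) ->
  {for v, continuous (fun u => quad (phi ^~ u))}.
Proof.
move=> cphi; apply: cvgM; first exact: cvg_cst.
apply: cvg_big => [|i _]; first exact: add_continuous.
apply: cvg_big => [|j _]; first exact: add_continuous.
by apply: cvgM; [exact: cvg_cst|apply: cvgM; exact: cphi].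
Qed.

Lemma measurable_quad d (T : measurableType d) (phi : Lam -> T -> R) :
  (forall j, measurable_fun setT (phi j)) ->
  measurable_fun setT (fun u => quad (phi ^~ u)).
Proof.
move=> mphi; apply: measurable_funM => //.
apply: measurable_sum => i; apply: measurable_sum => j.
by apply: measurable_funM => //; exact: measurable_funM.
Qed.

Hypotheses (b_ge0 : forall i j, 0 <= b i j) (b_sym : forall i j, b i j = b j i).

Lemma normr_quad_le l : (forall j, `|l j| <= 1) ->
  `|quad l| <= \sum_i \sum_j b i j.
Proof.
move=> l1; rewrite normrM ger0_norm//.
apply: (@le_trans _ _ (1 * `|\sum_i \sum_j b i j * (l i * l j)|)).
  by apply: ler_wpM2r => //; lra.
rewrite mul1r (le_trans (ler_norm_sum _ _ _))//; apply: ler_sum => i _.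
rewrite (le_trans (ler_norm_sum _ _ _))//; apply: ler_sum => j _.
by rewrite normrM ger0_norm// ler_piMr// normrM mulr_ile1.
Qed.

Variable F : Lam -> (Lam -> R) -> R.
Hypothesis bF : forall i, bucont (F i).
Local Notation weighted := (weighted b F).
Local Notation flux := (spin_flux b F).

Lemma continuous_weighted (V : topologicalType) (phi psi : Lam -> V -> R) i (v : V) :
  (forall j, {for v, continuous (phi j)}) ->
  (forall j, {for v, continuous (psi j)}) ->
  {for v, continuous (fun u => weighted i (phi ^~ u) (psi ^~ u))}.
Proof.
move=> cphi cpsi; apply: cvgM.
  by apply: ucont_continuous => //; case: (bF i).
apply: (@continuous_comp _ _ _ (fun u => quad (phi ^~ u) + quad (psi ^~ u)) expR).
  by apply: cvgD; exact: continuous_quad.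
exact: continuous_expR.
Qed.

Lemma continuous_flux (V : topologicalType) (phi psi : Lam -> V -> R) i (v : V) :
  (forall j, {for v, continuous (phi j)}) ->
  (forall j, {for v, continuous (psi j)}) ->
  {for v, continuous (fun u => flux i (phi ^~ u) (psi ^~ u))}.
Proof.
move=> cphi cpsi.
apply: cvg_big => [|j _]; first exact: add_continuous.
apply: cvgM; first exact: cvg_cst.
apply: cvgB; apply: cvgM; try exact: continuous_weighted; apply: cvgM;
  by [exact: cphi|exact: cpsi].
Qed.

Lemma measurable_weighted d (T : measurableType d) (phi psi : Lam -> T -> R) i :
  (forall j, measurable_fun setT (phi j)) ->
  (forall j, measurable_fun setT (psi j)) ->
  measurable_fun setT (fun u => weighted i (phi ^~ u) (psi ^~ u)).
Proof.
move=> mphi mpsi; apply: measurable_funM.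
  by apply: ucont_measurable => //; case: (bF i).
by apply: measurableT_comp => //; apply: measurable_funD; exact: measurable_quad.
Qed.

Lemma measurable_flux d (T : measurableType d) (phi psi : Lam -> T -> R) i :
  (forall j, measurable_fun setT (phi j)) ->
  (forall j, measurable_fun setT (psi j)) ->
  measurable_fun setT (fun u => flux i (phi ^~ u) (psi ^~ u)).
Proof.
move=> mphi mpsi; apply: measurable_sum => j.
apply: measurable_funM => //; apply: measurable_funB;
  by apply: measurable_funM; [exact: measurable_funM|exact: measurable_weighted].
Qed.

(** This form is the derivative of [weighted i] along the rotation field, which moves [(z i, x i)]
    with velocity [(- x i, z i)]. *)
Lemma fluxE i z x : flux i z x =
  z i * (weighted i z x * local_field i x) - x i * \sum_j b i j * z j * weighted j z x.
Proof.
rewrite /flux /spin_field !mulr_sumr -sumrB; apply: eq_bigr => j _; ring.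
Qed.

Variables (a : Lam) (eps gam : R).
Hypothesis eps0 : 0 < eps.
Hypothesis F_vanish : forall i l j, j != a -> l j <= eps -> F i l = 0.
Hypothesis F_der : forall i l, (forall j, 0 <= l j <= 1) -> (i = a -> gam < l a) ->
  is_derive (l i) 1 (fun r => F i (upd l i r)) (\sum_j b i j * l j * (F j l - F i l)).

Lemma weighted_vanish i j z x : j != a -> z j <= eps -> weighted i z x = 0.
Proof. by move=> ja zj; rewrite /weighted (F_vanish _ ja zj) mul0r. Qed.

Lemma flux_vanish i j z x : j != a -> z j <= eps -> flux i z x = 0.
Proof.
move=> ja zj; rewrite /flux big1// => k _.
by rewrite !(weighted_vanish _ _ ja zj) !mulr0 subrr mulr0.
Qed.

Local Notation inv_height r0 t := (Num.max eps (Num.sqrt (r0 - t ^+ 2)))^-1.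

Lemma continuous_height (r0 : R) : continuous (fun t : R => Num.sqrt (r0 - t ^+ 2)).
Proof.
move=> t; apply: (@continuous_comp _ _ _ (fun t : R => r0 - t ^+ 2) (@Num.sqrt R)).
  by apply: cvgB; [exact: cvg_cst|exact: exprn_continuous].
exact: sqrt_continuous.
Qed.

(** The maximum with [eps] removes the singularity at the rim of the hemisphere and changes nothing
    at heights above [eps]. *)
Lemma continuous_inv_height (r0 : R) : continuous (fun t : R => inv_height r0 t).
Proof.
move=> x; apply: cvgV; first by rewrite gt_eqF// lt_max eps0.
have := @continuous_max R R (cst eps) (fun t => Num.sqrt (r0 - t ^+ 2)) x.
apply; [exact: cvg_cst|exact: continuous_height].
Qed.

(* [flux / height] is the derivative of [weighted] along the circle. *)
Lemma Rintegral_flux0 i z x (r0 c : R) : i != a -> r0 <= 1 ->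
  (forall j, 0 <= z j <= 1) ->
  \int[@lebesgue_measure R]_t
    (flux i (upd z i (Num.sqrt (r0 - t ^+ 2))) (upd x i t) * (inv_height r0 t * c)) = 0.
Proof.
move=> ia r01 z01.
set f := fun t : R => _ * (inv_height r0 t * c).
pose h (t : R) := Num.sqrt (r0 - t ^+ 2).
have sqrt_le (u : R) : u <= eps ^+ 2 -> Num.sqrt u <= eps.
  move=> ue; rewrite -[leRHS](ger0_norm (ltW eps0)) -sqrtr_sqr.
  exact: ler_wsqrtr.
have le_sqrt (u : R) : eps ^+ 2 <= u -> eps <= Num.sqrt u.
  move=> ue; rewrite -[leLHS](ger0_norm (ltW eps0)) -sqrtr_sqr.
  exact: ler_wsqrtr.
have f_small (t : R) : h t <= eps -> f t = 0.
  by move=> ht; rewrite /f (@flux_vanish _ i)// ?mul0r// /upd eqxx.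
have [r0e|r0e] := leP r0 (eps ^+ 2).
  rewrite (_ : f = cst 0) ?Rintegral_cst ?mul0r//.
  apply/funext => t; apply: f_small.
  by apply: sqrt_le; have := sqr_ge0 t; move: r0e; lra.
(* The abscissa at which the height has fallen to [eps]; beyond it the integrand vanishes. *)
pose r := Num.sqrt (r0 - eps ^+ 2).
have r_gt0 : 0 < r by rewrite sqrtr_gt0 subr_gt0.
have rr : r ^+ 2 = r0 - eps ^+ 2 by rewrite sqr_sqrtr// ltW// subr_gt0.
have h_ge (t : R) : `|t| <= r -> eps <= h t.
  move=> tr; apply: le_sqrt.
  have : t ^+ 2 <= r ^+ 2.
    by rewrite -(real_normK (num_real t)) ler_sqr ?nnegrE// ltW.
  by rewrite rr; lra.
have h_le (t : R) : r <= `|t| -> h t <= eps.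
  move=> tr; apply: sqrt_le.
  have : r ^+ 2 <= t ^+ 2.
    by rewrite -(real_normK (num_real t)) ler_sqr ?nnegrE// ltW.
  by rewrite rr; lra.
have cupd l (k : R -> R) : continuous k ->
    forall t j, {for t, continuous (fun u => upd l i (k u) j)}.
  by move=> ck t j; rewrite /upd; case: (j == i); [exact: ck|exact: cvg_cst].
have cf : continuous f.
  move=> t; apply: cvgM.
    apply: (@continuous_flux _ (fun j u => upd z i (h u) j) (fun j u => upd x i u j)).
      by apply: cupd; exact: continuous_height.
    by apply: cupd => u; exact: cvg_id.
  by apply: cvgM; [exact: continuous_inv_height|exact: cvg_cst].
pose H (t : R) := weighted i (upd z i (h t)) (upd x i t) * c.
have cH : continuous H.
  move=> t; apply: cvgM; last exact: cvg_cst.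
  apply: (@continuous_weighted _ (fun j u => upd z i (h u) j) (fun j u => upd x i u j)).
    by apply: cupd; exact: continuous_height.
  by apply: cupd => u; exact: cvg_id.
have H0 (t : R) : r <= `|t| -> H t = 0.
  by move=> /h_le ht; rewrite /H (@weighted_vanish _ i) ?mul0r// /upd eqxx.
have dH (t : R) : `|t| <= r -> is_derive t 1 H (f t).
  move=> tr; have het := h_ge t tr; have ht0 : 0 < h t by exact: lt_le_trans het.
  have r0t : 0 < r0 - t ^+ 2 by rewrite -sqrtr_gt0.
  (* Dividing the rotation field by the height gives unit speed in [t], and then the height has
     slope [- t / h t]. *)
  have dh : is_derive t 1 h (- (t / h t)).
    have ds := is_derive1_sqrt r0t.
    have dq : is_derive t 1 (fun u : R => r0 - u ^+ 2) (- (2 * t)).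
      apply: is_derive_eq; rewrite /GRing.scale/=; ring.
    have := @is_derive1_comp R (@Num.sqrt R) (fun u => r0 - u ^+ 2) t _ _ ds dq.
    move=> dhh; apply: is_derive_eq; rewrite -/(h t).
    have ht_neq0 : h t != 0 by rewrite gt_eqF.
    by field.
  pose zt := upd z i (h t); pose xt := upd x i t.
  have dF : is_derive (zt i) 1 (fun u => F i (upd zt i u))
      (\sum_j b i j * zt j * (F j zt - F i zt)).
    apply: F_der; last by move=> iaE; rewrite iaE eqxx in ia.
    move=> j; rewrite /zt /upd; case: (j == i) => //.
    rewrite sqrtr_ge0/= -sqrtr1; apply: ler_wsqrtr; have := sqr_ge0 t.
    by move: r01; lra.
  have zti : zt i = h t by rewrite /zt /upd eqxx.
  have xti : xt i = t by rewrite /xt /upd eqxx.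
  have dw := is_derive_weighted b_sym dF zti xti dh (is_derive_id t 1).
  rewrite (_ : H = fun u => weighted i (upd zt i (h u)) (upd xt i u) * c); last first.
    by apply/funext => u; rewrite !upd_upd.
  apply: is_derive_eq; rewrite /f -/(h t) -/zt -/xt fluxE zti xti.
  rewrite -/(h t) (max_idPr het) /GRing.scale/=.
  have ht_neq0 : h t != 0 by rewrite gt_eqF.
  by field.
(* The integral reduces to [[- r, r]], and the primitive [H] vanishes at both ends. *)
rewrite (_ : f = f \_ `[- r, r]); last first.
  apply/funext => t; rewrite patchE; case: ifPn => // /negP.
  rewrite inE /= in_itv/= -ler_norml => /negP; rewrite -ltNge => tr.
  by apply/f_small/h_le/ltW.
rewrite -Rintegral_mkcond /Rintegral (@continuous_FTC2 _ f H).
- by rewrite !H0 ?normrN ?ger0_norm//= ?subrr// ltW.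
- by lra.
- exact: continuous_subspaceT.
- split.
  + move=> t; rewrite in_itv/= => /andP[t1 t2].
    by apply: ex_derive; apply: dH; rewrite ler_norml !ltW.
  + exact/cvg_at_right_filter/cH.
  + exact/cvg_at_left_filter/cH.
- move=> t; rewrite in_itv/= => /andP[t1 t2]; rewrite derive1E.
  by apply: derive_val; apply: dH; rewrite ler_norml !ltW.
Qed.
End flux_regularity.

(** * The rotated pinned expectation *)

Section pinned.
Context (R : realType) (Lam : finType) (a : Lam).
Local Notation m := #|{: {i : Lam | i != a}}|.

(** A polymorphic [pinned_config], so that each coordinate of a pinned configuration is again a
    pinned family. *)
Definition pinned (A : Type) (phi : 'I_m -> A) (v : A) : Lam -> A :=
  fun i => match insub i : option {i : Lam | i != a} with
           | Some k => phi (enum_rank k)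
           | None => v
           end.

Definition site (k : 'I_m) : Lam := val (enum_val k).

Lemma site_neq k : site k != a.
Proof. exact: (valP (enum_val k)). Qed.

Lemma siteP i : i != a -> exists k, i = site k.
Proof. by move=> ia; exists (enum_rank (Sub i ia : {i | i != a})); rewrite /site enum_rankK. Qed.

Lemma pinned_pin (A : Type) (phi : 'I_m -> A) v : pinned phi v a = v.
Proof. by rewrite /pinned insubF// eqxx. Qed.

Lemma pinned_site (A : Type) (phi : 'I_m -> A) v k : pinned phi v (site k) = phi k.
Proof. by rewrite /pinned /site valK enum_valK. Qed.

Lemma pinned_ind (A : Type) (phi : 'I_m -> A) v (Q : Lam -> A -> Prop) :
  Q a v -> (forall k, Q (site k) (phi k)) -> forall i, Q i (pinned phi v i).
Proof.
move=> Qv Qp i; have [->|/siteP[k ->]] := eqVneq i a; first by rewrite pinned_pin.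
by rewrite pinned_site.
Qed.

Lemma pinned_comp (A B : Type) (f : A -> B) (phi : 'I_m -> A) v i :
  f (pinned phi v i) = pinned (fun k => f (phi k)) (f v) i.
Proof. by rewrite /pinned; case: insub. Qed.

Lemma site_inj : injective site.
Proof. by move=> k l /val_inj /enum_val_inj. Qed.

Lemma pinned_upd (phi : 'I_m -> R) (v r : R) (k : 'I_m) :
  pinned (fun l => if l == k then r else phi l) v = upd (pinned phi v) (site k) r.
Proof.
apply/funext => i; rewrite /upd; have [->|/siteP[l ->]] := eqVneq i a.
  by rewrite !pinned_pin eq_sym (negbTE (site_neq k)).
by rewrite !pinned_site (inj_eq site_inj).
Qed.

Lemma pinned_upd_pin (phi : 'I_m -> R) (v r : R) :
  pinned phi r = upd (pinned phi v) a r.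
Proof.
apply/funext => i; rewrite /upd; have [->|/siteP[l ->]] := eqVneq i a.
  by rewrite pinned_pin.
by rewrite !pinned_site.
Qed.

End pinned.
Arguments pinned {Lam a A} phi v i.

Section hemispheres.
Context (R : realType) (Lam : finType) (b : Lam -> Lam -> R).
Hypotheses (b_ge0 : forall i j, 0 <= b i j) (b_sym : forall i j, b i j = b j i).
Variable F : Lam -> (Lam -> R) -> R.
Hypothesis bF : forall i, bucont (F i).
Variables (a : Lam) (eps gam : R).
Hypothesis eps0 : 0 < eps.
Hypothesis F_vanish : forall i l j, j != a -> l j <= eps -> F i l = 0.
Hypothesis F_der : forall i l, (forall j, 0 <= l j <= 1) -> (i = a -> gam < l a) ->
  is_derive (l i) 1 (fun r => F i (upd l i r)) (\sum_j b i j * l j * (F j l - F i l)).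
Variable n : nat.

Local Notation m := #|{: {i : Lam | i != a}}|.
Local Notation mu := (@lebesgue_measure R).
Local Notation conf := (m.-tuple (n.+1.-tuple R)).
Local Notation weighted := (weighted b F).
Local Notation flux := (spin_flux b F).
Local Notation quad := (quad b).
Implicit Types (u : n.+1.-tuple R) (y : conf) (t : R) (i j : Lam) (k : 'I_m).

Definition height u : R := Num.sqrt (1 - \sum_k tnth u k ^+ 2).

Definition zpin (t : R) (y : conf) : Lam -> R :=
  pinned (fun k => height (tnth y k)) (cos t).

Definition xpin (t : R) (y : conf) : Lam -> R :=
  pinned (fun k => tnth (tnth y k) ord0) (sin t).

(** The components left alone by the rotation. They are 0 for the rotated pole, hence the pinned
    value 0. *)
Definition perp (y : conf) : R :=
  \sum_(c < n) quad (@pinned _ a _ (fun k => tnth (tnth y k) (lift ord0 c)) 0).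

(* Where the integrands do not vanish, this is [e^perp] times the density of
   [du]; the cut-off [eps] makes it continuous. *)
Definition density (y : conf) : R :=
  expR (perp y) * \prod_k (Num.max eps (height (tnth y k)))^-1.

Definition weight_at i t y := weighted i (zpin t y) (xpin t y) * density y.

Definition flux_at i t y := flux i (zpin t y) (xpin t y) * density y.

(** It contains all configurations of ball coordinates and has finite measure, so bounded measurable
    functions vanishing off it are integrable. *)
Definition cube : set conf :=
  box (@box _ (measurableTypeR R) n.+1 `[(-1)%R, 1%R]%classic).

Lemma measurable_cube : measurable cube.
Proof. by do 2 apply: measurable_box; exact: measurable_itv. Qed.

Lemma itv11_lty : (mu `[(-1)%R, 1%R]%classic < +oo)%E.
Proof. by rewrite lebesgue_itv_lty. Qed.

Lemma cube1_lty :
  (lebesgueRn R n.+1 (@box _ (measurableTypeR R) _ `[(-1)%R, 1%R]%classic) < +oo)%E.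
Proof. by apply: power_measure_box; [exact: measurable_itv|exact: itv11_lty]. Qed.

Lemma cube_lty : (power_measure (lebesgueRn R n.+1) m cube < +oo)%E.
Proof.
apply: power_measure_box; last exact: cube1_lty.
by apply: measurable_box; exact: measurable_itv.
Qed.

Local Notation nu := (power_measure (lebesgueRn R n.+1) m).

Lemma cube_integrable (f : conf -> R) : bounded_on_support cube f ->
  nu.-integrable setT (EFin \o f).
Proof.
move=> bf.
have := @bounded_on_support_integrable _ _ _ nu cube f measurable_cube cube_lty.
by apply.
Qed.

Lemma indic_cube_integrable (C : R) :
  nu.-integrable setT (EFin \o (fun y => C * \1_cube y)).
Proof.
apply: cube_integrable; split.
- apply: measurable_funM => //; apply: measurable_indic; exact: measurable_cube.
- exists `|C| => y; rewrite indicE normrM.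
  by rewrite -[leRHS]mulr1 ler_wpM2l// normr_nat lern1; case: (_ \in _).
- by move=> y ny; rewrite indicE memNset// mulr0.
Qed.

Lemma height_le1 u : 0 <= height u <= 1.
Proof.
rewrite sqrtr_ge0/= -sqrtr1; apply: ler_wsqrtr.
by rewrite gerBl sumr_ge0// => k _; exact: sqr_ge0.
Qed.

Lemma zpin_norm t y i : `|zpin t y i| <= 1.
Proof.
apply: (@pinned_ind _ _ _ _ _ (fun _ r => `|r| <= 1)) => [|k].
  exact: cos_max.
by have /andP[h0 h1] := height_le1 (tnth y k); rewrite ger0_norm.
Qed.

Lemma ball_coord u c : 0 < height u -> `|tnth u c| <= 1.
Proof.
rewrite sqrtr_gt0 subr_gt0 => h.
have : tnth u c ^+ 2 <= 1.
  rewrite (le_trans _ (ltW h))// (bigD1 c)//= lerDl sumr_ge0// => k _.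
  exact: sqr_ge0.
by rewrite -(real_normK (num_real (tnth u c))) -[X in _ <= X](expr1n R 2) ler_sqr ?nnegrE.
Qed.



Lemma weighted_pin_vanish k i t y : height (tnth y k) <= eps ->
  weighted i (zpin t y) (xpin t y) = 0.
Proof.
move=> hk; apply: (@weighted_vanish _ _ b F a eps F_vanish i (site k) _ _ (site_neq k)).
by rewrite /zpin pinned_site.
Qed.

Lemma measurable_height : measurable_fun setT height.
Proof.
apply: (@measurableT_comp _ _ _ _ _ _ (@Num.sqrt R)).
  by apply: continuous_measurable_fun; exact: sqrt_continuous.
apply: measurable_funB => //; apply: measurable_sum => k.
by apply: measurable_funX; exact: measurable_tnth.
Qed.

Lemma measurable_pinned (phi : 'I_m -> conf -> R) v j :
  (forall k, measurable_fun setT (phi k)) ->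
  measurable_fun setT (fun y => @pinned _ a _ (phi ^~ y) v j).
Proof.
move=> mphi; rewrite /pinned; case: insub => [k|]; first exact: mphi.
exact: measurable_cst.
Qed.

Lemma measurable_zpin t j : measurable_fun setT (zpin t ^~ j).
Proof.
apply: measurable_pinned => k; apply: measurableT_comp; first exact: measurable_height.
exact: measurable_tnth.
Qed.

Lemma measurable_coord k c :
  measurable_fun [set: conf] (fun y => tnth (tnth y k) c).
Proof. by apply: (measurableT_comp (@measurable_tnth _ _ _ c)); exact: measurable_tnth. Qed.

Lemma measurable_xpin t j : measurable_fun setT (xpin t ^~ j).
Proof. by apply: measurable_pinned => k; exact: measurable_coord. Qed.

Lemma measurable_density : measurable_fun setT density.
Proof.
apply: measurable_funM.
  apply: measurableT_comp => //; apply: measurable_sum => c.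
  apply: (@measurable_quad _ _ _ _ _ (fun j y => @pinned _ a _ _ 0 j)) => j.
  by apply: measurable_pinned => k; exact: measurable_coord.
apply: measurable_prod => k _.
pose f (r : R) := (Num.max eps r)^-1.
apply: (@measurableT_comp _ _ _ _ _ _ f).
  apply: continuous_measurable_fun => r; apply: cvgV.
    by rewrite gt_eqF// lt_max eps0.
  have := @continuous_max R R (cst eps) id r.
  by apply; [exact: cvg_cst|exact: cvg_id].
by apply: measurableT_comp; [exact: measurable_height|exact: measurable_tnth].
Qed.

Lemma measurable_weight_at i t : measurable_fun setT (weight_at i t).
Proof.
apply: measurable_funM; last exact: measurable_density.
apply: measurable_weighted => // j; [exact: measurable_zpin|exact: measurable_xpin].
Qed.

Lemma measurable_flux_at i t : measurable_fun setT (flux_at i t).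
Proof.
apply: measurable_funM; last exact: measurable_density.
apply: measurable_flux => // j; [exact: measurable_zpin|exact: measurable_xpin].
Qed.

(** If all heights exceed [eps], the coordinates are bounded by 1, the quadratic forms by [B] and
    the inverse heights by [eps^-1]; otherwise [F] vanishes. The constant does not depend on [t], so
    it also gives a dominating function. *)
Lemma weight_at_bound : exists2 C, 0 <= C & forall i t y,
  `|weight_at i t y| <= C /\
  ((forall j, `|xpin t y j| <= 1) /\ cube y \/ forall j, weight_at j t y = 0).
Proof.
pose B := \sum_i \sum_j b i j.
have [M M0 FM] : exists2 M, 0 <= M & forall i l, `|F i l| <= M.
  have /choice[Mi FMi] : forall i, exists Mi, 0 < Mi /\ forall l, `|F i l| <= Mi.
    by move=> i; have [Mi] := bucont_bound (bF i); exists Mi.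
  exists (\sum_i Mi i); first by apply: sumr_ge0 => i _; case: (FMi i) => /ltW.
  move=> i l; case: (FMi i) => _ /(_ l) /le_trans; apply.
  by rewrite (bigD1 i)//= lerDl; apply: sumr_ge0 => j _; case: (FMi j) => /ltW.
have e0 : 0 <= eps^-1 by rewrite invr_ge0 ltW.
exists (M * expR (B + B) * (expR (\sum_(c < n) B) * \prod_(k < m) eps^-1)).
  by rewrite !mulr_ge0 ?expR_ge0// prodr_ge0.
move=> i t y; have [[k hk]|nk] := pselect (exists k, height (tnth y k) <= eps).
  have w0 j : weight_at j t y = 0.
    by rewrite /weight_at (weighted_pin_vanish _ _ hk) mul0r.
  split; last by right.
  by rewrite w0 normr0 !mulr_ge0 ?expR_ge0// prodr_ge0.
have c1 k c : `|tnth (tnth y k) c| <= 1.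
  apply: ball_coord; rewrite (lt_trans eps0)// ltNge.
  by apply/negP => hk; apply: nk; exists k.
have x1 j : `|xpin t y j| <= 1.
  apply: (@pinned_ind _ _ _ _ _ (fun _ r => `|r| <= 1)) => [|k//].
  by rewrite ler_norml sin_geN1 sin_le1.
split; last first.
  left; split => // k c /=; rewrite in_itv/= -ler_norml; exact: c1.
have quadB l : (forall j, `|l j| <= 1) -> quad l <= B.
  by move=> l1; rewrite (le_trans (ler_norm _))// normr_quad_le.
rewrite !normrM !(ger0_norm (expR_ge0 _)).
apply: ler_pM; rewrite ?mulr_ge0 ?expR_ge0//.
  apply: ler_pM; rewrite ?expR_ge0// ler_expR lerD// quadB// => j.
  exact: zpin_norm.
apply: ler_pM; rewrite ?expR_ge0//.
  rewrite ler_expR; apply: ler_sum => c _; apply: quadB.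
  by apply: (@pinned_ind _ _ _ _ _ (fun _ r => `|r| <= 1)); rewrite ?normr0.
rewrite normr_prod; apply: ler_prod => k _; rewrite normr_ge0/= ger0_norm.
  by rewrite lef_pV2 ?posrE ?lt_max ?eps0// le_max lexx.
by rewrite invr_ge0 le_max ltW.
Qed.

Lemma bounded_weight_at i t : bounded_on_support cube (weight_at i t).
Proof.
have [C C0 wC] := weight_at_bound; split; first exact: measurable_weight_at.
  by exists C => y; have [] := wC i t y.
by move=> y ny; have [_ [[]//|]] := wC i t y.
Qed.

Lemma flux_atE i t y : flux_at i t y = \sum_j b i j *
  (zpin t y i * xpin t y j * weight_at i t y - xpin t y i * zpin t y j * weight_at j t y).
Proof.
rewrite /flux_at /spin_flux mulr_suml; apply: eq_bigr => j _.
rewrite /weight_at; ring.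
Qed.

(** Being uniform in [t], this dominates the derivative under the integral sign. *)
Lemma flux_at_bound : exists2 C, 0 <= C & forall i t y,
  `|flux_at i t y| <= C * \1_cube y.
Proof.
have [C C0 wC] := weight_at_bound.
exists ((\sum_i \sum_j b i j) * (C + C)).
  by rewrite mulr_ge0 ?addr_ge0//; do 2 apply: sumr_ge0 => ? _.
move=> i t y; rewrite flux_atE indicE.
have [_ [[x1 cy]|w0]] := wC i t y; last first.
  rewrite big1 ?normr0 => [|j _]; last by rewrite !w0 !mulr0 subrr mulr0.
  by rewrite !mulr_ge0 ?addr_ge0//; do 2 apply: sumr_ge0 => ? _.
rewrite mem_set// mulr1.
apply: (@le_trans _ _ (\sum_j b i j * (C + C))).
  rewrite (le_trans (ler_norm_sum _ _ _))//; apply: ler_sum => j _.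
  rewrite normrM ger0_norm// ler_wpM2l// (le_trans (ler_normB _ _))//.
  have wi := (wC i t y).1; have wj := (wC j t y).1.
  move: (weight_at i t y) (weight_at j t y) wi wj => p q wi wj.
  by apply: lerD; rewrite !normrM -[leRHS]mul1r; apply: ler_pM;
    rewrite ?mulr_ge0// mulr_ile1// zpin_norm.
rewrite -mulr_suml ler_wpM2r ?addr_ge0// [leRHS](bigD1 i)//= lerDl.
by do 2 apply: sumr_ge0 => ? _.
Qed.

Lemma bounded_flux_at i t : bounded_on_support cube (flux_at i t).
Proof.
have [C C0 wC] := flux_at_bound; split; first exact: measurable_flux_at.
  exists C => y; rewrite (le_trans (wC _ _ _))// indicE.
  by rewrite -[leRHS]mulr1 ler_wpM2l// lern1; case: (_ \in _).
move=> y ny; apply/eqP; rewrite -normr_le0 (le_trans (wC _ _ _))//.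
by rewrite indicE memNset// mulr0.
Qed.

(** The varying coordinate enters [zpin], [xpin] and one factor of the density, while [perp] sees
    only the other coordinates. So the slice is an integral as in [Rintegral_flux0], over a circle
    of squared radius [r0]. *)
Lemma Rintegral_slice0 i t y k (u : n.+1.-tuple R) : i = site k -> 0 <= cos t ->
  \int[mu]_r flux_at i t (set_tnth y k (set_tnth u ord0 r)) = 0.
Proof.
move=> -> ct; pose y' r := set_tnth y k (set_tnth u ord0 r).
pose r0 := 1 - \sum_(c < n) tnth u (lift ord0 c) ^+ 2.
have h' r : height (set_tnth u ord0 r) = Num.sqrt (r0 - r ^+ 2).
  rewrite /height big_ord_recl tnth_set_tnth eqxx; congr Num.sqrt.
  rewrite /r0 opprD addrCA addrC; congr (_ - _ - _).
  by apply: eq_bigr => c _; rewrite tnth_set_tnth.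
have zE r : zpin t (y' r) = upd (zpin t y) (site k) (Num.sqrt (r0 - r ^+ 2)).
  rewrite /zpin -pinned_upd; congr (pinned _ _); apply/funext => l.
  by rewrite tnth_set_tnth; case: eqP => // _; rewrite h'.
have xE r : xpin t (y' r) = upd (xpin t y) (site k) r.
  rewrite /xpin -pinned_upd; congr (pinned _ _); apply/funext => l.
  by rewrite tnth_set_tnth; case: eqP => // _; rewrite tnth_set_tnth eqxx.
have pE r : perp (y' r) = perp (set_tnth y k u).
  apply: eq_bigr => c _; congr quad; congr (pinned _ _); apply/funext => l.
  by rewrite !tnth_set_tnth; case: eqP => // _; rewrite tnth_set_tnth.
under eq_Rintegral.
  move=> r _; rewrite -/(y' r) /flux_at zE xE /density pE.
  rewrite (bigD1 k)//= tnth_set_tnth eqxx h'.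
  rewrite [X in _ * (_ * (_ * X))](_ : _ =
      \prod_(l | l != k) (Num.max eps (height (tnth y l)))^-1); last first.
    by apply: eq_bigr => l /negbTE lk; rewrite tnth_set_tnth lk.
  rewrite (mulrC (expR _)) -!mulrA.
  over.
apply: (Rintegral_flux0 b_sym bF eps0 F_vanish F_der) => //.
- exact: site_neq.
- by rewrite gerBl sumr_ge0// => c _; exact: sqr_ge0.
- apply: (@pinned_ind _ _ _ _ _ (fun _ r => 0 <= r <= 1)) => [|l].
    by rewrite ct cos_le1.
  exact: height_le1.
Qed.

(** Fubini twice: the spin at [site k] is integrated first, and within it the coordinate [ord0]. *)
Lemma Rintegral_flux_at0 i t : i != a -> 0 <= cos t ->
  \int[power_measure (lebesgueRn R n.+1) m]_y flux_at i t y = 0.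
Proof.
move=> /siteP[k iE] ct.
have [mf [M fM] f0] := bounded_flux_at i t.
have mitv : measurable (`[(-1)%R, 1%R]%classic : set (measurableTypeR R)).
  exact: measurable_itv.
apply: (@integral_power_measure0 _ _ _ _ _ _ _ k _ cube1_lty) => //.
  exact: measurable_box.
  exact: bounded_flux_at.
move=> y; apply: (@integral_power_measure0 _ _ _ _ _ _ _ ord0 mitv itv11_lty).
  split.
  - by apply: measurableT_comp => //; exact: measurable_set_tnth.
  - by exists M.
  - move=> u nu; apply: f0 => /(_ k); rewrite tnth_set_tnth eqxx; exact: nu.
by move=> u; exact: Rintegral_slice0.
Qed.

Definition rotated t := \int[nu]_y weight_at a t y.

(** The pinned spin [(cos t, sin t)] moves with velocity [(- sin t, cos t)], which is the rotation
    field at [a]. *)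
Lemma is_derive_weight_at t y : 0 <= cos t -> gam < cos t ->
  is_derive t 1 (fun v : R => weight_at a v y) (flux_at a t y).
Proof.
move=> ct gct.
have zE (v : R) : zpin v y = upd (zpin t y) a (cos v) by exact: pinned_upd_pin.
have xE (v : R) : xpin v y = upd (xpin t y) a (sin v) by exact: pinned_upd_pin.
rewrite (_ : (fun v : R => _) = fun v : R =>
    weighted a (upd (zpin t y) a (cos v)) (upd (xpin t y) a (sin v)) * density y); last first.
  by apply/funext => v; rewrite /weight_at zE xE.
have za : zpin t y a = cos t by rewrite /zpin pinned_pin.
have xa : xpin t y a = sin t by rewrite /xpin pinned_pin.
have dF : is_derive (zpin t y a) 1 (fun r => F a (upd (zpin t y) a r))
    (\sum_j b a j * zpin t y j * (F j (zpin t y) - F a (zpin t y))).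
  apply: F_der => [|_]; last by rewrite za.
  apply: (@pinned_ind _ _ _ _ _ (fun _ r => 0 <= r <= 1)) => [|l].
    by rewrite ct cos_le1.
  exact: height_le1.
have dw := is_derive_weighted b_sym dF za xa (is_derive_cos t) (is_derive_sin t).
apply: is_derive_eq.
rewrite /flux_at fluxE za xa /GRing.scale/=; ring.
Qed.

Lemma continuous_rotated : continuous rotated.
Proof.
move=> t; have [C C0 wC] := weight_at_bound.
pose G y := C * \1_cube y.
have tI : t \in `]t - 1, t + 1[%classic.
  by rewrite inE/= in_itv/= gtrBl ltrDl ltr01.
apply: (@continuity_under_integral _ _ _ nu (weight_at a) _ measurableT _ _ _ _ G _ _ _ tI).
- move=> u _; apply: cube_integrable.
  exact: bounded_weight_at.
- apply: aeW => y _ u _; apply: cvgM; last exact: cvg_cst.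
  apply: (@continuous_weighted _ _ _ _ _ _ (fun j v => zpin v y j) (fun j v => xpin v y j)) => // j.
    rewrite /zpin /pinned; case: insub => [?|]; first exact: cvg_cst.
    exact: continuous_cos.
  rewrite /xpin /pinned; case: insub => [?|]; first exact: cvg_cst.
  exact: continuous_sin.
- exact: indic_cube_integrable.
- move=> u _; apply: aeW => y _; rewrite /G indicE.
  have [wb [[_ cy]|->]] := wC a u y; first by rewrite mem_set// mulr1.
  by rewrite normr0 mulr_ge0.
Qed.

Lemma is_derive_rotated (t u v : R) : u < t < v ->
  (forall w, u < w < v -> 0 <= cos w /\ gam < cos w) -> is_derive t 1 rotated 0.
Proof.
move=> tuv cw.
have dw w y : `]u, v[%classic w -> is_derive w 1 (fun s => weight_at a s y) (flux_at a w y).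
  by rewrite /= in_itv/= => /cw[]; exact: is_derive_weight_at.
have [C C0 fC] := flux_at_bound.
pose G y := C * \1_cube y.
have tI : `]u, v[%classic t by rewrite /= in_itv.
have iw w : `]u, v[%classic w -> nu.-integrable setT
    (EFin \o weight_at a w).
  move=> _; apply: cube_integrable.
  exact: bounded_weight_at.
have derw w y : `]u, v[%classic w -> [set: conf] y -> derivable (weight_at a ^~ y) w 1.
  by move=> wI _; apply: ex_derive; exact: dw.
have G0 y : 0 <= G y by rewrite mulr_ge0// indicE.
have iG : nu.-integrable setT (EFin \o G).
  exact: indic_cube_integrable.
have pE w y : `]u, v[%classic w -> partial1of2 (weight_at a) w y = flux_at a w y.
  by move=> wI; rewrite partial1of2E; apply: derive_val; exact: dw.
have Gub w y : `]u, v[%classic w -> [set: conf] y ->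
    `|partial1of2 (weight_at a) w y| <= G y.
  by move=> wI _; rewrite pE.
apply: DeriveDef.
  exact: (derivable_under_integral measurableT tI iw derw G0 iG Gub).
rewrite -derive1E (differentiation_under_integral measurableT tI iw derw G0 iG Gub).
under eq_Rintegral do rewrite pE//.
have ct : 0 <= cos t by case: (cw t).
have iflux i : nu.-integrable setT
    (EFin \o flux_at i t).
  apply: cube_integrable.
  exact: bounded_flux_at.
have : \sum_i \int[nu]_y flux_at i t y = 0.
  rewrite -Rintegral_sum//.
  under eq_Rintegral do rewrite /flux_at -mulr_suml (sum_flux b_sym) mul0r.
  by rewrite [LHS]Rintegral_cst// mul0r.
rewrite (bigD1 a)//= [X in _ + X = _]big1 ?addr0// => i ia.
exact: Rintegral_flux_at0.
Qed.

Lemma rotated_eq (u v : R) : u <= v ->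
  (forall w, u < w < v -> 0 <= cos w /\ gam < cos w) -> rotated u = rotated v.
Proof.
rewrite le_eqVlt => /predU1P[->//|uv] cw; apply/eqP; rewrite eq_sym -subr_eq0.
have [|w _ ->] := @MVT _ rotated (cst 0) u v uv _ (continuous_subspaceT continuous_rotated).
  by move=> w; rewrite in_itv/= => wI; exact: is_derive_rotated cw.
by rewrite mul0r.
Qed.

End hemispheres.

(** * The pinned expectation in terms of the quadratic form *)

Section energy.
Context (R : realType) (Lam : finType) (b : Lam -> Lam -> R).

(** For unit vectors the squared distance is 2 minus twice the inner product, which splits over the
    components. *)
Lemma energy_quad n (u : Lam -> spin R n) :
  (forall i, \sum_k tnth (u i) k ^+ 2 = 1) ->
  energy b u = 2^-1 * (\sum_i \sum_j b i j) - \sum_k quad b (fun i => tnth (u i) k).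
Proof.
move=> u1; have sqE i j : sqdist (u i) (u j) =
    2 - 2 * \sum_k tnth (u i) k * tnth (u j) k.
  rewrite /sqdist (_ : 2 = 1 + 1 :> R)// -{1}(u1 i) -{1}(u1 j) mulr_sumr.
  rewrite -big_split -sumrB /=; apply: eq_bigr => k _; ring.
rewrite /energy /quad -mulr_sumr -mulrBr.
rewrite [X in _ - X]exchange_big/=.
under [X in _ - X]eq_bigr do rewrite exchange_big/=.
rewrite -sumrB (_ : 4^-1 = 2^-1 * 2^-1 :> R); last by field.
rewrite -mulrA; congr (_ * _); rewrite mulr_sumr; apply: eq_bigr => i _.
rewrite -sumrB mulr_sumr; apply: eq_bigr => j _.
by rewrite sqE -mulr_sumr; field.
Qed.

End energy.

Section spins.
Context (R : realType).

Lemma tnth_hemi n (y : n.-tuple R) (c : 'I_n) : tnth (hemi y) (lift ord0 c) = tnth y c.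
Proof. by rewrite tnthS. Qed.

Lemma hemi_unit n (y : n.-tuple R) : open_ball y -> \sum_k tnth (hemi y) k ^+ 2 = 1.
Proof.
move=> yb; rewrite big_ord_recl/= {1}/hemi tnth0 sqr_sqrtr; last first.
  by rewrite subr_ge0 ltW.
under eq_bigr do rewrite tnth_hemi.
by rewrite subrK.
Qed.

Lemma nth_spin0 n k : (k < n.+1)%N -> (spin0 R n)`_k = (k == 0)%:R.
Proof. by move=> kn; rewrite -(tnth_nth 0 (spin0 R n) (Ordinal kn)) tnth_mktuple. Qed.

Lemma tnth_rotation_spin0 n (t : R) (k : 'I_n.+2) :
  tnth (rotation t (spin0 R n.+1)) k =
  if val k == 0%N then cos t else if val k == 1%N then sin t else 0.
Proof.
rewrite tnth_mktuple !nth_spin0//= mulr1 !mulr0 subr0 addr0.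
by case: (val k) => [|[|]]//=; rewrite mulr1.
Qed.

Lemma rotation_spin0_unit n (t : R) :
  \sum_k tnth (rotation t (spin0 R n.+1)) k ^+ 2 = 1.
Proof.
rewrite !big_ord_recl/= !tnth_rotation_spin0/= big1 ?addr0 ?cos2Dsin2// => k _.
by rewrite tnth_rotation_spin0/= expr0n.
Qed.

End spins.

Section pinned_expectation.
Context (R : realType) (Lam : finType) (b : Lam -> Lam -> R).
Variable F : Lam -> (Lam -> R) -> R.
Variables (a : Lam) (eps : R).
Hypotheses (b_ge0 : forall i j, 0 <= b i j) (bF : forall i, bucont (F i)).
Hypothesis eps0 : 0 < eps.
Hypothesis F_vanish : forall i l j, j != a -> l j <= eps -> F i l = 0.
Variable n : nat.
Local Notation m := #|{: {i : Lam | i != a}}|.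
Local Notation conf := (m.-tuple (n.+1.-tuple R)).
Implicit Types (y : conf) (t : R).

Lemma pinned_configE t y i :
  pinned_config (rotation t (spin0 R n.+1)) y i =
  pinned (fun k => hemi (tnth y k)) (rotation t (spin0 R n.+1)) i.
Proof. by []. Qed.

Lemma tnth_pinned_config0 t y i :
  tnth (pinned_config (rotation t (spin0 R n.+1)) y i) ord0 = zpin t y i.
Proof.
rewrite pinned_configE (pinned_comp (fun u : spin R n.+1 => tnth u ord0)).
by rewrite tnth_rotation_spin0.
Qed.

Lemma tnth_pinned_config1 t y i :
  tnth (pinned_config (rotation t (spin0 R n.+1)) y i) (lift ord0 ord0) = xpin t y i.
Proof.
rewrite pinned_configE (pinned_comp (fun u : spin R n.+1 => tnth u (lift ord0 ord0))).
rewrite tnth_rotation_spin0; congr (pinned _ _ _); apply/funext => k.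
exact: tnth_hemi.
Qed.

Lemma tnth_pinned_config2 t y i (c : 'I_n) :
  tnth (pinned_config (rotation t (spin0 R n.+1)) y i) (lift ord0 (lift ord0 c)) =
  pinned (fun k => tnth (tnth y k) (lift ord0 c)) 0 i.
Proof.
rewrite pinned_configE.
rewrite (pinned_comp (fun u : spin R n.+1 => tnth u (lift ord0 (lift ord0 c)))).
rewrite tnth_rotation_spin0/=; congr (pinned _ _ _); apply/funext => k.
exact: tnth_hemi.
Qed.

Lemma zcoord_pinned_config t y i :
  zcoord (pinned_config (rotation t (spin0 R n.+1)) y i) = zpin t y i.
Proof. by rewrite -tnth_pinned_config0 (tnth_nth 0). Qed.

Lemma energy_pinned_config t y : (forall k, open_ball (tnth y k)) ->
  - energy b (pinned_config (rotation t (spin0 R n.+1)) y) =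
  - (2^-1 * \sum_i \sum_j b i j) +
  (quad b (zpin t y) + quad b (xpin t y) + perp b y).
Proof.
move=> yb; rewrite energy_quad => [|i]; last first.
  rewrite pinned_configE; apply: (@pinned_ind _ _ _ _ _ (fun _ u => \sum_k tnth u k ^+ 2 = 1)).
    exact: rotation_spin0_unit.
  by move=> k; exact: hemi_unit.
rewrite opprB addrC; congr (_ + _); rewrite !big_ord_recl /perp addrA.
congr (quad b _ + quad b _ + _).
- by apply/funext => i; rewrite tnth_pinned_config0.
- by apply/funext => i; rewrite tnth_pinned_config1.
- apply: eq_bigr => c _; congr (quad b _); apply/funext => i.
  exact: tnth_pinned_config2.
Qed.

(** The prefactor is the constant part of the energy. The integrands also agree where the cut-off in
    the density acts, since [F a] vanishes there, and outside the balls, where the square root of a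
    nonpositive number is 0 and so the height is below [eps]. *)
Lemma pinned_expectation_rotated t (f : (Lam -> spin R n.+1) -> R) :
  (forall y, (forall k, open_ball (tnth y k)) ->
    f (pinned_config (rotation t (spin0 R n.+1)) y) = F a (zpin t y)) ->
  pinned_expectation b a (rotation t (spin0 R n.+1)) f =
  expR (- (2^-1 * \sum_i \sum_j b i j)) * @rotated R Lam b F a eps n t.
Proof.
move=> fF; rewrite /pinned_expectation Rintegral_mkcond /rotated.
rewrite -RintegralZl//; last first.
  exact/cube_integrable/bounded_weight_at.
apply: eq_Rintegral => y _; rewrite patchE.
have small k : height (tnth y k) <= eps -> F a (zpin t y) = 0.
  by move=> hk; apply: (F_vanish _ (site_neq k)); rewrite /zpin pinned_site.
case: ifPn => [/set_mem yb|/negP].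
  rewrite fF// energy_pinned_config// [in LHS]expRD [in LHS]expRD.
  rewrite /weight_at /weighted /density.
  have [[k hk]|nk] := pselect (exists k, height (tnth y k) <= eps).
    by rewrite (small k)// !mul0r mulr0.
  rewrite [X in _ = _ * (_ * (_ * X))](_ : _ =
      \prod_k (zcoord (hemi (tnth y k)))^-1); last first.
    apply: eq_bigr => k _; congr (_^-1); apply/max_idPr; rewrite leNgt.
    by apply/negP => /ltW hk; apply: nk; exists k.
  ring.
rewrite inE /= => /existsNP[k yk]; rewrite /weight_at /weighted (small k) ?mul0r ?mulr0//.
rewrite (le_trans _ (ltW eps0))// /height ler0_sqrtr// subr_le0 leNgt.
exact/negP.
Qed.

End pinned_expectation.

(** * Extension of the observable from the cube *)

Section pointwise_topology.
Context (R : realType) (Lam : finType).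
Implicit Types (l x : Lam -> R) (K : set {ptws Lam -> R}) (f : (Lam -> R) -> R).

(** The boxes form a filter that converges to [x] in each coordinate, hence contains all
    neighbourhoods in the product topology. *)
Lemma ptws_nbhs_box x (A : set (Lam -> R)) : nbhs (x : {ptws Lam -> R}) A ->
  exists2 r : R, 0 < r & forall l, (forall j, `|x j - l j| < r) -> A l.
Proof.
pose F := filter_from [set r : R | 0 < r] (fun r => [set l | forall j, `|x j - l j| < r]).
have FF : Filter F.
  apply: filter_from_filter; first by exists 1 => /=.
  move=> r s /= r0 s0; exists (Num.min r s) => /=; first by rewrite lt_min r0.
  by move=> l lrs; split => j; have := lrs j; rewrite lt_min => /andP[].
have Fx : {ptws, F --> x}.
  apply/cvg_sup => j; apply/cvg_image.
    by apply/seteqP; split => // v _; exists (cst v).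
  have Fj : (fun l : Lam -> R => l j) @ F --> x j.
    by apply/cvgrPdist_lt => r r0; exists r => // l /=; exact.
  move=> W Wx; exists (fun l => W (l j)); first exact: Fj Wx.
  apply/seteqP; split => [_ [l Wl <-]//|v Wv].
  by exists (fun=> v).
by move=> xA; have [r r0 rA] := Fx A xA; exists r.
Qed.

Lemma ptws_box_nbhs x (r : R) : 0 < r ->
  \forall l \near (x : {ptws Lam -> R}), forall j, `|x j - l j| < r.
Proof.
move=> r0; apply: (@filter_forall _ _ _ (nbhs (x : {ptws Lam -> R}))) => j.
apply: (@proj_continuous Lam (fun=> R) j x (ball (x j) r)).
exact: nbhsx_ballx.
Qed.

(** Compactness in its near-covering form: a radius that works near each point of [K] can be chosen
    for all of [K]. *)
Lemma ptws_compact_ucont K f : compact K ->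
  (forall x, K x -> {for x, continuous (f : {ptws Lam -> R} -> R)}) ->
  forall e : R, 0 < e -> exists2 d : R, 0 < d &
    forall x l, K x -> (forall j, `|x j - l j| <= d) -> `|f x - f l| <= e.
Proof.
move=> /compact_near_coveringP cK cf e e0.
have [] := near_right_ex (cK _ (0^'+) (fun d x => forall l,
    (forall j, `|x j - l j| <= d) -> `|f x - f l| <= e) _ _).
  move=> x Kx.
  have e2 : 0 < e / 2 by rewrite divr_gt0.
  have /cvgrPdist_lt/(_ _ e2) /ptws_nbhs_box [r r0 rf] := cf x Kx.
  have r2 : 0 < r / 2 by rewrite divr_gt0.
  exists ([set l | forall j, `|x j - l j| < r / 2], [set d | 0 < d < r / 2]).
    split; first exact: ptws_box_nbhs.
    exact: (near_right_of r2).
  move=> [x' d] /= [x'r /andP[d0 dr]] l x'l.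
  have fx' : `|f x - f x'| < e / 2.
    by apply: rf => j; apply: lt_trans (x'r j) _; lra.
  have fl : `|f x - f l| < e / 2.
    apply: rf => j; rewrite -(subrKA (x' j)) (le_lt_trans (ler_normD _ _))//.
    by have := x'r j; have := x'l j; lra.
  rewrite -(subrKA (f x)) (le_trans (ler_normD _ _))// (distrC (f x')).
  by move: fx' fl; lra.
move=> d d0 h; exists (d / 2); first by rewrite divr_gt0.
move=> x l Kx xl; apply: h Kx _ xl.
by rewrite divr_gt0//= ltr_pdivrMr//; lra.
Qed.

(** The same covering argument, with the bound written as [d^-1] so that it weakens as [d] decreases
    to 0. *)
Lemma ptws_compact_bounded K f : compact K ->
  (forall x, K x -> {for x, continuous (f : {ptws Lam -> R} -> R)}) ->
  exists M : R, forall x, K x -> `|f x| <= M.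
Proof.
move=> /compact_near_coveringP cK cf.
have [//|] := near_right_ex (cK _ (0^'+) (fun d x => `|f x| <= d^-1) _ _).
  move=> x Kx.
  have /cvgrPdist_lt/(_ _ ltr01) fx := cf x Kx.
  pose r := (`|f x| + 1)^-1; have r0 : 0 < r by rewrite invr_gt0 ltr_wpDl.
  exists ([set l | `|f x - f l| < 1], [set d : R | 0 < d < r]).
    split; first exact: fx.
    exact: (near_right_of r0).
  move=> [l d] /= [fl /andP[d0 dr]].
  apply: (@le_trans _ _ (`|f x| + 1)).
    have : `|f l| <= `|f x| + `|f l - f x|.
      by rewrite -[X in `|X| <= _](subrK (f x)) addrC ler_normD.
    by rewrite distrC; lra.
  by rewrite -[leLHS]invrK lef_pV2 ?posrE// ltW.
move=> d d0 h; exists (d / 2)^-1 => x; apply: h.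
by rewrite divr_gt0//= ltr_pdivrMr//; lra.
Qed.

Lemma ptws_compact_gt0 K : compact K -> (forall x, K x -> forall j, 0 < x j) ->
  exists2 d : R, 0 < d & forall x, K x -> forall j, d <= x j.
Proof.
move=> /compact_near_coveringP cK K0.
have [//|] := near_right_ex (cK _ (0^'+) (fun d x => forall j, d <= x j) _ _).
  move=> x Kx.
  have [r r0 rx] : exists2 r : R, 0 < r & forall j, r <= x j.
    exists (\big[Num.min/1]_j x j); last by move=> j; exact: bigmin_le_cond.
    by apply: lt_bigmin => // j _; exact: K0.
  have r2 : 0 < r / 2 by rewrite divr_gt0.
  exists ([set l | forall j, `|x j - l j| < r / 2], [set d : R | 0 < d < r / 2]).
    split; first exact: ptws_box_nbhs.
    exact: (near_right_of r2).
  move=> [l d] /= [xl /andP[d0 dr]] j.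
  by have := xl j; rewrite ltr_norml; have := rx j; lra.
move=> d d0 h; exists (d / 2); first by rewrite divr_gt0.
move=> x; apply: h.
by rewrite divr_gt0//= ltr_pdivrMr//; lra.
Qed.

End pointwise_topology.

Section extension.
Context (R : realType) (Lam : finType).
Implicit Types (l x : Lam -> R) (g : (Lam -> R) -> R).

(** For [eps <= 1], a retraction onto the compact box [[eps, 1]^Lam], Lipschitz with constant 1 in
    each coordinate. *)
Let clip (eps : R) l : Lam -> R := fun j => Num.max eps (Num.min 1 (l j)).

Let clip_lip (eps : R) l l' j : `|clip eps l j - clip eps l' j| <= `|l j - l' j|.
Proof.
have half (u v : R) : v <= u ->
    `|Num.max eps (Num.min 1 u) - Num.max eps (Num.min 1 v)| <= `|u - v|.
  move=> vu; rewrite [leRHS]ger0_norm ?subr_ge0// ger0_norm; last first.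
    by rewrite /Order.max /Order.min; repeat case: ifPn; rewrite -?leNgt => *; lra.
  by rewrite /Order.max /Order.min; repeat case: ifPn; rewrite -?leNgt => *; lra.
have [ll|ll] := leP (l' j) (l j); first exact: half.
by rewrite distrC (distrC (l j)); apply: half; exact: ltW.
Qed.

Let clip_itv (eps : R) l j : eps <= 1 -> eps <= clip eps l j <= 1.
Proof.
move=> e1; rewrite /clip /Order.max /Order.min.
by repeat case: ifPn; rewrite -?leNgt => *; apply/andP; split; lra.
Qed.

Let clip_id (eps : R) l j : eps <= l j <= 1 -> clip eps l j = l j.
Proof.
move=> /andP[? ?]; rewrite /clip /Order.max /Order.min.
by repeat case: ifPn; rewrite -?leNgt => *; lra.
Qed.

Let clip_small (eps : R) l j : eps <= 1 -> l j <= eps -> clip eps l j = eps.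
Proof.
move=> ? ?; rewrite /clip /Order.max /Order.min.
by repeat case: ifPn; rewrite -?leNgt => *; lra.
Qed.

(** Compact support makes [g] vanish wherever a coordinate is less than some [d > 0]. The smooth
    extension [f] precomposed with the retraction onto [[eps, 1]^Lam], for [eps < d], is bounded and
    uniformly continuous by compactness. Where the retraction moves a point of the cube, both values
    are 0. *)
Lemma bucont_extension g (gam : R) : smooth_on_cube g -> compactly_supported_on_cube g ->
  0 < gam <= 1 -> exists (eps : R) (g0 : (Lam -> R) -> R),
  [/\ 0 < eps < gam, bucont g0, forall l j, l j <= eps -> g0 l = 0 &
      forall l, unit_cube l -> g0 l = g l].
Proof.
move=> [U [f [oU cU fU fg]]] cK /andP[gam0 gam1].
have [|d d0 Kd] := ptws_compact_gt0 cK.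
  by move=> x [xc _] j; have /andP[] := xc j.
have g_small l j : unit_cube l -> l j < d -> g l = 0.
  move=> lc lj; apply/eqP/negPn/negP => /eqP gl.
  have : d <= l j by apply: Kd; split => //; exact: subset_closure.
  by rewrite leNgt lj.
(* The halves make [eps] strictly less than both [gam] and [d]. *)
pose eps := Num.min (gam / 2) (d / 2).
have eps0 : 0 < eps by rewrite lt_min !divr_gt0.
have epsgam : eps < gam.
  by apply: (@le_lt_trans _ _ (gam / 2)); [rewrite ge_min lexx|lra].
have epsd : eps < d.
  by apply: (@le_lt_trans _ _ (d / 2)); [rewrite ge_min lexx orbT|lra].
have eps1 : eps <= 1 by lra.
pose B : set {ptws Lam -> R} := [set l | forall j, `[eps, 1]%classic (l j)].
have cB : compact B.
  apply: (@tychonoff Lam (fun=> R) (fun=> `[eps, 1]%classic)) => j.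
  exact: segment_compact.
have BU l : B l -> unit_cube l.
  move=> Bl j; have := Bl j; rewrite /= in_itv/= => /andP[le l1].
  by rewrite (lt_le_trans eps0 le).
have cf x : B x -> {for x, continuous (f : {ptws Lam -> R} -> R)}.
  by move=> /BU/cU Ux; have [] := fU [::] x Ux.
have clipB l : B (clip eps l).
  by move=> j; rewrite /= in_itv/=; exact: clip_itv.
exists eps, (fun l => f (clip eps l)); split.
- by rewrite eps0.
- split.
    move=> e e0; have [r r0 fr] := ptws_compact_ucont cB cf e0.
    exists r => // l l' ll'; apply: fr => // j.
    by rewrite (le_trans (clip_lip _ _ _ _)).
  by have [M fM] := ptws_compact_bounded cB cf; exists M => l; exact: fM.
- move=> l j lj; rewrite fg; last exact: BU.
  by apply: (g_small _ j); [exact: BU|rewrite clip_small].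
- move=> l lc; rewrite fg; last exact: BU.
  have [[j lj]|nl] := pselect (exists j, l j < eps).
    rewrite (g_small l j)//; last exact: lt_trans lj _.
    by apply: (g_small _ j); [exact: BU|rewrite clip_small// ltW].
  congr g; apply/funext => j; apply: clip_id; have /andP[_ ->] := lc j.
  by rewrite andbT leNgt; apply/negP => lj; apply: nl; exists j.
Qed.

End extension.

(** * Rotation from the pole to the angle [s] *)

Lemma rotation0_spin0 (R : realType) n : rotation 0 (spin0 R n.+1) = spin0 R n.+1.
Proof.
apply: eq_from_tnth => k; rewrite tnth_rotation_spin0 tnth_mktuple cos0 sin0.
by case: eqP => //= _; case: eqP.
Qed.

Lemma cos_gt_abs (R : realType) (s w : R) : `|w| < `|s| -> `|s| < pi / 2 -> cos s < cos w.
Proof.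
have cosE (x : R) : cos x = cos `|x| by case: (ger0P x) => // _; rewrite cosN.
move=> ws spi; rewrite (cosE s) (cosE w) ltr_cos ?in_itv/=; first exact: ws.
  by rewrite normr_ge0/=; move: spi; have := pi_gt0 R; lra.
by rewrite normr_ge0/=; move: spi ws; have := pi_gt0 R; lra.
Qed.

Theorem theorem4p5 (R : realType) (n : nat) (n_gt0 : (0 < n)%N)
    (Lam : finType) (beta : Lam -> Lam -> R)
    (beta_sym : forall i j, beta i j = beta j i)
    (beta_ge0 : forall i j, 0 <= beta i j)
    (beta_connected : forall i j, connect (fun k l => 0 < beta k l) i j)
    (d : measure_display) (Om : measurableType d) (X : R -> Om -> Lam)
    (P : Lam -> (Lam -> R) -> probability Om R)
    (P_vdjp : forall v l0, unit_cube l0 -> is_vdjp beta X v l0 (P v l0))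
    (g : (Lam -> R) -> R) (g_smooth : smooth_on_cube g)
    (g_supp : compactly_supported_on_cube g)
    (a : Lam) (s : R) (s_itv : - (pi / 2) < s < pi / 2) :
  pinned_expectation beta a (spin0 R n)
    (fun u => let z := fun i => zcoord (u i) in
       fine 'E_(P a z)[fun w =>
         let tau := hitting_time X z a (cos s) w in
         g (diminished X z (fine tau) w) * (tau < lifetime X z w)%E%:R])
  = pinned_expectation beta a (rotation s (spin0 R n))
      (fun u => g (fun i => zcoord (u i))).
Proof.
(* In the form [n.+1] the spins have a component [x] for the rotation to mix with [z]. *)
case: n n_gt0 => [n_gt0|n _]; first by exfalso; rewrite ltnn in n_gt0.
have gam0 : 0 < cos s by exact: cos_gt0_pihalf.
have gam01 : 0 < cos s <= 1 by rewrite gam0 cos_le1.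
have [eps [g0 [/andP[eps0 epsgam] bg0 g0_vanish g0E]]] :=
  bucont_extension g_smooth g_supp gam01.
have [F [bF F_vanish F_stop F_der]] :=
  backward_solution beta_ge0 a eps0 epsgam bg0 g0_vanish.
have F_gam l : unit_cube l -> l a = cos s -> F a l = g l.
  by move=> lc la; rewrite F_stop ?la// -la upd_id g0E.
(* On [[0, 1]], the range of the heights, the truncation [clip2] disappears. *)
have F_der1 i l : (forall j, 0 <= l j <= 1) -> (i = a -> cos s < l a) ->
    is_derive (l i) 1 (fun r => F i (upd l i r))
      (\sum_j beta i j * l j * (F j l - F i l)).
  move=> l01 ia; rewrite (_ : \sum_j _ = drift beta F i l).
    by apply: F_der => //; have := l01 i; lra.
  apply: eq_bigr => j _; rewrite clip2_id//.
  by have := l01 j; lra.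
have cube_zpin (t : R) (y : #|{: {i : Lam | i != a}}|.-tuple (n.+1.-tuple R)) :
    0 < cos t -> (forall k, open_ball (tnth y k)) -> unit_cube (zpin t y).
  move=> ct yb; apply: (@pinned_ind _ _ _ _ _ (fun _ r => 0 < r <= 1)) => [|k].
    by rewrite ct cos_le1.
  have /andP[_ ->] := height_le1 (tnth y k).
  by rewrite andbT sqrtr_gt0 subr_gt0; exact: yb.
have zcoordE (t : R) (y : #|{: {i : Lam | i != a}}|.-tuple (n.+1.-tuple R)) :
    (fun i => zcoord (pinned_config (rotation t (spin0 R n.+1)) y i)) = zpin t y.
  by apply/funext => i; exact: zcoord_pinned_config.
have rotE := @pinned_expectation_rotated R Lam beta F a eps beta_ge0 bF eps0 F_vanish n.
(* The pole is the rotation by the angle 0; there the inner expectation equals [F a] by the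
   martingale identity. *)
rewrite -{1}rotation0_spin0 rotE; last first.
  move=> y yb; rewrite /= zcoordE.
  have zc : unit_cube (zpin 0 y) by apply: cube_zpin; rewrite ?cos0.
  apply: (stopped_expectation beta_ge0 (P_vdjp a _ zc) zc gam0 bF _ _ F_der).
  - by move=> i l j ja lj; apply: F_vanish ja _; rewrite (le_trans lj)// ltW.
  - by move=> l la; rewrite F_stop// [RHS]F_stop /upd ?eqxx// -/(upd _ _ _) -/(upd _ _ _) upd_upd.
  - by rewrite /zpin pinned_pin cos0 cos_le1.
  - exact: F_gam.
(* At the angle [s] the height at [a] is already [cos s], so [F a] reduces to [g]. *)
rewrite rotE; last first.
  move=> y yb; rewrite /= zcoordE F_gam; first by [].
    exact: cube_zpin.
  by rewrite /zpin pinned_pin.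
apply: (congr1 ( *%R _)).
have rot := rotated_eq beta_ge0 beta_sym bF eps0 F_vanish F_der1 n.
have spi : `|s| < pi / 2 by rewrite ltr_norml.
(* Strictly between 0 and [s] the height at [a] exceeds [cos s], so the backward equation at [a] is
   available. *)
have cosw (w : R) : `|w| < `|s| -> 0 <= cos w /\ cos s < cos w.
  by move=> ws; have sw := cos_gt_abs ws spi; rewrite (ltW (lt_trans gam0 sw)).
have [s0|s0] := leP 0 s.
  apply: rot => // w /andP[w0 ws]; apply: cosw.
  by rewrite (ger0_norm s0) gtr0_norm.
apply/esym; apply: rot; first exact: ltW.
move=> w /andP[sw w0]; apply: cosw.
by rewrite (ltr0_norm s0) ltr0_norm// ltrN2.
Qed.
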